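(* Let $V$ be an $\mathbb{F}_q$-vector space of finite dimension $r\ge1$, let $G:=\operatorname{Aut}_{\mathbb{F}_q}(V)$, let $G'\subset G$ be the subgroup of automorphisms of determinant $1$, and let $U$ be a maximal unipotent subgroup of $G$. Then: (a) $Q_V/U\cong\mathbb{P}^{r-1}_{\mathbb{F}_q}$ and the projection $Q_V\to Q_V/U$ is finite and flat of degree $q^{\frac{r(r-1)}2}$. The other quotients are weighted projective spaces over $\mathbb{F}_q$ of the following weights: (b) $P_V/U$ has weights $1,q,\ldots,q^{r-1}$. (c) $Q_V/G$ has weights $q-1,q^2-1,\ldots,q^r-1$. (d) $P_V/G$ has weights $q^r-1,q^r-q,\ldots,q^r-q^{r-1}$. (e) $Q_V/G'$ has weights $q-1,\ldots,q^{r-1}-1,\frac{q^r-1}{q-1}$. (f) $P_V/G'$ has weights $\frac{q^r-1}{q-1},q^r-q,\ldots,q^r-q^{r-1}$.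
   Context: $\mathbb{F}_q$ is a finite field with $q$ elements. $S_V$ is the symmetric algebra of $V$ over $\mathbb{F}_q$ with its standard grading, $K_V$ its field of quotients, and $R_V\subset K_V$ the $\mathbb{F}_q$-subalgebra generated by $\frac1v$ for all $v\in V\setminus\{0\}$; here $R_V$ is regarded as graded in degrees $\ge0$ with each $\frac1v$ of degree $1$. Set $P_V:=\operatorname{Proj}S_V\cong\mathbb{P}^{r-1}_{\mathbb{F}_q}$ and $Q_V:=\operatorname{Proj}R_V$. The groups $U\subset G\supset G'$ act by functoriality on $S_V$, $R_V$, $P_V$, $Q_V$, and the associated quotient varieties are obtained by applying $\operatorname{Proj}$ to the respective graded subrings of invariants (e.g. $Q_V/U=\operatorname{Proj}R_V^U$). In a suitable basis of $V$ the group $U$ corresponds to the upper-triangular matrices with all diagonal entries $1$. For positive integers $d_1,\ldots,d_r$ and a field $k$, the weighted projective space of weights $d_1,\ldots,d_r$ over $k$ is $\operatorname{Proj}k[T_1,\ldots,T_r]$ where $T_i$ is homogeneous of degree $d_i$. *)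

(* Defs.v *)
From HB Require Import structures.
From mathcomp Require Import all_boot all_order all_algebra.
From mathcomp Require Import boolp classical_sets topology_structure.
From mathcomp Require Import mpoly.

Set Implicit Arguments.
Unset Strict Implicit.
Unset Printing Implicit Defensive.

Import GRing.Theory.

Local Open Scope classical_set_scope.
Local Open Scope ring_scope.

Record opens (T : topologicalType) := Opens {
  oset :> set T;
  oset_open : open oset
}.

Definition invertible (A : comPzRingType) (a : A) : Prop := exists b, a * b = 1.

(* The last two axioms say that the stalks are local rings, i.e. that they are
   nonzero and that for every element s, one of s and 1 - s is a unit; a germ
   is a unit iff some representative is invertible.  [scal] is the structure
   morphism to Spec k. *)
Record lrSpace (k : fieldType) := LRSpace {
  carrier :> topologicalType;
  sect : opens carrier -> comPzRingType;
  res : forall W W' : opens carrier,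
    oset W' `<=` oset W -> {rmorphism sect W -> sect W'};
  scal : forall W : opens carrier, {rmorphism k -> sect W};
  res_id : forall (W : opens carrier) (h : oset W `<=` oset W) (s : sect W),
    res h s = s;
  res_comp : forall (W W' W'' : opens carrier) (h : oset W' `<=` oset W)
    (h' : oset W'' `<=` oset W') (h'' : oset W'' `<=` oset W) (s : sect W),
    res h' (res h s) = res h'' s;
  res_scal : forall (W W' : opens carrier) (h : oset W' `<=` oset W) (c : k),
    res h (scal W c) = scal W' c;
  sect_sep : forall (W : opens carrier) (I : Type) (C : I -> opens carrier)
    (hC : forall i, oset (C i) `<=` oset W) (s t : sect W),
    oset W `<=` \bigcup_i oset (C i) ->
    (forall i, res (hC i) s = res (hC i) t) -> s = t;
  sect_glue : forall (W : opens carrier) (I : Type) (C : I -> opens carrier)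
    (hC : forall i, oset (C i) `<=` oset W) (s : forall i, sect (C i)),
    oset W `<=` \bigcup_i oset (C i) ->
    (forall i j (W' : opens carrier) (hi : oset W' `<=` oset (C i))
       (hj : oset W' `<=` oset (C j)), res hi (s i) = res hj (s j)) ->
    exists t : sect W, forall i, res (hC i) t = s i;
  stalk_neq0 : forall (W : opens carrier) (x : carrier),
    oset W x -> (1 : sect W) <> 0;
  stalk_local : forall (W : opens carrier) (x : carrier) (s : sect W),
    oset W x ->
    exists (W' : opens carrier) (h : oset W' `<=` oset W),
      oset W' x /\ (invertible (res h s) \/ invertible (res h (1 - s)))
}.

Arguments sect {k} l W.
Arguments res {k} l {W W'} h.
Arguments scal {k} l W.

Definition preim_opens (S T : topologicalType) (f : S -> T)
    (cf : continuous f) (W : opens T) : opens S :=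
  @Opens S (f @^-1` oset W) ((continuousP f).1 cf _ (oset_open W)).

Lemma preim_subset (S T : topologicalType) (f : S -> T)
  (cf : continuous f) (W W' : opens T) :
  oset W' `<=` oset W -> oset (preim_opens cf W') `<=` oset (preim_opens cf W).
Proof. by move=> h x; exact: h. Qed.

(* Morphisms of locally ringed spaces over k.  [mor_local] says that the
   homomorphisms induced on the stalks are local. *)
Record morphism (k : fieldType) (X Y : lrSpace k) := Morphism {
  mor :> X -> Y;
  mor_cont : continuous mor;
  pull : forall W : opens Y,
    {rmorphism sect Y W -> sect X (preim_opens mor_cont W)};
  pull_res : forall (W W' : opens Y) (h : oset W' `<=` oset W) (s : sect Y W),
    pull W' (res Y h s) = res X (preim_subset (cf := mor_cont) h) (pull W s);
  pull_scal : forall (W : opens Y) (c : k),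
    pull W (scal Y W c) = scal X (preim_opens mor_cont W) c;
  mor_local : forall (W : opens Y) (s : sect Y W) (x : X), oset W (mor x) ->
    (exists (W' : opens X) (h : oset W' `<=` oset (preim_opens mor_cont W)),
       oset W' x /\ invertible (res X h (pull W s))) ->
    exists (W' : opens Y) (h : oset W' `<=` oset W),
      oset W' (mor x) /\ invertible (res Y h s)
}.

Arguments pull {k X Y} f W : rename.

Definition mpreim (k : fieldType) (X Y : lrSpace k) (f : morphism X Y)
  (W : opens Y) : opens X := preim_opens (@mor_cont _ _ _ f) W.

Definition open_immersion (k : fieldType) (X Y : lrSpace k)
    (f : morphism X Y) : Prop :=
  [/\ injective f,
      forall W : set X, open W -> open (f @` W) &
      forall W : opens Y, oset W `<=` range f -> bijective (pull f W)].

Definition isomorphism (k : fieldType) (X Y : lrSpace k)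
    (f : morphism X Y) : Prop :=
  [/\ bijective f,
      forall W : set X, open W -> open (f @` W) &
      forall W : opens Y, bijective (pull f W)].

Definition isomorphic (k : fieldType) (X Y : lrSpace k) : Prop :=
  exists f : morphism X Y, isomorphism f.

Section Stalk.
Context {k : fieldType} (X : lrSpace k) (x : X).

Record germ_rep := GermRep {
  germ_nbhd : opens X;
  germ_mem : oset germ_nbhd x;
  germ_sect : sect X germ_nbhd
}.

HB.instance Definition _ := gen_eqMixin germ_rep.
HB.instance Definition _ := gen_choiceMixin germ_rep.

Definition germ_eqP (a b : germ_rep) : Prop :=
  exists (W : opens X) (ha : oset W `<=` oset (germ_nbhd a))
    (hb : oset W `<=` oset (germ_nbhd b)),
    oset W x /\ res X ha (germ_sect a) = res X hb (germ_sect b).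

Definition germ_eq (a b : germ_rep) : bool := `[< germ_eqP a b >].

Lemma openI_subproof (W W' : opens X) : open (oset W `&` oset W').
Proof. by apply: openI; exact: oset_open. Qed.

Definition opensI (W W' : opens X) : opens X :=
  @Opens X (oset W `&` oset W') (openI_subproof W W').

Lemma subIl (W W' : opens X) : oset (opensI W W') `<=` oset W.
Proof. by move=> y []. Qed.
Lemma subIr (W W' : opens X) : oset (opensI W W') `<=` oset W'.
Proof. by move=> y []. Qed.

Lemma germ_eq_refl : reflexive germ_eq.
Proof.
by move=> a; apply/asboolP; exists (germ_nbhd a), (fun y h => h), (fun y h => h);
  split=> //; exact: germ_mem.
Qed.

Lemma germ_eqP_sym a b : germ_eqP a b -> germ_eqP b a.
Proof. by move=> [W [ha [hb [Wx e]]]]; exists W, hb, ha; split. Qed.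

Lemma germ_eq_sym : ssrbool.symmetric germ_eq.
Proof. by move=> a b; apply/asboolP/asboolP; exact: germ_eqP_sym. Qed.

Lemma germ_eq_trans : transitive germ_eq.
Proof.
move=> b a c /asboolP[W [ha [hb [Wx e]]]] /asboolP[W' [hb' [hc [W'x e']]]].
apply/asboolP; exists (opensI W W').
exists (fun y h => ha y (subIl h)), (fun y h => hc y (subIr h)); split=> //.
rewrite -(res_comp ha (@subIl W W')) e.
rewrite -(res_comp hc (@subIr W W')) -e'.
rewrite (res_comp hb (@subIl W W') (fun y h => hb y (subIl h))).
by rewrite (res_comp hb' (@subIr W W') (fun y h => hb y (subIl h))).
Qed.

Canonical germ_equiv := EquivRel germ_eq germ_eq_refl germ_eq_sym germ_eq_trans.

Definition stalk : Type := {eq_quot germ_eq}%qT.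
HB.instance Definition _ : EqQuotient _ germ_eq stalk := EqQuotient.on stalk.
HB.instance Definition _ := Choice.on stalk.

Definition germ (W : opens X) (hx : oset W x) (s : sect X W) : stalk :=
  (\pi_stalk (GermRep hx s))%qT.

Lemma germ_eqE (W W' : opens X) (hx : oset W x) (hx' : oset W' x) s s' :
  germ hx s = germ hx' s' <-> germ_eqP (GermRep hx s) (GermRep hx' s').
Proof.
split=> [/eqmodP /=|h]; first by move=> /asboolP.
by apply/eqmodP; exact/asboolP.
Qed.

Lemma germ_res (W W' : opens X) (hx : oset W x) (hx' : oset W' x)
  (h : oset W' `<=` oset W) s : germ hx' (res X h s) = germ hx s.
Proof.
apply/germ_eqE; exists W', (fun y h => h), h; split=> //=.
by rewrite res_id.
Qed.

Lemma germ_repr (a : stalk) : germ (germ_mem (repr a)) (germ_sect (repr a)) = a.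
Proof. by rewrite -[RHS]reprK /germ; case: (repr a). Qed.

Lemma germP (a : stalk) : exists W (hx : oset W x) s, a = germ hx s.
Proof.
exists (germ_nbhd (repr a)), (germ_mem (repr a)), (germ_sect (repr a)).
by rewrite germ_repr.
Qed.

Lemma germ2P (a b : stalk) :
  exists W (hx : oset W x) s t, a = germ hx s /\ b = germ hx t.
Proof.
have [W [hx [s ->]]] := germP a; have [W' [hx' [s' ->]]] := germP b.
have hI : oset (opensI W W') x by split.
exists (opensI W W'), hI, (res X (@subIl W W') s), (res X (@subIr W W') s').
by rewrite !germ_res.
Qed.

Lemma germ3P (a b c : stalk) :
  exists W (hx : oset W x) s t u,
    [/\ a = germ hx s, b = germ hx t & c = germ hx u].
Proof.
have [W [hx [s [t [-> ->]]]]] := germ2P a b; have [W' [hx' [s' ->]]] := germP c.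
have hI : oset (opensI W W') x by split.
exists (opensI W W'), hI, (res X (@subIl W W') s), (res X (@subIl W W') t),
  (res X (@subIr W W') s').
by rewrite !germ_res.
Qed.

Definition opensT : opens X := @Opens X setT openT.

Definition germ_op (op : forall A : comPzRingType, A -> A -> A) (a b : stalk) :
    stalk :=
  let W := opensI (germ_nbhd (repr a)) (germ_nbhd (repr b)) in
  germ (W := W) (conj (germ_mem (repr a)) (germ_mem (repr b)))
    (op _ (res X (@subIl _ _) (germ_sect (repr a)))
          (res X (@subIr _ _) (germ_sect (repr b)))).

Lemma germ_opE (op : forall A : comPzRingType, A -> A -> A)
    (opM : forall (A B : comPzRingType) (f : {rmorphism A -> B}) a b,
       f (op A a b) = op B (f a) (f b))
    (W : opens X) (hx : oset W x) (s t : sect X W) :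
  germ_op op (germ hx s) (germ hx t) = germ hx (op _ s t).
Proof.
rewrite /germ_op; set a := repr (germ hx s); set b := repr (germ hx t).
have ea : germ (germ_mem a) (germ_sect a) = germ hx s.
  exact: germ_repr.
have eb : germ (germ_mem b) (germ_sect b) = germ hx t.
  exact: germ_repr.
have [/= Wa [ha [ha' [hax Ea]]]] := (germ_eqE _ _ _ _).1 ea.
have [/= Wb [hb [hb' [hbx Eb]]]] := (germ_eqE _ _ _ _).1 eb.
have hI : oset (opensI Wa Wb) x by split.
have h1 : oset (opensI Wa Wb) `<=` oset (opensI (germ_nbhd a) (germ_nbhd b)).
  by move=> y [ya yb]; split; [exact: (ha _ ya)|exact: (hb _ yb)].
have h2 : oset (opensI Wa Wb) `<=` oset W by move=> y [ya yb]; exact: (ha' _ ya).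
rewrite -(germ_res _ hI h1) -(germ_res hx hI h2) !opM; congr (germ hI (op _ _ _)).
- rewrite (res_comp _ _ (fun y h => ha y (subIl h))).
  rewrite -(res_comp ha (@subIl Wa Wb)) Ea.
  exact: res_comp.
- rewrite (res_comp _ _ (fun y h => hb y (subIr h))).
  rewrite -(res_comp hb (@subIr Wa Wb)) Eb.
  exact: res_comp.
Qed.

Definition stalk_add : stalk -> stalk -> stalk :=
  germ_op (fun A => @GRing.add A).
Definition stalk_mul : stalk -> stalk -> stalk :=
  germ_op (fun A => @GRing.mul A).
Definition stalk_opp (a : stalk) : stalk :=
  germ (germ_mem (repr a)) (- germ_sect (repr a)).
Definition stalk_zero : stalk := germ (W := opensT) I 0.
Definition stalk_one : stalk := germ (W := opensT) I 1.

Lemma germD (W : opens X) (hx : oset W x) (s t : sect X W) :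
  stalk_add (germ hx s) (germ hx t) = germ hx (s + t).
Proof. by apply: germ_opE => A B f a b; rewrite rmorphD. Qed.

Lemma germM (W : opens X) (hx : oset W x) (s t : sect X W) :
  stalk_mul (germ hx s) (germ hx t) = germ hx (s * t).
Proof. by apply: germ_opE => A B f a b; rewrite rmorphM. Qed.

Lemma germ0 (W : opens X) (hx : oset W x) : stalk_zero = germ hx 0.
Proof.
have h : oset W `<=` oset opensT by [].
by rewrite /stalk_zero -(germ_res _ hx h) rmorph0.
Qed.

Lemma germ1 (W : opens X) (hx : oset W x) : stalk_one = germ hx 1.
Proof.
have h : oset W `<=` oset opensT by [].
by rewrite /stalk_one -(germ_res _ hx h) rmorph1.
Qed.

Lemma germN (W : opens X) (hx : oset W x) (s : sect X W) :
  stalk_opp (germ hx s) = germ hx (- s).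
Proof.
rewrite /stalk_opp; set a := repr (germ hx s).
have ea : germ (germ_mem a) (germ_sect a) = germ hx s.
  exact: germ_repr.
have [/= Wa [ha [ha' [hax Ea]]]] := (germ_eqE _ _ _ _).1 ea.
by rewrite -(germ_res _ hax ha) -(germ_res hx hax ha') !rmorphN Ea.
Qed.

Lemma stalk_addA : associative stalk_add.
Proof.
by move=> a b c; have [W [hx [s [t [u [-> -> ->]]]]]] := germ3P a b c;
  rewrite !germD addrA.
Qed.

Lemma stalk_addC : commutative stalk_add.
Proof.
by move=> a b; have [W [hx [s [t [-> ->]]]]] := germ2P a b;
  rewrite !germD addrC.
Qed.

Lemma stalk_add0 : left_id stalk_zero stalk_add.
Proof.
by move=> a; have [W [hx [s ->]]] := germP a; rewrite (germ0 hx) germD add0r.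
Qed.

Lemma stalk_addN : left_inverse stalk_zero stalk_opp stalk_add.
Proof.
by move=> a; have [W [hx [s ->]]] := germP a;
  rewrite (germ0 hx) germN germD addNr.
Qed.

HB.instance Definition _ :=
  GRing.isZmodule.Build stalk stalk_addA stalk_addC stalk_add0 stalk_addN.

Lemma stalk_mulA : associative stalk_mul.
Proof.
by move=> a b c; have [W [hx [s [t [u [-> -> ->]]]]]] := germ3P a b c;
  rewrite !germM mulrA.
Qed.

Lemma stalk_mulC : commutative stalk_mul.
Proof.
by move=> a b; have [W [hx [s [t [-> ->]]]]] := germ2P a b;
  rewrite !germM mulrC.
Qed.

Lemma stalk_mul1 : left_id stalk_one stalk_mul.
Proof.
by move=> a; have [W [hx [s ->]]] := germP a; rewrite (germ1 hx) germM mul1r.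
Qed.

Lemma stalk_mulDl : left_distributive stalk_mul stalk_add.
Proof.
by move=> a b c; have [W [hx [s [t [u [-> -> ->]]]]]] := germ3P a b c;
  rewrite !(germM, germD) mulrDl.
Qed.

HB.instance Definition _ := GRing.Zmodule_isComPzRing.Build stalk
  stalk_mulA stalk_mulC stalk_mul1 stalk_mulDl.

End Stalk.

Definition stalk_map (k : fieldType) (X Y : lrSpace k) (f : morphism X Y)
    (x : X) (a : stalk (f x)) : stalk x :=
  let r := repr a in
  germ (W := mpreim f (germ_nbhd r)) (germ_mem r) (pull f _ (germ_sect r)).

Lemma stalk_map_germ (k : fieldType) (X Y : lrSpace k) (f : morphism X Y)
    (x : X) (W : opens Y) (hx : oset W (f x)) (s : sect Y W) :
  stalk_map (germ hx s) = germ (W := mpreim f W) hx (pull f W s).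
Proof.
rewrite /stalk_map; set a := repr (germ hx s).
have ea : germ (germ_mem a) (germ_sect a) = germ hx s.
  exact: germ_repr.
have [/= Wa [ha [ha' [hax Ea]]]] := (germ_eqE _ _ _ _).1 ea.
apply/germ_eqE; exists (mpreim f Wa).
by exists (preim_subset ha), (preim_subset ha'); split=> //=;
  rewrite -!pull_res Ea.
Qed.

(* Let N be an A-module and B an A-algebra via phi.  By the universal property
   of the tensor product, the element of N (x)_A B given by a list of pure
   tensors vanishes iff every A-bilinear map on N x B sums to 0 on the list. *)
Definition tensor_zero (A B : comPzRingType) (phi : A -> B) (N : lmodType A)
    (s : seq (N * B)) : Prop :=
  forall (P : lmodType A) (b : N -> B -> P),
    (forall n n' m, b (n + n') m = b n m + b n' m) ->
    (forall n m m', b n (m + m') = b n m + b n m') ->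
    (forall a n m, b (a *: n) m = a *: b n m) ->
    (forall a n m, b n (phi a * m) = a *: b n m) ->
    \sum_(p <- s) b p.1 p.2 = 0.

Definition flat_hom (A B : comPzRingType) (phi : A -> B) : Prop :=
  forall (N N' : lmodType A) (h : {linear N -> N'}), injective h ->
  forall s : seq (N * B),
    tensor_zero phi [seq (h p.1, p.2) | p <- s] -> tensor_zero phi s.

Definition flat (k : fieldType) (X Y : lrSpace k) (f : morphism X Y) : Prop :=
  forall x : X, flat_hom (@stalk_map k X Y f x).

(* All rings below are subrings of a field K over k, given by a sequence
   A 0, A 1, ... of additive subgroups with A m * A n <= A (m + n): the
   homogeneous components for Proj, the constant sequence at the ring itself
   for Spec. *)
Record mulFamily (k K : fieldType) (inj : {rmorphism k -> K}) := MulFamily {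
  comp :> nat -> set K;
  comp_scal : forall c, comp 0%N (inj c);
  comp_zero : forall n, comp n 0;
  comp_sub : forall n a b, comp n a -> comp n b -> comp n (a - b);
  comp_mul : forall m n a b, comp m a -> comp n b -> comp (m + n)%N (a * b)
}.

Record primeSpace (k K : fieldType) (inj : {rmorphism k -> K})
    (A : mulFamily inj) := PrimeSpace {
  pts : Type;
  ideal : pts -> set K;
  ideal_zero : forall p, ideal p 0;
  ideal_sub : forall p n a b, A n a -> A n b ->
    ideal p a -> ideal p b -> ideal p (a - b);
  ideal_mul : forall p m n a b, A m a -> A n b -> ideal p b -> ideal p (a * b);
  ideal_one : forall p, ~ ideal p 1;
  ideal_prime : forall p m n a b, A m a -> A n b ->
    ideal p (a * b) -> ideal p a \/ ideal p b
}.

Section PrimeSpectrum.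
Context {k K : fieldType} {inj : {rmorphism k -> K}} {A : mulFamily inj}.

Lemma comp_one : A 0%N 1.
Proof. by rewrite -(rmorph1 inj); exact: comp_scal. Qed.

Lemma comp_opp n a : A n a -> A n (- a).
Proof. by move=> h; rewrite -sub0r; apply: comp_sub => //; exact: comp_zero. Qed.

Lemma comp_add n a b : A n a -> A n b -> A n (a + b).
Proof. by move=> ha hb; rewrite -[b]opprK; apply: comp_sub => //; exact: comp_opp. Qed.

Variable P : primeSpace A.

Definition zariski : Type := pts P.

HB.instance Definition _ := gen_eqMixin zariski.
HB.instance Definition _ := gen_choiceMixin zariski.

(* The closed sets are the sets V(E) for sets E of homogeneous elements. *)
Definition zariski_open : set_system zariski :=
  [set W | exists E : set K, E `<=` \bigcup_n A n /\
     W = [set p : zariski | ~ (E `<=` ideal (p : pts P))]].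

Lemma zariski_openP (W : set zariski) : zariski_open W <->
  forall p, W p -> exists n f, [/\ A n f, ~ ideal p f &
    forall q : zariski, ~ ideal q f -> W q].
Proof.
split=> [[E [hE ->]] p /= /existsNP[f /not_implyP[Ef nf]]|h].
  have [n _ Af] := hE _ Ef; exists n, f; split=> // q nq hq; exact/nq/hq.
exists [set f | (\bigcup_n A n) f /\ forall q : zariski, ~ ideal q f -> W q].
split=> [f []//|]; apply/seteqP; split=> p /=.
  move=> /h [n [f [Af nf hf]]] hE; apply: nf; apply: hE; split=> //.
  by exists n.
move=> /existsNP[f /not_implyP[[_ hf] nf]]; exact: hf.
Qed.

Lemma zariski_openT : zariski_open setT.
Proof.
apply/zariski_openP => p _; exists 0%N, 1; split=> //; first exact: comp_one.
exact: ideal_one.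
Qed.

Lemma zariski_openI : setI_closed zariski_open.
Proof.
move=> W W' /zariski_openP h /zariski_openP h'.
apply/zariski_openP => p [/h [n [f [Af nf hf]]] /h' [m [g [Ag ng hg]]]].
exists (n + m)%N, (f * g); split; first exact: comp_mul.
  by move=> /(ideal_prime Af Ag) [].
move=> q nq; split; first apply: hf => hq; last apply: hg => hq; apply: nq.
  by rewrite mulrC; exact: ideal_mul Ag Af hq.
exact: ideal_mul Af Ag hq.
Qed.

Lemma zariski_open_bigU (I : Type) (f : I -> set zariski) :
  (forall i, zariski_open (f i)) -> zariski_open (\bigcup_i f i).
Proof.
move=> h; apply/zariski_openP => p [i _ fp].
have /zariski_openP /(_ _ fp) [n [g [Ag ng hg]]] := h i.
by exists n, g; split=> // q nq; exists i => //; exact: hg.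
Qed.

HB.instance Definition _ := isOpenTopological.Build zariski
  zariski_openT zariski_openI zariski_open_bigU.

Lemma D_open n f : A n f -> open [set p : zariski | ~ ideal p f].
Proof. by move=> Af; apply/zariski_openP => p nf; exists n, f. Qed.

Implicit Types W : opens zariski.

Definition D_opens n f (Af : A n f) : opens zariski := Opens (D_open Af).

(* Sections over W assign to every p in W an element of the localization of A
   at p (the degree 0 part of the homogeneous localization for Proj), viewed
   inside K, and are locally given by a single fraction. *)
Definition is_section (W : opens zariski) (s : {p | oset W p} -> K) : Prop :=
  forall p : {p | oset W p}, exists W' : opens zariski, oset W' (sval p) /\
    exists n a f, [/\ A n a, A n f & forall q : {p | oset W p},
      oset W' (sval q) -> ~ ideal (sval q : pts P) f /\ s q = a / f].

Record zsect (W : opens zariski) := ZSect {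
  zval :> {p | oset W p} -> K;
  zvalP : is_section zval
}.

Lemma zsect_eq W (s t : zsect W) : (forall p, s p = t p) -> s = t.
Proof.
case: s t => [s hs] [t ht] /= h.
have e : s = t by apply: funext.
by case: _ / e ht => ht; congr ZSect; exact: Prop_irrelevance.
Qed.

HB.instance Definition _ W := gen_eqMixin (zsect W).
HB.instance Definition _ W := gen_choiceMixin (zsect W).

Lemma ideal_neq0 (p : zariski) f : ~ ideal p f -> f != 0.
Proof. by move=> nf; apply/eqP => f0; apply: nf; rewrite f0; exact: ideal_zero. Qed.

Lemma is_section_cst W n a f : A n a -> A n f ->
  (forall p, oset W p -> ~ ideal (p : pts P) f) ->
  is_section (fun _ : {p | oset W p} => a / f).
Proof.
move=> Aa Af hf p; exists W; split; first exact: (svalP p).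
by exists n, a, f; split=> // q hq; split=> //; exact: hf.
Qed.

Lemma is_section_scal W c : is_section (fun _ : {p | oset W p} => inj c).
Proof.
have := @is_section_cst W 0%N (inj c) 1 (comp_scal _ _) comp_one
  (fun p _ => @ideal_one _ _ _ _ P p).
by rewrite divr1.
Qed.

Lemma is_section_opp W (s : {p | oset W p} -> K) :
  is_section s -> is_section (fun p => - s p).
Proof.
move=> hs p; have [W' [hp [n [a [f [Aa Af h]]]]]] := hs p.
exists W'; split=> //; exists n, (- a), f; split=> //; first exact: comp_opp.
by move=> q /h [nf ->]; rewrite mulNr.
Qed.

Lemma openI_zariski (W W' : opens zariski) : open (oset W `&` oset W').
Proof. by apply: openI; exact: oset_open. Qed.

Lemma is_section_add W (s t : {p | oset W p} -> K) :
  is_section s -> is_section t -> is_section (fun p => s p + t p).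
Proof.
move=> hs ht p; have [W1 [hp [n [a [f [Aa Af h]]]]]] := hs p.
have [W2 [hp' [m [b [g [Ab Ag h']]]]]] := ht p.
exists (Opens (openI_zariski W1 W2)); split=> //.
exists (n + m)%N, (a * g + b * f), (f * g); split.
- by apply: comp_add; [exact: comp_mul|rewrite addnC; exact: comp_mul].
- exact: comp_mul.
- move=> q [/h[nf ->] /h'[ng ->]]; split.
    by move=> /(ideal_prime Af Ag)[].
  by rewrite addf_div ?(ideal_neq0 nf) ?(ideal_neq0 ng).
Qed.

Lemma is_section_mul W (s t : {p | oset W p} -> K) :
  is_section s -> is_section t -> is_section (fun p => s p * t p).
Proof.
move=> hs ht p; have [W1 [hp [n [a [f [Aa Af h]]]]]] := hs p.
have [W2 [hp' [m [b [g [Ab Ag h']]]]]] := ht p.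
exists (Opens (openI_zariski W1 W2)); split=> //.
exists (n + m)%N, (a * b), (f * g); split; [exact: comp_mul|exact: comp_mul|].
move=> q [/h[nf ->] /h'[ng ->]]; split; last by rewrite mulf_div.
by move=> /(ideal_prime Af Ag)[].
Qed.

Lemma is_section0 W : is_section (fun _ : {p | oset W p} => 0).
Proof. by have := @is_section_scal W 0; rewrite rmorph0. Qed.
Lemma is_section1 W : is_section (fun _ : {p | oset W p} => 1).
Proof. by have := @is_section_scal W 1; rewrite rmorph1. Qed.

Section ZsectRing.
Variable W : opens zariski.
Implicit Types s t u : zsect W.

Definition zs0 : zsect W := ZSect (@is_section0 W).
Definition zs1 : zsect W := ZSect (@is_section1 W).
Definition zsN s : zsect W := ZSect (is_section_opp (zvalP s)).
Definition zsD s t : zsect W := ZSect (is_section_add (zvalP s) (zvalP t)).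
Definition zsM s t : zsect W := ZSect (is_section_mul (zvalP s) (zvalP t)).

Lemma zsDA : associative zsD.
Proof. by move=> s t u; apply: zsect_eq => p /=; rewrite addrA. Qed.
Lemma zsDC : commutative zsD.
Proof. by move=> s t; apply: zsect_eq => p /=; rewrite addrC. Qed.
Lemma zs0D : left_id zs0 zsD.
Proof. by move=> s; apply: zsect_eq => p /=; rewrite add0r. Qed.
Lemma zsND : left_inverse zs0 zsN zsD.
Proof. by move=> s; apply: zsect_eq => p /=; rewrite addNr. Qed.
HB.instance Definition _ := GRing.isZmodule.Build (zsect W) zsDA zsDC zs0D zsND.

Lemma zsMA : associative zsM.
Proof. by move=> s t u; apply: zsect_eq => p /=; rewrite mulrA. Qed.
Lemma zsMC : commutative zsM.
Proof. by move=> s t; apply: zsect_eq => p /=; rewrite mulrC. Qed.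
Lemma zs1M : left_id zs1 zsM.
Proof. by move=> s; apply: zsect_eq => p /=; rewrite mul1r. Qed.
Lemma zsMDl : left_distributive zsM zsD.
Proof. by move=> s t u; apply: zsect_eq => p /=; rewrite mulrDl. Qed.
HB.instance Definition _ := GRing.Zmodule_isComPzRing.Build (zsect W)
  zsMA zsMC zs1M zsMDl.

Definition zs_scal (c : k) : zsect W := ZSect (is_section_scal (W := W) c).

Lemma zs_scal_zmod : zmod_morphism zs_scal.
Proof. by move=> a b; apply: zsect_eq => p /=; rewrite rmorphB. Qed.
Lemma zs_scal_monoid : monoid_morphism zs_scal.
Proof.
by split=> [|a b]; apply: zsect_eq => p /=; rewrite (rmorph1, rmorphM).
Qed.
HB.instance Definition _ := GRing.isZmodMorphism.Build _ _ zs_scal zs_scal_zmod.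
HB.instance Definition _ :=
  GRing.isMonoidMorphism.Build _ _ zs_scal zs_scal_monoid.
End ZsectRing.

Section ZsectRes.
Variables (W W' : opens zariski) (h : oset W' `<=` oset W).

Definition sub_pt (p : {p | oset W' p}) : {p | oset W p} :=
  exist _ (sval p) (h (svalP p)).

Lemma is_section_res (s : {p | oset W p} -> K) :
  is_section s -> is_section (s \o sub_pt).
Proof.
move=> hs p; have [W1 [hp [n [a [f [Aa Af h1]]]]]] := hs (sub_pt p).
exists W1; split=> //; exists n, a, f; split=> // q hq; exact: (h1 (sub_pt q)).
Qed.

Definition zs_res (s : zsect W) : zsect W' := ZSect (is_section_res (zvalP s)).

Lemma zs_res_zmod : zmod_morphism zs_res.
Proof. by move=> a b; apply: zsect_eq. Qed.
Lemma zs_res_monoid : monoid_morphism zs_res.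
Proof. by split=> [|a b]; apply: zsect_eq. Qed.
HB.instance Definition _ := GRing.isZmodMorphism.Build _ _ zs_res zs_res_zmod.
HB.instance Definition _ :=
  GRing.isMonoidMorphism.Build _ _ zs_res zs_res_monoid.
End ZsectRes.

Lemma sig_eq (W : opens zariski) (p q : {p | oset W p}) : sval p = sval q -> p = q.
Proof.
case: p q => [p hp] [q hq] /= e; case: _ / e hq => hq.
by congr exist; exact: Prop_irrelevance.
Qed.

Lemma zs_res_id W (h : oset W `<=` oset W) (s : zsect W) : zs_res h s = s.
Proof. by apply: zsect_eq => p /=; congr (zval s _); exact: sig_eq. Qed.

Lemma zs_res_comp W W' W'' (h : oset W' `<=` oset W)
  (h' : oset W'' `<=` oset W') (h'' : oset W'' `<=` oset W) (s : zsect W) :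
  zs_res h' (zs_res h s) = zs_res h'' s.
Proof. by apply: zsect_eq => p /=; congr (zval s _); exact: sig_eq. Qed.

Lemma zs_res_scal W W' (h : oset W' `<=` oset W) c :
  zs_res h (zs_scal W c) = zs_scal W' c.
Proof. exact: zsect_eq. Qed.

Lemma zs_sep W (I : Type) (C : I -> opens zariski)
    (hC : forall i, oset (C i) `<=` oset W) (s t : zsect W) :
  oset W `<=` \bigcup_i oset (C i) ->
  (forall i, zs_res (hC i) s = zs_res (hC i) t) -> s = t.
Proof.
move=> cov h; apply: zsect_eq => p; have [i _ Cp] := cov _ (svalP p).
have /(congr1 (fun u => zval u (exist _ (sval p) Cp))) /= := h i.
by congr (zval s _ = zval t _); exact: sig_eq.
Qed.

Lemma zs_glue W (I : Type) (C : I -> opens zariski)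
    (hC : forall i, oset (C i) `<=` oset W) (s : forall i, zsect (C i)) :
  oset W `<=` \bigcup_i oset (C i) ->
  (forall i j (W' : opens zariski) (hi : oset W' `<=` oset (C i))
     (hj : oset W' `<=` oset (C j)), zs_res hi (s i) = zs_res hj (s j)) ->
  exists t : zsect W, forall i, zs_res (hC i) t = s i.
Proof.
move=> cov h.
have hi (p : {p | oset W p}) : {i | oset (C i) (sval p)}.
  by apply: cid; have [i _ ?] := cov _ (svalP p); exists i.
pose t (p : {p | oset W p}) : K :=
  s (sval (hi p)) (exist (oset (C (sval (hi p)))) (sval p) (svalP (hi p))).
have ht i (q : {p | oset (C i) p}) (p : {p | oset W p}) :
    sval p = sval q -> t p = s i q.
  move=> e; rewrite /t; case: (hi p) => j /= hj.
  pose W' := Opens (openI_zariski (C i) (C j)).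
  have s1 : oset W' `<=` oset (C i) by move=> y [].
  have s2 : oset W' `<=` oset (C j) by move=> y [].
  have hp : oset W' (sval p) by split=> //; rewrite e; exact: (svalP q).
  pose r : {y | oset W' y} := exist (oset W') (sval p) hp.
  have e2 : s i (sub_pt s1 r) = s j (sub_pt s2 r).
    exact: (congr1 (fun u : zsect W' => u r) (h i j W' s1 s2)).
  transitivity (s i (sub_pt s1 r)); last by congr (zval _ _); exact: sig_eq.
  by rewrite e2; congr (zval _ _); exact: sig_eq.
have secT : is_section t.
  move=> p; pose i := sval (hi p); have hp := svalP (hi p).
  have [W1 [W1p [n [a [f [Aa Af h1]]]]]] :=
    zvalP (s i) (exist _ (sval p) hp).
  exists (Opens (openI_zariski (C i) W1)); split=> //.
  exists n, a, f; split=> // q [Cq W1q].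
  by rewrite (ht i (exist _ _ Cq)) //; exact: (h1 (exist _ _ Cq)).
exists (ZSect secT) => i; apply: zsect_eq => q; exact: ht.
Qed.

Lemma zs_neq0 W (p : zariski) : oset W p -> (1 : zsect W) <> 0.
Proof.
move=> hp /(congr1 (fun u => zval u (exist _ p hp))) /= /eqP.
by rewrite oner_eq0.
Qed.

Lemma zs_inv W n a f (Aa : A n a) (Af : A n f) (s : zsect W) :
  (forall q : {q | oset W q}, ~ ideal (sval q : pts P) a) ->
  (forall q : {q | oset W q}, ~ ideal (sval q : pts P) f /\ s q = a / f) -> invertible s.
Proof.
move=> ha hs.
exists (ZSect (is_section_cst Af Aa (W := W) (fun p hp => ha (exist _ p hp)))).
apply: zsect_eq => q /=; have [nf ->] := hs q.
by rewrite mulf_div [f * a]mulrC divff // mulf_neq0 ?(ideal_neq0 nf) ?(ideal_neq0 (ha q)).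
Qed.

Lemma zs_local W (p : zariski) (s : zsect W) : oset W p ->
  exists (W' : opens zariski) (h : oset W' `<=` oset W),
    oset W' p /\ (invertible (zs_res h s) \/ invertible (zs_res h (1 - s))).
Proof.
move=> hp; have [W1 [W1p [n [a [f [Aa Af h1]]]]]] := zvalP s (exist _ p hp).
have [nf _] := h1 (exist _ p hp) W1p.
have main b (Ab : A n b) : ~ ideal p b -> exists W' : opens zariski,
    [/\ oset W' `<=` oset W, oset W' `<=` oset W1, oset W' p &
      forall q, oset W' q -> ~ ideal (q : pts P) b].
  move=> nb; exists (Opens (openI_zariski (D_opens Ab)
    (Opens (openI_zariski W W1)))); split=> //.
  - by move=> y [_ []].
  - by move=> y [_ []].
  - by move=> y [].
have [pa|na] := pselect (ideal (p : pts P) a).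
  have Ab : A n (f - a) by exact: comp_sub.
  have nb : ~ ideal p (f - a).
    move=> hb; apply: nf; have -> : f = (f - a) - (0 - a) by rewrite sub0r opprK subrK.
    have A0 := @comp_zero _ _ _ A n.
    apply: (ideal_sub Ab (comp_sub A0 Aa) hb).
    exact: (ideal_sub A0 Aa (ideal_zero _) pa).
  have [W' [hW hW1 hp' hb]] := main _ Ab nb; exists W', hW; split=> //; right.
  apply: (zs_inv Ab Af) => q; first exact: (hb _ (svalP q)).
  have [nq e] := h1 (sub_pt hW q) (hW1 _ (svalP q)); split=> //=.
  by rewrite e mulrBl divff // (ideal_neq0 nq).
have [W' [hW hW1 hp' hb]] := main _ Aa na; exists W', hW; split=> //; left.
apply: (zs_inv Aa Af) => q; first exact: (hb _ (svalP q)).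
exact: (h1 (sub_pt hW q) (hW1 _ (svalP q))).
Qed.

Definition prime_lrSpace : lrSpace k :=
  @LRSpace k zariski (fun W => zsect W) zs_res (fun W => @zs_scal W)
    zs_res_id zs_res_comp zs_res_scal zs_sep zs_glue zs_neq0 zs_local.

End PrimeSpectrum.

Record subalgebra (k K : fieldType) (inj : {rmorphism k -> K}) := Subalgebra {
  subalg : set K;
  subalg_scal : forall c, subalg (inj c);
  subalg_sub : forall a b, subalg a -> subalg b -> subalg (a - b);
  subalg_mul : forall a b, subalg a -> subalg b -> subalg (a * b)
}.

Section Spec.
Context {k K : fieldType} {inj : {rmorphism k -> K}} (B : subalgebra inj).

Lemma subalg_zero : subalg B 0.
Proof. by rewrite -(rmorph0 inj); exact: subalg_scal. Qed.

Definition subalg_family : mulFamily inj :=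
  @MulFamily k K inj (fun _ => subalg B) (@subalg_scal _ _ _ B) (fun _ => subalg_zero)
    (fun _ => @subalg_sub _ _ _ B) (fun _ _ => @subalg_mul _ _ _ B).

Record primeIdeal := PrimeIdeal {
  prime_set : set K;
  prime_subset : prime_set `<=` subalg B;
  prime_zero : prime_set 0;
  prime_sub : forall a b, prime_set a -> prime_set b -> prime_set (a - b);
  prime_mul : forall a b, subalg B a -> prime_set b -> prime_set (a * b);
  prime_one : ~ prime_set 1;
  prime_prime : forall a b, subalg B a -> subalg B b ->
    prime_set (a * b) -> prime_set a \/ prime_set b
}.

Definition spec_primes : primeSpace subalg_family :=
  @PrimeSpace k K inj subalg_family primeIdeal prime_set prime_zero
    (fun p _ a b _ _ => @prime_sub p a b)
    (fun p _ _ a b Ba _ => @prime_mul p a b Ba) prime_one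
    (fun p _ _ a b => @prime_prime p a b).

Definition Spec : lrSpace k := prime_lrSpace spec_primes.

End Spec.

(* An open subspace isomorphic to the spectrum of an integral domain, presented
   as a subalgebra of some field.  This is the general notion of a nonempty
   affine open as long as the ambient schemes are integral, as all Proj's of
   graded domains are. *)
Definition affine_open (k : fieldType) (X : lrSpace k) (W : opens X) : Prop :=
  exists (K : fieldType) (inj : {rmorphism k -> K}) (B : subalgebra inj)
    (j : morphism (Spec B) X), open_immersion j /\ range j = oset W.

Definition finite_morphism (k : fieldType) (X Y : lrSpace k)
    (f : morphism X Y) : Prop :=
  forall y : Y, exists W : opens Y,
    [/\ oset W y, affine_open W, affine_open (mpreim f W) &
      exists (n : nat) (e : 'I_n -> sect X (mpreim f W)),
        forall s : sect X (mpreim f W), exists c : 'I_n -> sect Y W,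
          s = \sum_(i < n) pull f W (c i) * e i].

(* The direct image of the structure sheaf of X is a locally free module of
   rank n over the structure sheaf of Y. *)
Definition has_degree (k : fieldType) (X Y : lrSpace k) (f : morphism X Y)
    (n : nat) : Prop :=
  forall y : Y, exists W : opens Y, oset W y /\
    exists e : 'I_n -> sect X (mpreim f W),
      forall (W' : opens Y) (h : oset W' `<=` oset W),
        bijective (fun c : {ffun 'I_n -> sect Y W'} =>
          \sum_(i < n) pull f W' (c i) *
            res X (preim_subset (cf := @mor_cont _ _ _ f) h) (e i)).

Record gradedAlgebra (k K : fieldType) (inj : {rmorphism k -> K}) :=
  GradedAlgebra {
  family :> mulFamily inj;
  graded_direct : forall (n : nat) (a : 'I_n -> K),
    (forall i : 'I_n, family i (a i)) -> \sum_(i < n) a i = 0 ->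
    forall i, a i = 0
}.

Section Proj.
Context {k K : fieldType} {inj : {rmorphism k -> K}} (A : gradedAlgebra inj).

Definition total : set K :=
  [set x | exists (n : nat) (a : 'I_n -> K),
     (forall i : 'I_n, A i (a i)) /\ x = \sum_(i < n) a i].

Record projPoint := ProjPoint {
  pt_set : set K;
  pt_subset : pt_set `<=` total;
  pt_zero : pt_set 0;
  pt_sub : forall a b, pt_set a -> pt_set b -> pt_set (a - b);
  pt_mul : forall a b, total a -> pt_set b -> pt_set (a * b);
  pt_one : ~ pt_set 1;
  pt_prime : forall a b, total a -> total b ->
    pt_set (a * b) -> pt_set a \/ pt_set b;
  pt_homog : forall x, pt_set x -> exists (n : nat) (a : 'I_n -> K),
    (forall i : 'I_n, A i (a i) /\ pt_set (a i)) /\ x = \sum_(i < n) a i;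
  pt_relevant : exists (n : nat) (a : K), [/\ (0 < n)%N, A n a & ~ pt_set a]
}.

Lemma comp_total n : A n `<=` total.
Proof.
move=> a Aa; exists n.+1, (fun i : 'I_n.+1 => if i == n :> nat then a else 0).
split=> [i|].
  by case: eqP => [->//|_]; exact: comp_zero.
rewrite (bigD1 ord_max) //= eqxx big1 ?addr0 // => i ni.
by case: eqP => // e; case/negP: ni; apply/eqP/val_inj.
Qed.

Definition proj_primes : primeSpace A :=
  @PrimeSpace k K inj A projPoint pt_set pt_zero
    (fun p _ a b _ _ => @pt_sub p a b)
    (fun p m _ a b Aa _ => @pt_mul p a b (comp_total Aa)) pt_one
    (fun p m n a b Aa Ab => @pt_prime p a b (comp_total Aa) (comp_total Ab)).

Definition Proj : lrSpace k := prime_lrSpace proj_primes.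

End Proj.

(* These conditions determine f uniquely: it is the morphism Proj A -> Proj B
   induced by an inclusion B <= A of graded algebras, which in general is only
   defined on an open subscheme of Proj A. *)
Definition induced_by_inclusion (k K : fieldType) (inj : {rmorphism k -> K})
    (A B : gradedAlgebra inj) (f : morphism (Proj A) (Proj B)) : Prop :=
  [/\ forall n, B n `<=` A n,
      forall x : projPoint A, pt_set (f x : projPoint B) = pt_set x `&` total B &
      forall (W : opens (Proj B)) (s : zsect W) (x : {x | oset (mpreim f W) x}),
        (pull f W s : zsect (mpreim f W)) x =
        s (exist (oset W) (f (sval x)) (svalP x))].

Local Notation "x %:F" := (@FracField.tofrac _ x) : ring_scope.

Section Weighted.
Context (k : fieldType) (r : nat) (d : 'I_r -> nat).

Definition wdeg (m : 'X_{1..r}) : nat := (\sum_(i < r) m i * d i)%N.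

Lemma wdeg0 : wdeg 0%MM = 0%N.
Proof. by rewrite /wdeg big1 // => i _; rewrite mnm0E. Qed.
Lemma wdegD : {morph wdeg : m1 m2 / (m1 + m2)%MM >-> (m1 + m2)%N}.
Proof.
move=> m1 m2; rewrite /wdeg -big_split /=; apply: eq_bigr => i _.
by rewrite mnmDE mulnDl.
Qed.
HB.instance Definition _ := isMeasure.Build r wdeg wdeg0 wdegD.

Definition polyFrac : fieldType := {fraction {mpoly k[r]}}.
Definition polyConst : {rmorphism k -> polyFrac} :=
  (@FracField.tofrac {mpoly k[r]}) \o (@mpolyC r k).

Definition whomog (n : nat) : set polyFrac :=
  [set x | exists2 p : {mpoly k[r]}, p \is ishomog1 n wdeg & x = p%:F].

Lemma dhomog_direct n (p : 'I_n -> {mpoly k[r]}) (e : 'I_n -> nat) :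
  injective e -> (forall i, p i \is ishomog1 (e i) wdeg) ->
  \sum_(i < n) p i = 0 -> forall i, p i = 0.
Proof.
move=> ie hp s0 i; apply/mpolyP => m; rewrite mcoeff0.
have [em|nem] := eqVneq (wdeg m) (e i); last exact: dhomog_nemf_coeff (hp i) nem.
have := congr1 (mcoeff m) s0; rewrite mcoeff0 raddf_sum /= (bigD1 i) //= big1.
  by rewrite addr0.
move=> j nj; apply: dhomog_nemf_coeff (hp j) _; rewrite /= em.
by apply: contraNneq nj => /ie ->.
Qed.

Lemma whomog_scal c : whomog 0 (polyConst c).
Proof.
exists c%:MP => //; apply/dhomogP => m; rewrite msuppC.
by case: eqP => // _; rewrite inE => /eqP ->; exact: wdeg0.
Qed.

Lemma whomog_zero n : whomog n 0.
Proof. by exists 0; rewrite ?tofrac0 //; exact: dhomog0. Qed.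

Lemma whomog_sub n a b : whomog n a -> whomog n b -> whomog n (a - b).
Proof.
move=> [p hp ->] [q hq ->]; exists (p - q); last by rewrite rmorphB.
by apply: dhomogD => //; rewrite dhomogN.
Qed.

Lemma whomog_mul m n a b : whomog m a -> whomog n b -> whomog (m + n) (a * b).
Proof.
move=> [p hp ->] [q hq ->]; exists (p * q); last by rewrite rmorphM.
exact: dhomogM.
Qed.

Definition wfamily : mulFamily polyConst :=
  @MulFamily k polyFrac polyConst whomog whomog_scal whomog_zero whomog_sub
    whomog_mul.

Lemma wfamily_direct n (a : 'I_n -> polyFrac) :
  (forall i : 'I_n, wfamily i (a i)) -> \sum_(i < n) a i = 0 ->
  forall i, a i = 0.
Proof.
move=> ha.
have hp (i : 'I_n) : {p : {mpoly k[r]} | p \is ishomog1 i wdeg /\ a i = p%:F}.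
  by apply: cid; have [p ? ?] := ha i; exists p.
have pE j : a j = (sval (hp j))%:F by case: (svalP (hp j)).
move=> s0 i; rewrite pE.
rewrite (@dhomog_direct n (fun i => sval (hp i)) (fun i => val i)) ?tofrac0 //.
- exact: val_inj.
- by move=> j; have [] := svalP (hp j).
- apply/eqP; rewrite -tofrac_eq0 rmorph_sum /=; apply/eqP.
  by rewrite -[RHS]s0; apply: eq_bigr => j _; rewrite -pE.
Qed.

Definition wpoly : gradedAlgebra polyConst :=
  @GradedAlgebra k polyFrac polyConst wfamily wfamily_direct.

Definition weighted_proj_space : lrSpace k := Proj wpoly.

End Weighted.

(* Of dimension r - 1, with r homogeneous coordinates. *)
Definition proj_space (k : fieldType) (r : nat) : lrSpace k :=
  weighted_proj_space k (fun _ : 'I_r => 1%N).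

Section FracMap.
Context (R : idomainType) (f : {rmorphism R -> R}) (fI : injective f).

Definition frac_map (x : {fraction R}) : {fraction R} :=
  (f \n_(repr x))%:F / (f \d_(repr x))%:F.

Lemma fracE (x : {fraction R}) : x = (\n_(repr x))%:F / (\d_(repr x))%:F.
Proof.
have d0 : (\d_(repr x))%:F != 0 :> {fraction R} by rewrite tofrac_eq0; exact: denom_ratioP.
apply/(canRL (mulfK d0)).
rewrite -{1}[x]reprK; case: (repr x) d0 => [[a b] /= hb] _.
unlock FracField.tofrac; rewrite -[LHS]FracField.pi_mul; apply/eqmodP.
rewrite /= FracField.equivfE /FracField.mulf /= !numden_Ratio ?mulr1 ?oner_eq0 //=.
by rewrite mulrC.
Qed.

Lemma f_neq0 a : a != 0 -> f a != 0.
Proof. by rewrite -{2}(rmorph0 f) (inj_eq fI). Qed.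

Lemma frac_mapE a b : b != 0 ->
  frac_map (a%:F / b%:F) = (f a)%:F / (f b)%:F.
Proof.
move=> b0; set x := a%:F / b%:F; rewrite /frac_map.
have db0 : \d_(repr x) != 0 by exact: denom_ratioP.
have e : (a * \d_(repr x))%:F = (\n_(repr x) * b)%:F :> {fraction R}.
  rewrite !rmorphM /=; apply/eqP; rewrite -eqr_div ?tofrac_eq0 //.
  by rewrite -(fracE x).
apply/eqP; rewrite eqr_div ?tofrac_eq0 ?f_neq0 // -!rmorphM tofrac_eq.
by move/eqP: e; rewrite tofrac_eq => /eqP ->.
Qed.

Lemma fracP (x : {fraction R}) : exists a b, b != 0 /\ x = a%:F / b%:F.
Proof. by exists \n_(repr x), \d_(repr x); split; [exact: denom_ratioP|exact: fracE]. Qed.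

Lemma frac_map_tofrac a : frac_map a%:F = (f a)%:F.
Proof.
have := frac_mapE a (oner_neq0 R); rewrite !rmorph1.
by rewrite !divr1.
Qed.

Lemma frac_mapB : zmod_morphism frac_map.
Proof.
move=> x y; have [a [b [b0 ->]]] := fracP x; have [c [e [e0 ->]]] := fracP y.
rewrite -mulNr -rmorphN addf_div ?tofrac_eq0 // -!rmorphM -rmorphD.
rewrite !frac_mapE ?mulf_neq0 // -mulNr -rmorphN.
rewrite addf_div ?tofrac_eq0 ?f_neq0 // -!rmorphM -rmorphD.
by rewrite rmorphD !rmorphM !rmorphN.
Qed.

Lemma frac_mapM x y : frac_map (x * y) = frac_map x * frac_map y.
Proof.
have [a [b [b0 ->]]] := fracP x; have [c [e [e0 ->]]] := fracP y.
rewrite mulf_div -!rmorphM !frac_mapE ?mulf_neq0 // mulf_div.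
by rewrite -!rmorphM.
Qed.

End FracMap.

Section Action.
Context (F : fieldType) (V : vectType F).

(* The embedding of V in its symmetric algebra, identified by means of the
   basis [vbasis fullv] with the polynomial ring in \dim V variables. *)
Definition sym_vect (v : V) : {mpoly F[\dim {:V}]} :=
  \sum_(i < \dim {:V}) coord (vbasis {:V}) i v *: 'X_i.

Definition sym_map (g : 'End(V)) : {mpoly F[\dim {:V}]} -> {mpoly F[\dim {:V}]} :=
  comp_mpoly [tuple sym_vect (g (vbasis {:V})`_i) | i < \dim {:V}].

HB.instance Definition _ g := GRing.LRMorphism.on (sym_map g).

Lemma sym_vect_linear : linear sym_vect.
Proof.
move=> c u v; rewrite /sym_vect scaler_sumr -big_split; apply: eq_bigr => i _ /=.
by rewrite linearP scalerDl scalerA.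
Qed.
HB.instance Definition _ := GRing.isLinear.Build F V {mpoly F[\dim {:V}]} _
  sym_vect sym_vect_linear.

Lemma sym_mapX g i : sym_map g 'X_i = sym_vect (g (vbasis {:V})`_i).
Proof. by rewrite /sym_map comp_mpolyXU -tnth_nth tnth_mktuple. Qed.

Lemma sym_map_vect g v : sym_map g (sym_vect v) = sym_vect (g v).
Proof.
rewrite {1}/sym_vect linear_sum /=.
under eq_bigr do rewrite linearZ /= sym_mapX -linearZ -linearZ.
by rewrite -!linear_sum /= -(coord_vbasis (memvf v)).
Qed.

Lemma sym_map_comp g h p : sym_map h (sym_map g p) = sym_map (h \o g)%VF p.
Proof.
have e := mpolyE p; rewrite [in LHS]e [in RHS]e => {e}.
rewrite (linear_sum (sym_map g)) (linear_sum (sym_map h)).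
rewrite (linear_sum (sym_map (h \o g)%VF)); apply: eq_bigr => m _.
rewrite !linearZ /=; congr (_ *: _); rewrite mpolyXE_id.
rewrite (rmorph_prod (sym_map g)) (rmorph_prod (sym_map h)).
rewrite (rmorph_prod (sym_map (h \o g)%VF)).
by apply: eq_bigr => i _; rewrite !rmorphXn /= !sym_mapX sym_map_vect comp_lfunE.
Qed.

Lemma sym_map1 p : sym_map \1%VF p = p.
Proof.
have e := mpolyE p; rewrite [in LHS]e [in RHS]e => {e}.
rewrite (linear_sum (sym_map _)); apply: eq_bigr => m _.
rewrite linearZ /=; congr (_ *: _); rewrite mpolyXE_id (rmorph_prod (sym_map _)).
apply: eq_bigr => i _; rewrite rmorphXn /= sym_mapX id_lfunE.
congr (_ ^+ _); rewrite /sym_vect (bigD1 i) //= coord_free ?eqxx ?scale1r.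
  rewrite big1 ?addr0 // => j nj; rewrite coord_free ?(basis_free (vbasisP _)) //.
  by rewrite eq_sym (negPf nj) scale0r.
exact: basis_free (vbasisP _).
Qed.

Lemma sym_map_inj g : lker g == 0%VS -> injective (sym_map g).
Proof.
move=> kg; apply: (can_inj (g := sym_map g^-1%VF)) => p.
by rewrite sym_map_comp lker0_compVf // sym_map1.
Qed.

Definition act (g : 'End(V)) : polyFrac F (\dim {:V}) -> polyFrac F (\dim {:V}) :=
  frac_map (sym_map g).

Record autSubgroup := AutSubgroup {
  aut_set : set 'End(V);
  aut_ker : forall g, aut_set g -> lker g == 0%VS;
  aut_one : aut_set \1%VF;
  aut_mul : forall g h, aut_set g -> aut_set h -> aut_set (g \o h)%VF;
  aut_inv : forall g, aut_set g -> aut_set g^-1%VF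
}.

Lemma lker_inv (g : 'End(V)) : lker g == 0%VS -> lker g^-1%VF == 0%VS.
Proof.
move=> kg; apply/lker0P; apply: (can_inj (g := g)); exact: lker0_lfunVK.
Qed.

Lemma lker_comp (g h : 'End(V)) :
  lker g == 0%VS -> lker h == 0%VS -> lker (g \o h)%VF == 0%VS.
Proof.
move=> /lker0P gI /lker0P hI; apply/lker0P => u v; rewrite !comp_lfunE.
by move=> /gI /hI.
Qed.

Lemma lker_one : lker (\1%VF : 'End(V)) == 0%VS.
Proof. by apply/lker0P => u v; rewrite !id_lfunE. Qed.

Definition GL_V : autSubgroup :=
  @AutSubgroup [set g | lker g == 0%VS] (fun g h => h) lker_one lker_comp lker_inv.

Definition det (g : 'End(V)) : F := \det (passmx.mxof (vbasis {:V}) (vbasis {:V}) g).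

Lemma det_one : det \1%VF = 1.
Proof. by rewrite /det passmx.mxof1 ?det1 // (basis_free (vbasisP _)). Qed.

Lemma det_comp g h : det (g \o h)%VF = det g * det h.
Proof.
by rewrite /det (passmx.mxof_comp _ _ (vbasisP fullv)) // det_mulmx mulrC.
Qed.

Definition SL_V : autSubgroup.
Proof.
refine (@AutSubgroup [set g | lker g == 0%VS /\ det g = 1] _ _ _ _) => /=.
- by move=> g [].
- by split; [exact: lker_one|exact: det_one].
- move=> g h [kg dg] [kh dh]; split; first exact: lker_comp.
  by rewrite det_comp dg dh mulr1.
- move=> g [kg dg]; split; first exact: lker_inv.
  by rewrite -[LHS]mulr1 -dg -det_comp lker0_compVf // det_one.
Defined.

Definition unipotent (g : 'End(V)) : Prop :=
  exists n, iter n (fun h => (g - \1) \o h)%VF \1%VF = 0.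

Definition maximal_unipotent (U : autSubgroup) : Prop :=
  (forall g, aut_set U g -> unipotent g) /\
  forall U' : autSubgroup, (forall g, aut_set U' g -> unipotent g) ->
    aut_set U `<=` aut_set U' -> aut_set U' = aut_set U.

(* S_V, inside its quotient field K_V *)
Definition symAlg : gradedAlgebra (polyConst F (\dim {:V})) :=
  wpoly F (fun _ : 'I_(\dim {:V}) => 1%N).

Definition vect_inv (v : V) : polyFrac F (\dim {:V}) := ((sym_vect v)%:F)^-1.

(* The degree n component of R_V: the span of the n-fold products of inverses
   1/v.  Note that it has degree - n in K_V. *)
Definition rec_comp (n : nat) : set (polyFrac F (\dim {:V})) :=
  [set x | exists s : seq (F * n.-tuple V),
     (forall p, p \in s -> forall v, v \in (p.2 : seq V) -> v != 0) /\
     x = \sum_(p <- s) polyConst F (\dim {:V}) p.1 * \prod_(v <- p.2) vect_inv v].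

Lemma rec_comp_zero n : rec_comp n 0.
Proof. by exists [::]; split=> //; rewrite big_nil. Qed.

Lemma rec_comp_scal c : rec_comp 0 (polyConst F (\dim {:V}) c).
Proof.
exists [:: (c, [tuple])]; split=> [p|]; first by rewrite inE => /eqP -> v.
by rewrite big_seq1 big_nil mulr1.
Qed.

Lemma rec_comp_sub n a b : rec_comp n a -> rec_comp n b -> rec_comp n (a - b).
Proof.
move=> [s [hs ->]] [t [ht ->]]; exists (s ++ [seq (- p.1, p.2) | p <- t]); split.
  by move=> p; rewrite mem_cat => /orP[/hs//|/mapP[q /ht hq ->]].
rewrite big_cat big_map -sumrN; congr (_ + _); apply: eq_bigr => p _ /=.
by rewrite !rmorphN mulNr.
Qed.

Lemma rec_comp_mul m n a b :
  rec_comp m a -> rec_comp n b -> rec_comp (m + n) (a * b).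
Proof.
move=> [s [hs ->]] [t [ht ->]].
exists (allpairs (fun (p : F * m.-tuple V) (q : F * n.-tuple V) =>
  (p.1 * q.1, cat_tuple p.2 q.2)) s t); split.
  move=> _ /allpairsP[[p q] [/= /hs hp /ht hq ->]] v /=.
  by rewrite mem_cat => /orP[/hp|/hq].
rewrite big_allpairs_dep mulr_suml; apply: eq_bigr => p _.
rewrite mulr_sumr; apply: eq_bigr => q _ /=.
by rewrite big_cat !rmorphM mulrACA.
Qed.

Definition rec_family : mulFamily (polyConst F (\dim {:V})) :=
  @MulFamily F _ (polyConst F (\dim {:V})) rec_comp rec_comp_scal rec_comp_zero
    rec_comp_sub rec_comp_mul.

Let w : 'X_{1..\dim {:V}} -> nat := wdeg (fun _ : 'I_(\dim {:V}) => 1%N).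

(* Quotients p / q with q homogeneous of degree n + deg p. *)
Let codeg (n : nat) (x : polyFrac F (\dim {:V})) : Prop :=
  exists L (p q : {mpoly F[\dim {:V}]}),
    [/\ q != 0, {in msupp q, forall m, w m = L},
        {in msupp p, forall m, (w m + n)%N = L} & x = p%:F / q%:F].

Lemma w_mul (p q : {mpoly F[\dim {:V}]}) a b a' b' :
  {in msupp p, forall m, (w m + a)%N = b} ->
  {in msupp q, forall m, (w m + a')%N = b'} ->
  {in msupp (p * q), forall m, (w m + (a + a'))%N = (b + b')%N}.
Proof.
move=> hp hq m /msuppM_le /allpairsP[[m1 m2] /= [/hp <- /hq <- ->]].
by rewrite /w wdegD addnACA.
Qed.

Lemma codeg0 n : codeg n 0.
Proof.
exists 0%N, 0, 1; split; rewrite ?oner_eq0 ?rmorph0 ?mul0r //.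
  by move=> m; rewrite msupp1 inE => /eqP ->; exact: wdeg0.
by move=> m; rewrite msupp0.
Qed.

Lemma codeg1 : codeg 0 1.
Proof.
exists 0%N, 1, 1; split; rewrite ?oner_eq0 ?rmorph1 ?divr1 //.
  by move=> m; rewrite msupp1 inE => /eqP ->; exact: wdeg0.
by move=> m; rewrite msupp1 inE addn0 => /eqP ->; exact: wdeg0.
Qed.

Lemma codegM m n x y : codeg m x -> codeg n y -> codeg (m + n) (x * y).
Proof.
move=> [L [p [q [q0 hq hp ->]]]] [L' [p' [q' [q0' hq' hp' ->]]]].
exists (L + L')%N, (p * p'), (q * q'); split; first exact: mulf_neq0.
- have /= h := @w_mul q q' 0%N L 0%N L'.
  move=> t /h ht; rewrite -ht ?addn0 // => u /[!addn0]; [exact: hq|exact: hq'].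
- exact: w_mul.
- by rewrite mulf_div -!rmorphM.
Qed.

Lemma codegD n x y : codeg n x -> codeg n y -> codeg n (x + y).
Proof.
move=> [L [p [q [q0 hq hp ->]]]] [L' [p' [q' [q0' hq' hp' ->]]]].
have hq0 : {in msupp q, forall m, (w m + 0)%N = L} by move=> m /hq <-; rewrite addn0.
have hq0' : {in msupp q', forall m, (w m + 0)%N = L'}.
  by move=> m /hq' <-; rewrite addn0.
exists (L + L')%N, (p * q' + p' * q), (q * q'); split; first exact: mulf_neq0.
- by move=> t /(w_mul hq0 hq0') <-; rewrite !addn0.
- move=> t /msuppD_le; rewrite mem_cat => /orP[].
    by move=> /(w_mul hp hq0') <-; rewrite addn0.
  by move=> /(w_mul hp' hq0) ht; rewrite addnC [RHS]addnC -ht addn0 addnC.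
- by rewrite addf_div ?tofrac_eq0 // -!rmorphM -rmorphD.
Qed.

Lemma codegZ c : codeg 0 (polyConst F (\dim {:V}) c).
Proof.
have hC : {in msupp (c%:MP : {mpoly F[\dim {:V}]}), forall m, w m = 0%N}.
  move=> m; rewrite msuppC; case: eqP => // _; rewrite inE => /eqP ->.
  exact: wdeg0.
exists 0%N, c%:MP, 1; split; rewrite ?oner_eq0 ?rmorph1 ?divr1 //.
  by move=> m; rewrite msupp1 inE => /eqP ->; exact: wdeg0.
by move=> m /hC ->.
Qed.

Lemma sym_vect_eq0 v : (sym_vect v == 0) = (v == 0).
Proof.
apply/eqP/eqP => [e|->]; last exact: linear0.
rewrite (coord_vbasis (memvf v)) big1 // => i _.
have := congr1 (mcoeff U_(i)%MM) e; rewrite mcoeff0 /sym_vect raddf_sum /=.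
rewrite (bigD1 i) //= mcoeffZ mcoeffXU eqxx mulr1 big1 ?addr0 => [->|j nj].
  by rewrite scale0r.
by rewrite mcoeffZ mcoeffXU (negPf nj) mulr0.
Qed.

Lemma codegV v : v != 0 -> codeg 1 (vect_inv v).
Proof.
move=> v0; exists 1%N, 1, (sym_vect v); split; first by rewrite sym_vect_eq0.
- move=> m; rewrite /sym_vect => /msupp_sum_le /flattenP[s /mapP[i _ ->]].
  move=> /msuppZ_le; rewrite msuppX inE => /eqP ->.
  rewrite /w /wdeg (bigD1 i) //= mnm1E eqxx big1 // => j nj.
  by rewrite mnm1E eq_sym (negPf nj).
- by move=> m; rewrite msupp1 inE => /eqP ->; rewrite /w wdeg0.
- by rewrite /vect_inv rmorph1 div1r.
Qed.

Lemma rec_codeg n x : rec_comp n x -> codeg n x.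
Proof.
move=> [s [hs ->]]; rewrite big_seq.
apply: (big_ind (codeg n)) => [||p /hs hp]; [exact: codeg0|exact: codegD|].
case: p hp => c t /= ht; apply: (@codegM 0%N n); first exact: codegZ.
move: (tval t) (size_tuple t) ht => u <-.
elim: u => [|v u IH] hu; first by rewrite big_nil; exact: codeg1.
rewrite big_cons /= -add1n; apply: codegM.
  by apply: codegV; apply: hu; rewrite inE eqxx.
by apply: IH => y yu; apply: hu; rewrite inE yu orbT.
Qed.

Lemma rec_direct n (a : 'I_n -> polyFrac F (\dim {:V})) :
  (forall i : 'I_n, rec_family i (a i)) -> \sum_(i < n) a i = 0 ->
  forall i, a i = 0.
Proof.
move=> ha s0 i.
have /choice [L hL] : forall i : 'I_n, exists L, exists p q : {mpoly F[\dim {:V}]},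
    [/\ q != 0, {in msupp q, forall m, w m = L},
        {in msupp p, forall m, (w m + i)%N = L} & a i = p%:F / q%:F].
  by move=> j; exact: rec_codeg (ha j).
have /choice [p /choice [q hpq]] := hL.
pose Q j := \prod_(l < n | l != j) q l.
have qM (P : pred 'I_n) :
    {in msupp (\prod_(l < n | P l) q l), forall m,
      (w m + 0)%N = (\sum_(l < n | P l) L l)%N}.
  apply: (big_rec2 (fun (p : {mpoly F[\dim {:V}]}) b =>
    {in msupp p, forall m, (w m + 0)%N = b})).
    by move=> m; rewrite msupp1 inE => /eqP ->; rewrite /w wdeg0.
  move=> l b p' _ hb; rewrite -[0%N]addn0; apply: w_mul => // m.
  by have [_ hq _ _] := hpq l; move/hq <-; rewrite addn0.
have pM j : {in msupp (p j * Q j), forall m,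
    (w m + j)%N = (\sum_(l < n) L l)%N}.
  have [_ _ hp _] := hpq j.
  move=> m /(w_mul hp (qM _)); rewrite addn0 => ->.
  by rewrite [RHS](bigD1 j).
have aM j : a j * (\prod_(l < n) q l)%:F = (p j * Q j)%:F.
  have [q0 _ _ ->] := hpq j; rewrite (bigD1 j) //= !rmorphM /= mulrA.
  by rewrite divfK ?tofrac_eq0.
have Q0 : (\prod_(l < n) q l)%:F != 0 :> polyFrac F (\dim {:V}).
  rewrite tofrac_eq0; apply/prodf_neq0 => l _; by have [] := hpq l.
suff e : p i * Q i = 0.
  by apply: (mulIf Q0); rewrite aM e rmorph0 mul0r.
have sM : \sum_(j < n) (p j * Q j) = 0.
  apply/eqP; rewrite -tofrac_eq0 rmorph_sum /=; apply/eqP.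
  under eq_bigr do rewrite -aM.
  by rewrite -mulr_suml s0 mul0r.
apply/mpolyP => m; rewrite mcoeff0; apply: contra_eq sM => /= ni.
apply/eqP => /(congr1 (mcoeff m)); rewrite mcoeff0 raddf_sum /= (bigD1 i) //=.
rewrite big1 ?addr0; first by move/eqP; rewrite (negPf ni).
move=> j nj; apply: contraNeq nj => nj'.
rewrite -mcoeff_msupp in ni; rewrite -mcoeff_msupp in nj'.
have := pM _ _ ni; rewrite -(pM _ _ nj') => /addnI /val_inj ->; exact: eqxx.
Qed.

Definition recAlg : gradedAlgebra (polyConst F (\dim {:V})) :=
  @GradedAlgebra F _ (polyConst F (\dim {:V})) rec_family rec_direct.

Section Invariants.
Variables (A : gradedAlgebra (polyConst F (\dim {:V}))) (H : autSubgroup).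

Definition inv_comp (n : nat) : set (polyFrac F (\dim {:V})) :=
  [set x | A n x /\ forall g, aut_set H g -> act g x = x].

Lemma act_const g c : aut_set H g ->
  act g (polyConst F (\dim {:V}) c) = polyConst F (\dim {:V}) c.
Proof.
move=> /aut_ker /sym_map_inj gI; rewrite /act /= frac_map_tofrac //.
congr (FracField.tofrac _); exact: comp_mpolyC.
Qed.

Lemma inv_comp_scal c : inv_comp 0 (polyConst F (\dim {:V}) c).
Proof. by split; [exact: comp_scal|move=> g; exact: act_const]. Qed.

Lemma inv_comp_zero n : inv_comp n 0.
Proof.
split; first exact: comp_zero.
by move=> g Hg; have := act_const 0 Hg; rewrite rmorph0.
Qed.

Lemma inv_comp_sub n a b : inv_comp n a -> inv_comp n b -> inv_comp n (a - b).
Proof.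
move=> [Aa ha] [Ab hb]; split; first exact: comp_sub.
move=> g Hg; rewrite /act (frac_mapB (sym_map_inj (aut_ker Hg))).
by rewrite -/(act g a) -/(act g b) ha // hb.
Qed.

Lemma inv_comp_mul m n a b :
  inv_comp m a -> inv_comp n b -> inv_comp (m + n) (a * b).
Proof.
move=> [Aa ha] [Ab hb]; split; first exact: comp_mul.
move=> g Hg; rewrite /act (frac_mapM (sym_map_inj (aut_ker Hg))).
by rewrite -/(act g a) -/(act g b) ha // hb.
Qed.

Definition invariants : gradedAlgebra (polyConst F (\dim {:V})).
Proof.
refine (@GradedAlgebra F _ _ (@MulFamily F _ (polyConst F (\dim {:V})) inv_comp
  inv_comp_scal inv_comp_zero inv_comp_sub inv_comp_mul) _).
by move=> n a ha; apply: (@graded_direct _ _ _ A) => i; have [] := ha i.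
Defined.

End Invariants.

End Action.

Arguments symAlg {F} V.
Arguments recAlg {F} V.
Arguments GL_V {F} V.
Arguments SL_V {F} V.

Definition P_space (F : fieldType) (V : vectType F) : lrSpace F := Proj (symAlg V).

Definition Q_space (F : fieldType) (V : vectType F) : lrSpace F := Proj (recAlg V).

Definition P_quot (F : fieldType) (V : vectType F) (H : autSubgroup V) : lrSpace F :=
  Proj (invariants (symAlg V) H).

Definition Q_quot (F : fieldType) (V : vectType F) (H : autSubgroup V) : lrSpace F :=
  Proj (invariants (recAlg V) H).

(* Main.v *)
From HB Require Import structures.
From mathcomp Require Import all_boot all_order all_algebra.
From mathcomp Require Import fingroup pgroup cyclic finfield mxrepresentation mxabelem.
From mathcomp Require Import generic_quotient boolp classical_sets functions.
From mathcomp Require Import topology_structure mpoly ring zify.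
Require Import Defs.

Set Implicit Arguments.
Unset Strict Implicit.
Unset Printing Implicit Defensive.

Import GRing.Theory.

Local Open Scope classical_set_scope.
Local Open Scope ring_scope.

(** Why the theorem holds.

    Algebra.  Let A be S_V or R_V, inside the field K = K_V, and let H be U or G.
    The invariants A^H are identified without computing them from the group:
    it is enough to exhibit homogeneous invariants b_1, .., b_r such that A is
    spanned over C = F[b_1, .., b_r] by |H| homogeneous elements, one of
    which is 1.  Indeed, by Dedekind's independence of characters, the |H|
    automorphisms force these |H| elements to be linearly independent over the
    field of invariants (spanning_free), and comparing x * 1, for x an
    invariant, with the expansion of x gives x in C (invariant_poly).
    Finally A contains r algebraically independent elements of degree 1, so
    it grows too fast for the b_i to satisfy a relation (peval_inj).  Hence A^H
    is a weighted polynomial ring.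

    Generators.  Let x_0, .., x_{r-1} be a basis adapted to U, and V_i the
    span of x_0, .., x_{i-1}.  Let E_i be the F-linear polynomial with set of
    roots V_i and with linear coefficient 1, so that E_i(z)^-1 is the sum of
    the 1 / (z + w) for w in V_i, and let E_i(z) = sum_j d_ij z^(q^j).  The
    generators are
    - g_i = E_i(x_i)^-1, of degree 1, for R_V and U;
    - f_i = E_i(x_i) / d_ii, the product of the x_i + w for w in V_i, of
      degree q^i, for S_V and U;
    - d_{r,j} with 0 < j <= r, of degree q^j - 1, for R_V and G;
    - c_{r,j} = d_{r,j} / d_{r,r} with j < r, the Dickson invariants, of degree
      q^r - q^j, for S_V and G.
    The spanning sets are built by adjoining one generator at a time: x_i is
    a root of a monic polynomial obtained from E_i and E_r in the case of S_V
    (spans_monic), while in R_V the products of the reciprocals 1 / (x_i + w)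
    are reduced by partial fractions and by the relation that the sum of these
    reciprocals is g_i (spans_recip).

    For G' the Moore determinant l of the basis, which is the product of
    the f_i, is multiplied by the determinant of the automorphism, and
    l^(q-1) = (-1)^r c_{r,0}.  A G'-invariant is a sum of semi-invariants,
    and comparing (q-1)-st powers shows that each of them is a power of l (of
    its inverse in R_V) times a G-invariant (semi_invariants).

    Geometry.  An isomorphism of graded algebras induces one of Proj, and
    every point of Proj of the larger algebra restricts to the invariants.
    For R_V and U every point of the quotient has a neighbourhood D(g) with g
    invariant of degree 1.  There the spanning elements e_j, divided by
    g ^ deg e_j, form a basis of the sections above over the sections below:
    a section s above is a fraction at each of the points over y, and by lying
    over it has an invariant denominator that does not vanish at y (descend).
    This makes the projection finite and locally free of rank |U|, and
    flatness passes to the stalks, which are localizations of free modules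
    over the stalks below (flat_localization).

    Groups.  A maximal unipotent subgroup is the stabilizer of a flag acting
    trivially on its graded pieces: a unipotent group over F is a p-group, so
    it fixes a nonzero vector in each quotient of V (unipotent_flag). *)

(** * Additive maps *)

Section AdditiveMaps.
Variables (U V : zmodType) (f : U -> V).
Hypothesis fB : zmod_morphism f.

Lemma zmod_morph0 : f 0 = 0.
Proof. by rewrite -[X in f X](subrr 0) fB subrr. Qed.

Lemma zmod_morphN x : f (- x) = - f x.
Proof. by rewrite -sub0r fB zmod_morph0 sub0r. Qed.

Lemma zmod_morphD x y : f (x + y) = f x + f y.
Proof. by rewrite -{1}[y]opprK fB zmod_morphN opprK. Qed.

Lemma zmod_morph_sum (I : Type) (r : seq I) (P : pred I) (g : I -> U) :
  f (\sum_(i <- r | P i) g i) = \sum_(i <- r | P i) f (g i).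
Proof. exact: (big_morph f zmod_morphD zmod_morph0). Qed.

End AdditiveMaps.

(** * Morphisms between prime spectra of subrings of fields *)

(** A homomorphism of fields need not map the given subring into the other one:
    it may do so after multiplication by a unit u n in each degree n, which
    leaves fractions of the same degree unchanged.  This covers both inclusions
    of graded rings and dehomogenization. *)
Section Functoriality.
Context {k K1 K2 : fieldType} {inj1 : {rmorphism k -> K1}}
  {inj2 : {rmorphism k -> K2}} {A1 : mulFamily inj1} {A2 : mulFamily inj2}.
Variables (P1 : primeSpace A1) (P2 : primeSpace A2).
Variables (phi : {rmorphism K1 -> K2}) (u : nat -> K2) (nu : nat -> nat)
  (m : pts P2 -> pts P1).
Hypothesis phi_inj : forall c, phi (inj1 c) = inj2 c.
Hypothesis u_neq0 : forall n, u n != 0.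
Hypothesis A_phi : forall n a, A1 n a -> A2 (nu n) (phi a * u n).
Hypothesis m_ideal : forall p n a, A1 n a ->
  (ideal p (phi a * u n) <-> ideal (m p) a).

Let mz : zariski P2 -> zariski P1 := m.

Lemma zmap_continuous : continuous mz.
Proof.
apply/continuousP => W /zariski_openP hW; apply/zariski_openP => p /= Wp.
have [n [f [Af nf hf]]] := hW _ Wp.
exists (nu n), (phi f * u n); split; first exact: A_phi.
  by move/(m_ideal p Af).
by move=> q nq; apply: hf => /(m_ideal q Af).
Qed.

Let pre (W : opens (zariski P1)) : opens (zariski P2) :=
  preim_opens zmap_continuous W.

Let pt (W : opens (zariski P1)) (p : {p | oset (pre W) p}) : {q | oset W q} :=
  exist (oset W) (m (sval p)) (svalP p).

Lemma is_section_pull (W : opens (zariski P1)) (s : zsect W) :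
  is_section (fun p : {p | oset (pre W) p} => phi (s (pt p))).
Proof.
move=> p; have [W' [W'p [n [a [f [Aa Af h]]]]]] := zvalP s (pt p).
exists (pre W'); split=> //.
exists (nu n), (phi a * u n), (phi f * u n); split; try exact: A_phi.
move=> q W'q; have [nf ->] := h (pt q) W'q; split.
  by move/(m_ideal (sval q) Af).
by rewrite fmorph_div -mulf_div divff // mulr1.
Qed.

Definition zpull (W : opens (zariski P1)) (s : zsect W) : zsect (pre W) :=
  ZSect (is_section_pull s).

Lemma zpull_zmod W : zmod_morphism (@zpull W).
Proof. by move=> s t; apply: zsect_eq => p /=; rewrite rmorphB. Qed.
Lemma zpull_monoid W : monoid_morphism (@zpull W).
Proof.
by split=> [|s t]; apply: zsect_eq => p /=; rewrite ?rmorph1 ?rmorphM.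
Qed.
HB.instance Definition _ W :=
  GRing.isZmodMorphism.Build _ _ (@zpull W) (@zpull_zmod W).
HB.instance Definition _ W :=
  GRing.isMonoidMorphism.Build _ _ (@zpull W) (@zpull_monoid W).

Lemma zpull_res (W W' : opens (zariski P1)) (h : oset W' `<=` oset W)
    (s : zsect W) :
  zpull (zs_res h s) = zs_res (preim_subset (cf := zmap_continuous) h) (zpull s).
Proof.
by apply: zsect_eq => p /=; congr (phi (zval s _)); exact: sig_eq.
Qed.

Lemma zpull_scal (W : opens (zariski P1)) (c : k) :
  zpull (zs_scal W c) = zs_scal (pre W) c.
Proof. by apply: zsect_eq => p /=. Qed.

(** If s = a / f near m(p) had a in the prime ideal of m(p), then phi a * u n
    would lie in p, and no t = b / g defined at p could satisfy s t = 1. *)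
Lemma zpull_local (W : opens (zariski P1)) (s : zsect W) (p : zariski P2) :
  oset W (mz p) ->
  (exists (W' : opens (zariski P2)) (h : oset W' `<=` oset (pre W)),
     oset W' p /\ invertible (zs_res h (zpull s))) ->
  exists (W' : opens (zariski P1)) (h : oset W' `<=` oset W),
    oset W' (mz p) /\ invertible (zs_res h s).
Proof.
move=> Wp [W' [h [W'p [t ht]]]].
have [W1 [W1p [n [a [f [Aa Af hs]]]]]] := zvalP s (exist (oset W) (mz p) Wp).
have [nf es] := hs (exist (oset W) (mz p) Wp) W1p.
have na : ~ ideal (mz p) a.
  move=> /(m_ideal p Aa) pa.
  have [W2 [W2p [n' [b [g [Ab Ag hb]]]]]] := zvalP t (exist _ p W'p).
  have [ng eb] := hb (exist _ p W'p) W2p.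
  have /(congr1 (fun v : zsect W' => v (exist _ p W'p))) /= := ht.
  have -> : pt (sub_pt h (exist (oset W') p W'p)) = exist (oset W) (mz p) Wp.
    exact: sig_eq.
  rewrite es eb fmorph_div mulf_div => /eqP.
  have f0 : phi f != 0 by rewrite fmorph_eq0; exact: (ideal_neq0 nf).
  rewrite -[X in _ == X]divr1 eqr_div ?oner_neq0 ?mulf_neq0 //; last first.
    exact: (ideal_neq0 ng).
  rewrite mulr1 mul1r => /eqP e.
  have : ideal p ((phi f * u n) * g).
    have -> : phi f * u n * g = b * (phi a * u n) by rewrite mulrAC -e; ring.
    exact: ideal_mul Ab (A_phi Aa) pa.
  by case/(ideal_prime (A_phi Af) Ag) => // /(m_ideal p Af).
pose W2 := Opens (openI_zariski (D_opens P1 Aa) (Opens (openI_zariski W W1))).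
have h2 : oset W2 `<=` oset W by move=> y [_ []].
exists W2, h2; split; first by split.
apply: (@zs_inv _ _ _ _ P1 _ _ _ _ Aa Af) => q; first by have [] := svalP q.
by apply: (hs (sub_pt h2 q)); have [_ []] := svalP q.
Qed.

Definition zmap : morphism (prime_lrSpace P2) (prime_lrSpace P1) :=
  @Morphism k (prime_lrSpace P2) (prime_lrSpace P1) mz zmap_continuous
    (fun W => @zpull W) zpull_res zpull_scal zpull_local.

(** Over the image of a basic open set D(g) the two structure sheaves agree as
    soon as every fraction b / g upstairs is already a fraction downstairs
    whose denominator vanishes nowhere on that image. *)
Hypothesis m_inj : injective m.
Hypothesis m_frac : forall n b g, A2 n b -> A2 n g -> g != 0 ->
  exists l a f, [/\ A1 l a, A1 l f, b / g = phi a / phi f,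
    forall p, ~ ideal p g -> ~ ideal (m p) f &
    forall q, ~ ideal q f -> exists2 p, m p = q & ~ ideal p g].

Lemma zmap_open (W : set (zariski P2)) : open W -> open (mz @` W).
Proof.
move=> /zariski_openP hW; apply/zariski_openP => _ [p Wp <-].
have [n [g [Ag ng hg]]] := hW _ Wp.
have [l [_ [f [_ Af _ h1 h2]]]] := m_frac (comp_zero _ n) Ag (ideal_neq0 ng).
exists l, f; split=> //; first exact: h1.
by move=> q /h2 [p' <- /hg]; exists p'.
Qed.

Lemma zpull_bij (W : opens (zariski P1)) : oset W `<=` range mz ->
  bijective (@zpull W).
Proof.
move=> hW; have inj : injective (@zpull W).
  move=> s t e; apply: zsect_eq => q; have [p _ pq] := hW _ (svalP q).
  have Wp : oset (pre W) p by rewrite /= pq; exact: (svalP q).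
  have /(congr1 (fun v : zsect (pre W) => v (exist _ p Wp))) /= := e.
  have -> : pt (exist _ p Wp) = q by exact: sig_eq.
  exact: fmorph_inj.
suff /choice [i hi] : forall t : zsect (pre W), exists s, zpull s = t.
  by exists i => // s; apply: inj; rewrite hi.
move=> t; have /choice [r hr] : forall q : {q | oset W q},
    exists r : {p | oset (pre W) p}, m (sval r) = sval q.
  move=> q; have [p _ pq] := hW _ (svalP q).
  have Wp : oset (pre W) p by rewrite /= pq; exact: (svalP q).
  by exists (exist _ p Wp).
have /choice [v hv] : forall q : {q | oset W q}, exists v, phi v = t (r q).
  move=> q; have [W' [W'p [n [b [g [Ab Ag hb]]]]]] := zvalP t (r q).
  have [ng ->] := hb _ W'p.
  have [l [a [f [_ _ -> _ _]]]] := m_frac Ab Ag (ideal_neq0 ng).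
  by exists (a / f); rewrite fmorph_div.
have secv : is_section v.
  move=> q; have [W' [W'p [n [b [g [Ab Ag hb]]]]]] := zvalP t (r q).
  have [ng _] := hb _ W'p.
  have [l [a [f [Aa Af e h1 _]]]] := m_frac Ab Ag (ideal_neq0 ng).
  exists (Opens (zmap_open (oset_open W'))); split.
    by exists (sval (r q)) => //; exact: hr.
  exists l, a, f; split=> // q' [p W'p' pq'].
  have rp : sval (r q') = p by apply: m_inj; rewrite hr.
  have [] := hb (r q'); rewrite ?rp // => ng' e'; split.
    by rewrite -pq'; exact: h1.
  by apply: (fmorph_inj phi); rewrite hv e' e fmorph_div.
exists (ZSect secv); apply: zsect_eq => p /=; rewrite hv; congr (zval t _).
by apply: sig_eq; apply: m_inj; rewrite hr.
Qed.

Lemma zmap_open_immersion : open_immersion zmap.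
Proof. by split; [exact: m_inj|exact: zmap_open|exact: zpull_bij]. Qed.

Lemma zmap_isomorphism : (forall q, exists p, m p = q) -> isomorphism zmap.
Proof.
move=> surj; split; last 2 first.
- exact: zmap_open.
- by move=> W; apply: zpull_bij => q _; have [p pq] := surj q; exists p.
- have /choice [i hi] := surj; exists i => // p; apply: m_inj; exact: hi.
Qed.

End Functoriality.

(** * Points of Proj and homogeneous primes *)

Section HomogeneousPrimes.
Context {k K : fieldType} {inj : {rmorphism k -> K}} (A : gradedAlgebra inj).

Lemma graded_sum_inj N (a b : nat -> K) :
  (forall i, A i (a i)) -> (forall i, A i (b i)) ->
  \sum_(i < N) a i = \sum_(i < N) b i -> forall i, (i < N)%N -> a i = b i.
Proof.
move=> ha hb /eqP; rewrite -subr_eq0 -sumrB => /eqP e i iN.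
apply/eqP; rewrite -subr_eq0; apply/eqP.
apply: (@graded_direct _ _ _ A N (fun i => a i - b i) _ e (Ordinal iN)) => j.
exact: comp_sub.
Qed.

Lemma graded_deg_uniq m n a : A m a -> A n a -> a != 0 -> m = n.
Proof.
move=> Am An a0; apply/eqP; apply: contraNT a0 => nmn; apply/eqP.
pose c (p i : nat) := if i == p then a else 0.
have Ac p : A p a -> forall i, A i (c p i).
  by move=> Ap i; rewrite /c; case: eqP => [->//|_]; exact: comp_zero.
have sc p : (p < (m + n).+1)%N -> \sum_(i < (m + n).+1) c p i = a.
  move=> pl; rewrite (bigD1 (Ordinal pl)) //= /c eqxx big1 ?addr0 // => i ni.
  by case: eqP => // e; case/eqP: ni; exact: val_inj.
have lm : (m < (m + n).+1)%N by rewrite ltnS leq_addr.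
have ln : (n < (m + n).+1)%N by rewrite ltnS leq_addl.
have := graded_sum_inj (Ac m Am) (Ac n An) (etrans (sc _ lm) (esym (sc _ ln))) lm.
by rewrite /c eqxx (negPf nmn).
Qed.

(** Indexing the components by all natural numbers, rather than by an ordinal
    type depending on the sum, lets sums of different lengths be compared
    componentwise. *)
Definition hsum (I : set K) (N : nat) : set K :=
  [set x | exists a : nat -> K,
     (forall i, A i (a i) /\ I (a i)) /\ x = \sum_(i < N) a i].

(** Ideals are described by their homogeneous elements alone: the axioms are only
    required for these, and I may contain other elements of K. *)
Definition hideal (I : set K) : Prop :=
  [/\ I 0,
      forall n a b, A n a -> A n b -> I a -> I b -> I (a - b) &
      forall m n a b, A m a -> A n b -> I b -> I (a * b)].

Lemma hidealT : hideal setT. Proof. by []. Qed.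

Lemma hideal_add I n a b : hideal I -> A n a -> A n b -> I a -> I b -> I (a + b).
Proof.
move=> [I0 Isub _] Aa Ab Ia Ib; rewrite -[b]opprK -[- b]sub0r.
apply: (Isub n) => //; first by apply: comp_sub => //; exact: comp_zero.
by apply: (Isub n) => //; exact: comp_zero.
Qed.

Lemma comp_sum (J : Type) (s : seq J) (P : pred J) n (f : J -> K) :
  (forall i, P i -> A n (f i)) -> A n (\sum_(i <- s | P i) f i).
Proof.
move=> h; apply: big_ind => //; first exact: comp_zero.
by move=> x y; exact: comp_add.
Qed.

Lemma hideal_sum (I : set K) (J : Type) (s : seq J) (P : pred J) n (f : J -> K) :
  hideal I -> (forall i, P i -> A n (f i) /\ I (f i)) ->
  I (\sum_(i <- s | P i) f i).
Proof.
move=> hI h; suff [] : A n (\sum_(i <- s | P i) f i) /\ I (\sum_(i <- s | P i) f i).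
  by [].
apply: (big_ind (fun x => A n x /\ I x)) => //.
  by split; [exact: comp_zero|case: hI].
by move=> x y [Ax Ix] [Ay Iy]; split; [exact: comp_add|exact: hideal_add Ax Ay _ _].
Qed.

Lemma hsum_mono I N M x : hideal I -> (N <= M)%N -> hsum I N x -> hsum I M x.
Proof.
move=> [I0 _ _] NM [a [ha ->]]; exists (fun i => if (i < N)%N then a i else 0).
split=> [i|]; first by case: ifP => // _; split=> //; exact: comp_zero.
rewrite (big_ord_widen_cond M xpredT a NM) big_mkcond /=.
exact: eq_bigr.
Qed.

Lemma hsum0 I N : hideal I -> hsum I N 0.
Proof.
move=> [I0 _ _]; exists (fun _ => 0); split; last by rewrite big1.
by move=> i; split=> //; exact: comp_zero.
Qed.

Lemma hsum_sub I N x y : hideal I -> hsum I N x -> hsum I N y -> hsum I N (x - y).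
Proof.
move=> [_ Is _] [a [ha ->]] [b [hb ->]]; exists (fun i => a i - b i).
rewrite sumrB; split=> // i; have [Aa Ia] := ha i; have [Ab Ib] := hb i.
by split; [exact: comp_sub|exact: Is Aa Ab Ia Ib].
Qed.

Lemma hsum_add I N x y : hideal I -> hsum I N x -> hsum I N y -> hsum I N (x + y).
Proof.
move=> hI hx hy; rewrite -[y]opprK; apply: hsum_sub => //.
by rewrite -sub0r; apply: hsum_sub => //; exact: hsum0.
Qed.

Lemma hsum_homog (I : set K) n a : hideal I -> A n a -> I a -> hsum I n.+1 a.
Proof.
move=> [I0 _ _] Aa Ia; exists (fun i => if i == n then a else 0); split=> [i|].
  by case: eqP => [->//|_]; split=> //; exact: comp_zero.
rewrite big_ord_recr /= eqxx big1 ?add0r // => i _.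
by rewrite (ltn_eqF (ltn_ord i)).
Qed.

Lemma hsum_mulh (I : set K) m N c x :
  hideal I -> A m c -> hsum I N x -> hsum I (m + N) (c * x).
Proof.
move=> [I0 _ Im] Ac [a [ha ->]].
exists (fun i => if (m <= i)%N then c * a (i - m)%N else 0); split=> [i|].
  case: leqP => [mi|_]; last by split=> //; exact: comp_zero.
  have [Aa Ia] := ha (i - m)%N; split; last exact: Im Ac Aa Ia.
  by rewrite -{1}(subnKC mi); exact: comp_mul.
rewrite big_split_ord /= [X in X + _]big1 ?add0r; last first.
  by move=> i _; rewrite leqNgt ltn_ord.
rewrite mulr_sumr; apply: eq_bigr => i _.
by rewrite leq_addr addKn.
Qed.

Lemma hsum_mul (I : set K) M N c x :
  hideal I -> hsum setT M c -> hsum I N x -> hsum I (M + N) (c * x).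
Proof.
move=> hI [a [ha ->]] hx; rewrite mulr_suml.
apply: (big_ind (hsum I (M + N))) => [|y z|i _]; first exact: hsum0.
  exact: hsum_add.
apply: hsum_mono (hsum_mulh hI (ha i).1 hx) => //.
by rewrite leq_add2r ltnW.
Qed.

Lemma hsumE (I : set K) : hideal I ->
  [set x | exists (n : nat) (a : 'I_n -> K),
     (forall i : 'I_n, A i (a i) /\ I (a i)) /\ x = \sum_(i < n) a i] =
  \bigcup_N hsum I N.
Proof.
move=> [I0 _ _]; apply/seteqP; split=> x.
  move=> [n [a [ha ->]]]; exists n => //.
  exists (fun i => if insub i is Some j then a j else 0); split=> [i|].
    case: insubP => [j _ <-|_]; first exact: ha.
    by split=> //; exact: comp_zero.
  by apply: eq_bigr => i _; rewrite valK.
by move=> [n _ [a [ha ->]]]; exists n, (fun i => a i).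
Qed.

Lemma totalE : total A = \bigcup_N hsum setT N.
Proof.
rewrite -(hsumE hidealT); apply/seteqP; split=> x [n [a [ha ->]]].
  by exists n, a; split=> // i; split.
by exists n, a; split=> // i; have [] := ha i.
Qed.

Lemma total_hsum x : total A x -> exists N, hsum setT N x.
Proof. by rewrite totalE => -[N _]; exists N. Qed.

Lemma hsum_total N x : hsum setT N x -> total A x.
Proof. by rewrite totalE; exists N. Qed.

Lemma hsum_homogP (I : set K) n a : hideal I -> A n a ->
  (\bigcup_N hsum I N) a <-> I a.
Proof.
move=> hI Aa; split; last by exists n.+1 => //; exact: hsum_homog.
move=> [N _ hN]; have [b [hb eb]] := hsum_mono hI (leq_maxl N n.+1) hN.
pose d (i : nat) := if i == n then a else 0.
have [_] := hb n; suff -> : b n = d n by rewrite /d eqxx.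
apply: (@graded_sum_inj (maxn N n.+1) b d).
- by move=> i; have [] := hb i.
- by move=> i; rewrite /d; case: eqP => [->//|_]; exact: comp_zero.
- rewrite -eb /d (bigD1 (Ordinal (leq_maxr N n.+1))) //= eqxx big1 ?addr0 // => i ni.
  by case: eqP => // e; case/eqP: ni; exact: val_inj.
- exact: leq_maxr.
Qed.

Lemma hideal_proj (p : projPoint A) : hideal (pt_set p).
Proof.
split; first exact: pt_zero.
  by move=> n a b _ _; exact: pt_sub.
by move=> m n a b Aa Ab; apply: pt_mul; exact: comp_total Aa.
Qed.

Lemma pt_setE (p : projPoint A) : pt_set p = \bigcup_N hsum (pt_set p) N.
Proof.
rewrite -(hsumE (hideal_proj p)); apply/seteqP; split=> x.
  exact: pt_homog.
move=> [n [a [ha ->]]].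
apply: (big_ind (pt_set p)); first exact: pt_zero.
  move=> y z hy hz; rewrite -[z]opprK -[- z]sub0r.
  by apply: pt_sub => //; apply: pt_sub => //; exact: pt_zero.
by move=> i _; have [] := ha i.
Qed.

Lemma pt_ext (p q : projPoint A) :
  (forall n a, A n a -> (pt_set p a <-> pt_set q a)) -> p = q.
Proof.
move=> h; have e : pt_set p = pt_set q.
  rewrite [LHS]pt_setE [RHS]pt_setE; apply/seteqP; split=> x [N _ [a [ha ->]]];
    exists N => //; exists a; split=> // i; have [Aa pa] := ha i; split=> //;
    exact/(h _ _ Aa).
case: p q e {h} => [P p1 p2 p3 p4 p5 p6 p7 p8] [Q q1 q2 q3 q4 q5 q6 q7 q8] /= e.
by subst Q; congr ProjPoint; exact: Prop_irrelevance.
Qed.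

(** A homogeneous ideal that is prime as far as homogeneous elements are
    concerned is prime: if neither factor lies in it, neither do suitable
    components of highest degree, whose product is then a component of the
    product. *)
Lemma hprime_total (I : set K) : hideal I ->
  (forall m n a b, A m a -> A n b -> I (a * b) -> I a \/ I b) ->
  forall x y, total A x -> total A y -> (\bigcup_N hsum I N) (x * y) ->
  (\bigcup_N hsum I N) x \/ (\bigcup_N hsum I N) y.
Proof.
move=> hI Ip x y; rewrite totalE => -[n _ hx] [m _ hy].
set H := \bigcup_N _; have Hsub u v : H u -> H v -> H (u - v).
  move=> [N _ hu] [M _ hv]; exists (maxn N M) => //; apply: hsum_sub => //.
    exact: hsum_mono hI (leq_maxl _ _) hu.
  exact: hsum_mono hI (leq_maxr _ _) hv.
have Hadd u v : H u -> H v -> H (u + v).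
  move=> hu hv; rewrite -[v]opprK -[- v]sub0r; apply: (Hsub) => //.
  by apply: (Hsub) => //; exists 0%N => //; exact: hsum0 hI.
have Hmul N u v : hsum setT N u -> H v -> H (u * v).
  by move=> hu [M _ hv]; exists (N + M)%N => //; exact: hsum_mul.
have [s] := ubnP (n + m); elim: s n m x y hx hy => // s IH n m x y hx hy.
case: n hx => [[a [_ ->]] _ _|n hx].
  by rewrite big_ord0; left; exists 0%N => //; exact: hsum0.
case: m hy => [[a [_ ->]] _ _|m hy].
  by rewrite big_ord0; right; exists 0%N => //; exact: hsum0.
rewrite addSn addnS ltnS => nms Hxy.
have [a [ha ex]] := hx; have [b [hb ey]] := hy.
have [[Aa _] [Ab _]] := (ha n, hb m).
pose x' := \sum_(i < n) a i; pose y' := \sum_(i < m) b i.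
have hx' : hsum setT n x' by exists a.
have hy' : hsum setT m y' by exists b.
have {}ex : x = x' + a n by rewrite ex big_ord_recr.
have {}ey : y = y' + b m by rewrite ey big_ord_recr.
have [Ia|nIa] := pselect (I (a n)).
  have Ha : H (a n) by apply/(hsum_homogP hI Aa).
  case: (IH n m.+1 x' y hx' hy); [by rewrite addnS| |by left; rewrite ex; exact: Hadd|by right].
  have -> : x' * y = x * y - y * a n by rewrite ex; ring.
  by apply: (Hsub) => //; exact: Hmul hy Ha.
have [Ib|nIb] := pselect (I (b m)).
  have Hb : H (b m) by apply/(hsum_homogP hI Ab).
  case: (IH n.+1 m x y' hx hy'); [by rewrite addSn| |by left|by right; rewrite ey; exact: Hadd].
  have -> : x * y' = x * y - x * b m by rewrite ey; ring.
  by apply: (Hsub) => //; exact: Hmul hx Hb.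
(* All products of components other than a n * b m have smaller degree. *)
exfalso; suff /(Ip _ _ _ _ Aa Ab) [] : I (a n * b m) by [].
have [N _ hN] := Hxy; have [c [hc ec]] := hsum_mono hI (leq_maxl N (n + m).+1) hN.
have [d [hd ed]] : hsum setT (n + m) (x' * y' + (b m * x' + a n * y')).
  apply: hsum_add hidealT _ _; first exact: hsum_mul.
  apply: hsum_add hidealT _ _; last exact: hsum_mulh.
  by rewrite addnC; exact: hsum_mulh.
pose d' i := if (i < n + m)%N then d i else if i == (n + m)%N then a n * b m else 0.
have := hc (n + m)%N => -[_]; suff -> : c (n + m)%N = d' (n + m)%N.
  by rewrite /d' ltnn eqxx.
apply: (@graded_sum_inj (maxn N (n + m).+1)) => [i|i||]; last exact: leq_maxr.
- by have [] := hc i.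
- rewrite /d'; case: ltnP => _; first by have [] := hd i.
  by case: eqP => [->|_]; [exact: comp_mul|exact: comp_zero].
- rewrite -ec -(subnKC (leq_maxr N (n + m).+1)) big_split_ord /=.
  rewrite [X in _ = _ + X]big1 ?addr0; last first.
    move=> i _; rewrite /d' addSn ltnNge leqW ?leq_addr //=.
    by rewrite gtn_eqF // ltnS leq_addr.
  rewrite big_ord_recr /= {2}/d' ltnn eqxx.
  under eq_bigr => i _ do rewrite /d' ltn_ord.
  by rewrite -ed ex ey; ring.
Qed.

(** To construct a point of Proj, the axioms of a prime ideal only have to be
    checked on homogeneous elements. *)
Lemma hprime_point (I : set K) : hideal I -> ~ I 1 ->
  (forall m n a b, A m a -> A n b -> I (a * b) -> I a \/ I b) ->
  (exists n a, [/\ (0 < n)%N, A n a & ~ I a]) ->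
  exists p : projPoint A, forall n a, A n a -> (pt_set p a <-> I a).
Proof.
move=> hI I1 Ip [n0 [a0 [n0_gt0 Aa0 nIa0]]].
have homE := hsum_homogP hI.
have A1 : A 0%N 1 := comp_one.
have H0 : (\bigcup_N hsum I N) 0 by apply/(homE 0%N); [exact: comp_zero|case: hI].
have HT : \bigcup_N hsum I N `<=` total A.
  rewrite totalE => x [N _ [a [ha ->]]]; exists N => //; exists a; split=> // i.
  by have [] := ha i.
have Hs u v : (\bigcup_N hsum I N) u -> (\bigcup_N hsum I N) v ->
    (\bigcup_N hsum I N) (u - v).
  move=> [N _ hu] [M _ hv]; exists (maxn N M) => //; apply: hsum_sub => //.
    exact: hsum_mono hI (leq_maxl _ _) hu.
  exact: hsum_mono hI (leq_maxr _ _) hv.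
have Hm u v : total A u -> (\bigcup_N hsum I N) v -> (\bigcup_N hsum I N) (u * v).
  rewrite totalE => -[N _ hu] [M _ hv]; exists (N + M)%N => //; exact: hsum_mul.
have H1 : ~ (\bigcup_N hsum I N) 1 by move/(homE _ _ A1).
have Hh x : (\bigcup_N hsum I N) x -> exists (n : nat) (a : 'I_n -> K),
    (forall i : 'I_n, A i (a i) /\ (\bigcup_N hsum I N) (a i)) /\
    x = \sum_(i < n) a i.
  move=> [N _ [a [ha ->]]]; exists N, (fun i => a i); split=> // i.
  by have [Aa Ia] := ha i; split=> //; apply/(homE _ _ Aa).
have Hr : exists (n : nat) (a : K),
    [/\ (0 < n)%N, A n a & ~ (\bigcup_N hsum I N) a].
  by exists n0, a0; split=> // /(homE _ _ Aa0).
by exists (@ProjPoint k K inj A _ HT H0 Hs Hm H1 (hprime_total hI Ip) Hh Hr).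
Qed.

End HomogeneousPrimes.

(** * Isomorphic graded algebras have isomorphic Proj *)

Section ProjIso.
Context {k K1 K2 : fieldType} {inj1 : {rmorphism k -> K1}}
  {inj2 : {rmorphism k -> K2}}.
Variables (A1 : gradedAlgebra inj1) (A2 : gradedAlgebra inj2).
Variable phi : {rmorphism K1 -> K2}.

Lemma proj_isomorphic : (forall c, phi (inj1 c) = inj2 c) ->
  (forall n a, A1 n a -> A2 n (phi a)) ->
  (forall n b, A2 n b -> exists2 a, A1 n a & b = phi a) ->
  isomorphic (Proj A2) (Proj A1).
Proof.
move=> phi_inj A12 A21.
have phiI a b : phi a = phi b -> a = b by exact: fmorph_inj.
have /choice [m hm] : forall q : projPoint A2, exists p : projPoint A1,
    forall n a, A1 n a -> (pt_set p a <-> pt_set q (phi a)).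
  move=> q; have [q0 qs qm] := hideal_proj q.
  apply: (@hprime_point _ _ _ A1 [set a | pt_set q (phi a)]) => /=.
  - split=> /= [|n a b Aa Ab qa qb|l n a b Aa Ab qb]; first by rewrite rmorph0.
      by rewrite rmorphB; apply: (qs n) => //; exact: A12.
    by rewrite rmorphM; apply: (qm l n) => //; exact: A12.
  - by rewrite rmorph1; exact: pt_one.
  - move=> l n a b Aa Ab; rewrite rmorphM; apply: pt_prime.
      exact: comp_total (A12 _ _ Aa).
    exact: comp_total (A12 _ _ Ab).
  - have [n [b [n0 Ab nb]]] := pt_relevant q.
    have [a Aa e] := A21 _ _ Ab; exists n, a; split=> //; by rewrite -e.
have surj p : exists q, m q = p.
  have [p0 ps pm] := hideal_proj p.
  have [q hq] : exists q : projPoint A2,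
      forall n b, A2 n b -> (pt_set q b <-> exists2 a, pt_set p a & b = phi a).
    apply: (@hprime_point _ _ _ A2 [set b | exists2 a, pt_set p a & b = phi a]) => /=.
    - split=> /= [|n x y _ _ [a pa ->] [b pb ->]|l n a b Aa Ab [c pc e]].
      + by exists 0; rewrite ?rmorph0.
      + by exists (a - b); rewrite ?rmorphB //; exact: pt_sub.
      + have [a' Aa' ->] := A21 _ _ Aa; exists (a' * c); last by rewrite rmorphM e.
        by apply: pt_mul => //; exact: comp_total Aa'.
    - move=> [a pa]; rewrite -(rmorph1 phi) => /phiI e.
      by case: (@pt_one _ _ _ _ p); rewrite e.
    - move=> l n a b /A21[a' Aa' ->] /A21[b' Ab' ->] [c pc].
      rewrite -rmorphM => /phiI e; have := pc; rewrite -e.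
      move=> /(pt_prime (comp_total Aa') (comp_total Ab')).
      by case=> h; [left|right]; [exists a'|exists b'].
    - have [n [a [n0 Aa na]]] := pt_relevant p.
      exists n, (phi a); split=> //; first exact: A12 Aa.
      by move=> [b pb e]; apply: na; rewrite (phiI _ _ e).
  exists q; apply: pt_ext => n a Aa; rewrite (hm q n a Aa) (hq n _ (A12 _ _ Aa)).
  by split=> [[b pb /phiI ->]//|pa]; exists a.
exists (@zmap _ _ _ _ _ _ _ (proj_primes A1) (proj_primes A2) phi (fun _ => 1)
  id m phi_inj (fun _ => oner_neq0 _)
  (fun n a Aa => eq_ind_r (A2 n) (A12 n a Aa) (mulr1 _))
  (fun q n a Aa => eq_ind_r (fun b => pt_set q b <-> pt_set (m q) a)
     (iff_sym (hm q n a Aa)) (mulr1 _))).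
apply: zmap_isomorphism => //.
- move=> q q' e; apply: pt_ext => n b /A21[a Aa ->].
  by rewrite -(hm _ _ _ Aa) e (hm _ _ _ Aa).
- move=> n b g /A21[a Aa ->] /A21[f Af ->] g0; exists n, a, f; split=> //.
    by move=> q nq /(hm _ _ _ Af).
  by move=> p nf; have [q e] := surj p; exists q => // /(hm _ _ _ Af); rewrite e.
Qed.

End ProjIso.

(** * The basic open set defined by an element of degree one *)

Lemma comp_exp (k K : fieldType) (inj : {rmorphism k -> K}) (A : mulFamily inj)
    d a n : A d a -> A (d * n)%N (a ^+ n).
Proof.
move=> Aa; elim: n => [|n IH]; first by rewrite muln0; exact: comp_one.
by rewrite mulnS exprS; exact: comp_mul.
Qed.

Section BasicOpen.
Context {k K : fieldType} {inj : {rmorphism k -> K}} (A : gradedAlgebra inj).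

Variable g : K.
Hypotheses (Ag : A 1%N g) (g_neq0 : g != 0).

Lemma comp_exp1 n : A n (g ^+ n).
Proof. by rewrite -[n in A n]mul1n; exact: comp_exp. Qed.

Let gX n : g ^+ n != 0. Proof. by rewrite expf_neq0. Qed.

Let dehomog : set K := [set x | exists n a, A n a /\ x = a / g ^+ n].

Lemma dehomog_scal c : dehomog (inj c).
Proof.
by exists 0%N, (inj c); split; [exact: comp_scal|rewrite expr0 divr1].
Qed.

Lemma dehomog_sub a b : dehomog a -> dehomog b -> dehomog (a - b).
Proof.
move=> [n [a' [Aa ->]]] [m [b' [Ab ->]]].
exists (n + m)%N, (a' * g ^+ m - b' * g ^+ n); split.
  apply: comp_sub; first exact/comp_mul/comp_exp1.
  by rewrite addnC; exact/comp_mul/comp_exp1.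
by rewrite -mulNr addf_div // exprD mulNr.
Qed.

Lemma dehomog_mul a b : dehomog a -> dehomog b -> dehomog (a * b).
Proof.
move=> [n [a' [Aa ->]]] [m [b' [Ab ->]]]; exists (n + m)%N, (a' * b').
by rewrite mulf_div exprD; split=> //; exact: comp_mul.
Qed.

Definition dehomog_alg : subalgebra inj :=
  Subalgebra dehomog_scal dehomog_sub dehomog_mul.

(** A prime of the ring of fractions of degree 0 determines a point of Proj:
    a homogeneous a of degree n belongs to it when a / g ^+ n does. *)
Lemma spec_proj_point (q : primeIdeal dehomog_alg) :
  exists p : projPoint A, forall n a, A n a ->
    (pt_set p a <-> prime_set q (a / g ^+ n)).
Proof.
pose I := [set a | exists2 n, A n a & prime_set q (a / g ^+ n)].
have IE n a : A n a -> (I a <-> prime_set q (a / g ^+ n)).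
  move=> Aa; split=> [[m Ama]|]; last by exists n.
  have [->|a0] := eqVneq a 0; first by rewrite !mul0r.
  by rewrite (graded_deg_uniq Ama Aa a0).
have A1 : A 0%N 1 by exact: comp_one.
have [||||p hp] := @hprime_point _ _ _ A I.
- split.
  + by exists 0%N; [exact: comp_zero|rewrite mul0r; exact: prime_zero].
  + move=> n a b Aa Ab /(IE _ _ Aa) qa /(IE _ _ Ab) qb.
    by apply/(IE _ _ (comp_sub Aa Ab)); rewrite mulrBl; exact: prime_sub.
  + move=> m n a b Aa Ab /(IE _ _ Ab) qb; apply/(IE _ _ (comp_mul Aa Ab)).
    by rewrite exprD -mulf_div; apply: prime_mul => //; exists m, a.
- by move/(IE _ _ A1); rewrite expr0 divr1; exact: prime_one.
- move=> m n a b Aa Ab /(IE _ _ (comp_mul Aa Ab)); rewrite exprD -mulf_div.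
  move/prime_prime => -[||h|h]; [by exists m, a|by exists n, b|left|right].
    exact/(IE _ _ Aa).
  exact/(IE _ _ Ab).
- exists 1%N, g; split=> // /(IE _ _ Ag); rewrite expr1 divff //.
  exact: prime_one.
by exists p => n a Aa; rewrite (hp n a Aa); exact: IE Aa.
Qed.

(** Conversely a point of Proj at which g does not vanish determines a prime of
    the ring of fractions of degree 0, as powers of g can be cancelled. *)
Lemma proj_spec_point (p : projPoint A) : ~ pt_set p g ->
  exists q : primeIdeal dehomog_alg, forall n a, A n a ->
    (prime_set q (a / g ^+ n) <-> pt_set p a).
Proof.
move=> npg; pose I := [set x | exists n a, [/\ A n a, pt_set p a & x = a / g ^+ n]].
have npX n : ~ pt_set p (g ^+ n).
  elim: n => [|n IH]; first by rewrite expr0; exact: pt_one.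
  by rewrite exprS => /(pt_prime (comp_total Ag) (comp_total (comp_exp1 n))) [].
have IE n a : A n a -> (I (a / g ^+ n) <-> pt_set p a).
  move=> Aa; split=> [|pa]; last by exists n, a.
  move=> [m [b [Ab pb /eqP]]]; rewrite eqr_div // => /eqP e.
  have : pt_set p (a * g ^+ m).
    by rewrite e mulrC; apply: pt_mul => //; exact: comp_total (comp_exp1 n).
  by case/(pt_prime (comp_total Aa) (comp_total (comp_exp1 m))) => // /npX.
have p0 := pt_zero p.
have Isub : I `<=` dehomog by move=> x [n [a [Aa _ ->]]]; exists n, a.
have I0 : I 0 by exists 0%N, 0; split=> //; [exact: comp_zero|rewrite mul0r].
have Is x y : I x -> I y -> I (x - y).
  move=> [n [a [Aa pa ->]]] [m [b [Ab pb ->]]].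
  exists (n + m)%N, (a * g ^+ m - b * g ^+ n); split.
  - apply: comp_sub; first exact/comp_mul/comp_exp1.
    by rewrite addnC; exact/comp_mul/comp_exp1.
  - apply: pt_sub; rewrite mulrC; apply: pt_mul => //.
      exact: comp_total (comp_exp1 m).
    exact: comp_total (comp_exp1 n).
  - by rewrite -mulNr addf_div // exprD mulNr.
have Im x y : dehomog x -> I y -> I (x * y).
  move=> [n [a [Aa ->]]] [m [b [Ab pb ->]]]; exists (n + m)%N, (a * b).
  rewrite mulf_div exprD; split=> //; first exact: comp_mul.
  by apply: pt_mul => //; exact: comp_total Aa.
have I1 : ~ I 1.
  have := IE 0%N 1 comp_one; rewrite expr0 divr1 => -> ; exact: pt_one.
have Ip x y : dehomog x -> dehomog y -> I (x * y) -> I x \/ I y.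
  move=> [n [a [Aa ->]]] [m [b [Ab ->]]]; rewrite mulf_div -exprD.
  move/(IE _ _ (comp_mul Aa Ab)) => /(pt_prime (comp_total Aa) (comp_total Ab)).
  by case=> h; [left; apply/(IE _ _ Aa)|right; apply/(IE _ _ Ab)].
by exists (@PrimeIdeal k K inj dehomog_alg I Isub I0 Is Im I1 Ip).
Qed.

Lemma prime_ext (q q' : primeIdeal dehomog_alg) :
  (forall n a, A n a ->
     (prime_set q (a / g ^+ n) <-> prime_set q' (a / g ^+ n))) -> q = q'.
Proof.
move=> h; have e : prime_set q = prime_set q'.
  apply/seteqP; split=> x qx; have [n [a [Aa ex]]] := prime_subset qx;
    move: qx; rewrite ex => qx; exact/(h _ _ Aa).
case: q q' e {h} => [P p1 p2 p3 p4 p5 p6] [Q q1 q2 q3 q4 q5 q6] /= e.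
by subst Q; congr PrimeIdeal; exact: Prop_irrelevance.
Qed.

(** Dehomogenizing a homogeneous element of degree n means dividing it by
    g ^+ n, which is the rescaling needed to let the inclusion of rings
    induce a morphism from the affine to the projective spectrum. *)
Lemma basic_affine (W : opens (Proj A)) :
  oset W = [set p | ~ pt_set (p : projPoint A) g] -> affine_open W.
Proof.
move=> eW; exists K, inj, dehomog_alg.
have /choice [m hm] := spec_proj_point.
pose ug n : K := (g ^+ n)^-1.
have ug0 n : ug n != 0 by rewrite invr_eq0.
have Aphi n a : A n a -> subalg_family dehomog_alg 0%N (idfun a * ug n).
  by move=> Aa; exists n, a.
have mi (q : pts (spec_primes dehomog_alg)) n a : A n a ->
    (ideal q (idfun a * ug n) <-> ideal (m q : pts (proj_primes A)) a).
  by move=> Aa; apply: iff_sym; exact: hm.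
have surj (p : projPoint A) : ~ pt_set p g -> exists q, m q = p.
  move=> /proj_spec_point [q hq]; exists q; apply: pt_ext => n a Aa.
  by rewrite (hm _ _ _ Aa) (hq _ _ Aa).
exists (@zmap _ _ _ _ _ _ _ (proj_primes A) (spec_primes dehomog_alg) idfun ug
  (fun _ => 0%N) m (fun _ => erefl) ug0 Aphi mi); split.
  apply: zmap_open_immersion => [q q' e|_ _ _ [i [b [Ab ->]]] [j [f [Af ->]]] fg0].
    by apply: prime_ext => n a Aa; rewrite -(hm _ _ _ Aa) e (hm _ _ _ Aa).
  (* One extra factor g makes f g^(i+1) vanish exactly outside of the image. *)
  have AbE : A (i + j).+1 (b * g ^+ j.+1).
    by rewrite -addnS; exact/comp_mul/comp_exp1.
  have AfE : A (i + j).+1 (f * g ^+ i.+1).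
    by rewrite -addnS addnC addSnnS; exact/comp_mul/comp_exp1.
  have eE : f * g ^+ i.+1 / g ^+ (i + j).+1 = f / g ^+ j.
    by rewrite -addSn exprD [g ^+ i.+1 * _]mulrC -mulf_div divff // mulr1.
  exists (i + j).+1, (b * g ^+ j.+1), (f * g ^+ i.+1); split=> //=.
  - have f0 : f != 0 by apply: contraNneq fg0 => ->; rewrite mul0r.
    by rewrite !exprS; field; rewrite ?gX ?f0 ?g_neq0.
  - by move=> q nq; rewrite (hm _ _ _ AfE) eE.
  - move=> p nf; have ng : ~ pt_set p g.
      move=> pg; apply: nf; rewrite exprSr mulrA.
      apply: pt_mul => //; apply: (@comp_total _ _ _ _ (j + i)).
      exact/comp_mul/comp_exp1.
    by have [q e] := surj p ng; exists q => //; rewrite -eE -(hm _ _ _ AfE) e.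
rewrite eW; apply/seteqP; split=> p /=; last by move=> /surj [q e]; exists q.
by move=> [q _ <-] /(hm _ _ _ Ag); rewrite expr1 divff //; exact: prime_one.
Qed.

End BasicOpen.

(** * Flatness of a localization of a free algebra *)

Record submodule (R : comPzRingType) (L : lmodType R) := Submodule {
  submod : set L;
  submod0 : submod 0;
  submodB : forall x y, submod x -> submod y -> submod (x - y);
  submodZ : forall a x, submod x -> submod (a *: x)
}.

(** Used to divide a module of families of vectors by the families that
    vanish eventually. *)
Section QuotientModule.
Context (R : comPzRingType) (L : lmodType R) (S : submodule L).

Let Z : set L := submod S.
Let Z0 : Z 0 := submod0 S.
Let ZB : forall x y, Z x -> Z y -> Z (x - y) := @submodB _ _ S.
Let ZZ : forall a x, Z x -> Z (a *: x) := @submodZ _ _ S.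

Let eqZ (x y : L) : bool := `[< Z (x - y) >].

Let ZN x : Z x -> Z (- x). Proof. by rewrite -sub0r; exact: ZB. Qed.

Let eqZ_refl : reflexive eqZ.
Proof. by move=> x; apply/asboolP; rewrite subrr. Qed.
Let eqZ_sym : ssrbool.symmetric eqZ.
Proof.
by move=> x y; apply/asboolP/asboolP => /ZN; rewrite opprB.
Qed.
Let eqZ_trans : transitive eqZ.
Proof.
move=> y x z /asboolP h /asboolP h'; apply/asboolP.
have -> : x - z = (x - y) - (- (y - z)) by rewrite opprK addrA subrK.
exact/ZB/ZN.
Qed.

Canonical quotZ_equiv := EquivRel eqZ eqZ_refl eqZ_sym eqZ_trans.

Definition quotZ : Type := {eq_quot eqZ}%qT.
HB.instance Definition _ : EqQuotient _ eqZ quotZ := EqQuotient.on quotZ.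
HB.instance Definition _ := Choice.on quotZ.

Definition to_quotZ (x : L) : quotZ := (\pi_quotZ x)%qT.

Lemma quotZP x y : to_quotZ x = to_quotZ y <-> Z (x - y).
Proof.
split=> [/eqmodP /asboolP //|h]; first by apply/eqmodP/asboolP.
Qed.

Lemma quotZ_repr (a : quotZ) : exists x, a = to_quotZ x.
Proof. by exists (repr a); rewrite -[LHS]reprK. Qed.

Let addZ (a b : quotZ) : quotZ := to_quotZ (repr a + repr b).
Let oppZ (a : quotZ) : quotZ := to_quotZ (- repr a).
Let scaleZ c (a : quotZ) : quotZ := to_quotZ (c *: repr a).

Let reprZ x : Z (repr (to_quotZ x) - x).
Proof. by apply/quotZP; rewrite -[RHS]reprK. Qed.

Let addE x y : addZ (to_quotZ x) (to_quotZ y) = to_quotZ (x + y).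
Proof.
apply/quotZP; rewrite opprD addrACA -[_ - y]opprK.
by apply: ZB => //; apply: ZN.
Qed.
Let oppE x : oppZ (to_quotZ x) = to_quotZ (- x).
Proof. by apply/quotZP; rewrite -opprD; exact: ZN. Qed.
Let scaleE c x : scaleZ c (to_quotZ x) = to_quotZ (c *: x).
Proof. by apply/quotZP; rewrite -scalerBr; exact: ZZ. Qed.

Let addZA : associative addZ.
Proof.
move=> a b c; have [[[x ->] [y ->]] [z ->]] := (quotZ_repr a, quotZ_repr b, quotZ_repr c).
by rewrite !addE addrA.
Qed.
Let addZC : commutative addZ.
Proof.
by move=> a b; have [[x ->] [y ->]] := (quotZ_repr a, quotZ_repr b); rewrite !addE addrC.
Qed.
Let add0Z : left_id (to_quotZ 0) addZ.
Proof. by move=> a; have [x ->] := quotZ_repr a; rewrite addE add0r. Qed.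
Let addNZ : left_inverse (to_quotZ 0) oppZ addZ.
Proof. by move=> a; have [x ->] := quotZ_repr a; rewrite oppE addE addNr. Qed.
HB.instance Definition _ := GRing.isZmodule.Build quotZ addZA addZC add0Z addNZ.

Let scaleZA a b v : scaleZ a (scaleZ b v) = scaleZ (a * b) v.
Proof. by have [x ->] := quotZ_repr v; rewrite !scaleE scalerA. Qed.
Let scale1Z : left_id 1 scaleZ.
Proof. by move=> v; have [x ->] := quotZ_repr v; rewrite scaleE scale1r. Qed.
Let scaleZDr : right_distributive scaleZ +%R.
Proof.
move=> c a b; have [[x ->] [y ->]] := (quotZ_repr a, quotZ_repr b).
have D u v : to_quotZ u + to_quotZ v = to_quotZ (u + v) := addE u v.
by rewrite D !scaleE D scalerDr.
Qed.
Let scaleZDl v : {morph scaleZ^~ v : a b / a + b}.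
Proof.
by move=> a b; have [x ->] := quotZ_repr v; rewrite !scaleE [RHS]addE scalerDl.
Qed.
HB.instance Definition _ := GRing.Zmodule_isLmodule.Build R quotZ
  scaleZA scale1Z scaleZDr scaleZDl.

Lemma to_quotZD x y : to_quotZ (x + y) = to_quotZ x + to_quotZ y.
Proof. by rewrite [RHS]addE. Qed.
Lemma to_quotZZ c x : to_quotZ (c *: x) = c *: to_quotZ x.
Proof. by rewrite [RHS]scaleE. Qed.
Lemma to_quotZ_eq0 x : to_quotZ x = 0 <-> Z x.
Proof. by rewrite -[X in Z X]subr0; exact: quotZP. Qed.

End QuotientModule.

Section FlatLocalization.
(** O' is the localization at T of the free O-module M spanned by the e_i: T
    consists of units of O' that multiply M into itself, and every element of
    O' has a multiple by an element of T in M. *)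
Context (O O' : comPzRingType) (phi : O -> O').
Hypothesis phiB : zmod_morphism phi.
Hypothesis phiM : forall a b, phi (a * b) = phi a * phi b.
Variables (n : nat) (e : 'I_n -> O') (T : set O').
Hypothesis free_e : forall c : 'I_n -> O, \sum_(i < n) phi (c i) * e i = 0 ->
  forall i, c i = 0.
Let M : set O' := [set x | exists c : 'I_n -> O, x = \sum_(i < n) phi (c i) * e i].
Hypothesis T1 : T 1.
Hypothesis TM : forall a b, T a -> T b -> T (a * b).
Hypothesis T_unit : forall t, T t -> exists t', t * t' = 1.
Hypothesis TMul : forall t m, T t -> M m -> M (t * m).
Hypothesis T_den : forall b, exists2 t, T t & M (t * b).

Let MD x y : M x -> M y -> M (x + y).
Proof.
move=> [c ->] [d ->]; exists (fun i => c i + d i).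
by rewrite -big_split; apply: eq_bigr => i _ /=; rewrite (zmod_morphD phiB) mulrDl.
Qed.

Let MZ a x : M x -> M (phi a * x).
Proof.
move=> [c ->]; exists (fun i => a * c i).
by rewrite mulr_sumr; apply: eq_bigr => i _; rewrite phiM mulrA.
Qed.

Let coef_uniq (c d : 'I_n -> O) :
  \sum_(i < n) phi (c i) * e i = \sum_(i < n) phi (d i) * e i -> c = d.
Proof.
move=> /eqP; rewrite -subr_eq0 -sumrB => /eqP h; apply: funext => i.
apply/eqP; rewrite -subr_eq0; apply/eqP; move: i; apply: free_e.
by rewrite -[RHS]h; apply: eq_bigr => i _; rewrite phiB mulrBl.
Qed.

(** Let M be the free submodule of O' spanned by e.  A module P receiving a
    bilinear map from N' x O' in which vanishing can be read off is obtained by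
    sending (m, b) to the family, indexed by t in T, of the coordinates of
    m (x) t b in the free N'-module N' (x) M; this makes sense for all
    sufficiently divisible t, so families are identified when they agree there.
    If the sum of the h (m_k) (x) b_k is 0, then so is the sum of the
    h (m_k) (x) t b_k for some t, which by injectivity of h is an identity
    between coordinates in N, and t is invertible in O'. *)
Lemma flat_localization : flat_hom phi.
Proof.
move=> N N' h h_inj s hs P b bDl bDr bZl bZr.
have /choice [cf hcf] : forall x, exists c : 'I_n -> O,
    (M x -> x = \sum_(i < n) phi (c i) * e i) /\ (~ M x -> c = fun=> 0).
  move=> x; have [[c ec]|nM] := pselect (M x); last by exists (fun=> 0).
  by exists c; split=> // nM; case: nM; exists c.
have cfE x : M x -> x = \sum_(i < n) phi (cf x i) * e i by case: (hcf x).
have cfD x y : M x -> M y -> cf (x + y) = fun i => cf x i + cf y i.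
  move=> Mx My; apply: coef_uniq; rewrite -cfE; last exact: MD.
  rewrite {1}(cfE x Mx) {1}(cfE y My) -big_split.
  by apply: eq_bigr => i _ /=; rewrite (zmod_morphD phiB) mulrDl.
have cfZ a x : M x -> cf (phi a * x) = fun i => a * cf x i.
  move=> Mx; apply: coef_uniq; rewrite -cfE; last exact: MZ.
  by rewrite {1}(cfE x Mx) mulr_sumr; apply: eq_bigr => i _; rewrite phiM mulrA.
(* f (t, j) stands for the j-th coordinate of t f, for t divisible enough. *)
pose Fn := (O' * 'I_n -> N')%type.
pose Z : set Fn := [set f | exists2 t0, T t0 &
  forall t, T t -> forall j, f (t * t0, j) = 0].
have Z0 : Z 0 by exists 1.
have ZB f g : Z f -> Z g -> Z (f - g).
  move=> [t Tt ht] [u Tu hu]; exists (t * u); first exact: TM.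
  move=> v Tv j; have -> : (f - g) (v * (t * u), j) = f (v * (t * u), j) - g (v * (t * u), j) by [].
  by rewrite {1}[t * u]mulrC !mulrA ht ?hu ?subrr //; exact: TM.
have ZZ a f : Z f -> Z (a *: f).
  move=> [t Tt ht]; exists t => // v Tv j.
  have -> : (a *: f) (v * t, j) = a *: f (v * t, j) by [].
  by rewrite ht // scaler0.
pose cls : Fn -> quotZ (Submodule Z0 ZB ZZ) := to_quotZ _.
pose fam m x : Fn := fun tj => cf (tj.1 * x) tj.2 *: m.
pose bP m x := cls (fam m x).
have ev f g : Z (f - g) -> cls f = cls g by move=> hz; apply/quotZP.
have hsP : \sum_(p <- [seq (h p.1, p.2) | p <- s]) bP p.1 p.2 = 0.
  apply: hs => [m m' x|m x x'|a m x|a m x].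
  - rewrite /bP /cls -to_quotZD; congr (to_quotZ _ _); apply: funext => tj.
    exact: scalerDr.
  - rewrite /bP /cls -to_quotZD; apply: ev.
    have [[t Tt Mt] [u Tu Mu]] := (T_den x, T_den x').
    exists (t * u); first exact: TM.
    move=> v Tv j; change (cf (v * (t * u) * (x + x')) j *: m -
      (cf (v * (t * u) * x) j *: m + cf (v * (t * u) * x') j *: m) = 0).
    apply/eqP; rewrite subr_eq0 -scalerDl; apply/eqP; congr (_ *: _).
    rewrite mulrDr cfD //.
      by rewrite -mulrA [t * u]mulrC -mulrA; do 2?apply: TMul.
    by rewrite -!mulrA; do 2?apply: TMul.
  - rewrite /bP /cls -to_quotZZ; congr (to_quotZ _ _); apply: funext => tj.
    by rewrite /fam scalerA mulrC -scalerA.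
  - rewrite /bP /cls -to_quotZZ; apply: ev.
    have [t Tt Mt] := T_den x; exists t => // v Tv j.
    have Mvt : M (v * t * x) by rewrite -mulrA; apply: TMul.
    change (cf (v * t * (phi a * x)) j *: m - a *: (cf (v * t * x) j *: m) = 0).
    by rewrite mulrCA cfZ // scalerA subrr.
have [t0 Tt0 h0] : Z (\sum_(p <- s) fam (h p.1) p.2).
  apply/(to_quotZ_eq0 (Submodule Z0 ZB ZZ)); rewrite -[RHS]hsP big_map /bP /cls.
  elim: (s) => [|p s' IH]; first by rewrite !big_nil; apply/to_quotZ_eq0.
  by rewrite !big_cons to_quotZD IH.
have [t Tt Mt] : exists2 t, T t & forall p, p \in s -> M (t * p.2).
  elim: (s) => [|p s' [t Tt IH]]; first by exists 1.
  have [u Tu Mu] := T_den p.2; exists (t * u); first exact: TM.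
  move=> r; rewrite inE => /orP[/eqP ->|/IH]; rewrite -mulrA.
    exact: TMul.
  by rewrite mulrCA; exact: TMul.
have Tu := TM Tt Tt0; set u := t * t0 in Tu.
have [u' uu'] := T_unit Tu.
have Mu p : p \in s -> M (u * p.2).
  move=> /Mt Mtp; have -> : u * p.2 = t0 * (t * p.2) by rewrite /u mulrAC mulrC.
  exact: TMul.
have z0 j : \sum_(p <- s) cf (u * p.2) j *: p.1 = 0.
  apply: h_inj; rewrite linear0 linear_sum -[RHS](h0 t Tt j) fct_sumE.
  by apply: eq_bigr => p _; rewrite linearZ.
have b0 x : b 0 x = 0 by rewrite -(scale0r 0) bZl scale0r.
have b0r m : b m 0 = 0 by apply: (addrI (b m 0)); rewrite -bDr !addr0.
have bsl (I : Type) (r : seq I) (f : I -> N) x :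
    b (\sum_(i <- r) f i) x = \sum_(i <- r) b (f i) x.
  by apply: (big_morph (b^~ x)) => // m m'; exact: bDl.
have bsr (I : Type) (r : seq I) m (f : I -> O') :
    b m (\sum_(i <- r) f i) = \sum_(i <- r) b m (f i).
  by apply: (big_morph (b m)) => // x x'; exact: bDr.
transitivity (\sum_(p <- s) \sum_(j < n) b (cf (u * p.2) j *: p.1) (u' * e j)).
  apply: eq_big_seq => p ps.
  have {1}-> : p.2 = u' * (u * p.2) by rewrite mulrA [u' * u]mulrC uu' mul1r.
  rewrite {1}(cfE _ (Mu _ ps)) mulr_sumr bsr; apply: eq_bigr => j _.
  by rewrite mulrCA bZr bZl.
by rewrite exchange_big big1 // => j _; rewrite -bsl z0 b0.
Qed.

End FlatLocalization.

(** * Stalks as subrings of the ambient field *)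

Section StalkValue.
Context {k K : fieldType} {inj : {rmorphism k -> K}} {A : mulFamily inj}
  (P : primeSpace A) (p : prime_lrSpace P).

(** Sections are functions with values in K, so a germ has a value at its base
    point; being locally a fraction, the germ is determined by this value. *)
Definition stalk_val (a : stalk p) : K :=
  (germ_sect (repr a) : zsect _) (exist _ p (germ_mem (repr a))).

Lemma stalk_val_germ (W : opens (prime_lrSpace P)) (hp : oset W p)
    (s : sect (prime_lrSpace P) W) :
  stalk_val (germ hp s) = (s : zsect W) (exist _ p hp).
Proof.
have [W' [ha [hb [W'p]]]] := (germ_eqE _ _ _ _).1 (germ_repr (germ hp s)).
move=> /(congr1 (fun t : zsect W' => t (exist _ p W'p))) /= e.
transitivity ((germ_sect (repr (germ hp s)) : zsect _)
  (sub_pt ha (exist (oset W') p W'p))); first by congr (zval _ _); exact: sig_eq.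
rewrite e; congr (zval _ _); exact: sig_eq.
Qed.

Lemma stalk_val_inj : injective stalk_val.
Proof.
move=> a b; have [W [hp [s [t [-> ->]]]]] := germ2P a b.
rewrite !stalk_val_germ => e; apply/germ_eqE.
have [W1 [W1p [n [c [f [_ _ h1]]]]]] := zvalP s (exist _ p hp).
have [W2 [W2p [m [d [g [_ _ h2]]]]]] := zvalP t (exist _ p hp).
pose W' : opens (prime_lrSpace P) :=
  Opens (openI_zariski W (Opens (openI_zariski W1 W2))).
have hW : oset W' `<=` oset W by move=> y [].
exists W', hW, hW; split; first by split.
apply: zsect_eq => q /=; have [_ [W1q W2q]] := svalP q.
have [_ ->] := h1 (sub_pt hW q) W1q; have [_ ->] := h2 (sub_pt hW q) W2q.
have [_ <-] := h1 _ W1p; have [_ <-] := h2 _ W2p; exact: e.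
Qed.

Lemma stalk_valB a b : stalk_val (a - b) = stalk_val a - stalk_val b.
Proof.
have [W [hp [s [t [-> ->]]]]] := germ2P a b.
have -> : germ hp s - germ hp t = germ hp (s - t).
  by rewrite -germD -germN.
by rewrite !stalk_val_germ.
Qed.

Lemma stalk_valM a b : stalk_val (a * b) = stalk_val a * stalk_val b.
Proof.
have [W [hp [s [t [-> ->]]]]] := germ2P a b.
have -> : germ hp s * germ hp t = germ hp (s * t) by rewrite -germM.
by rewrite !stalk_val_germ.
Qed.

Lemma stalk_val0 : stalk_val 0 = 0.
Proof. exact: zmod_morph0 stalk_valB. Qed.

Lemma stalk_val1 : stalk_val 1 = 1.
Proof. by rewrite [1]/(stalk_one p) stalk_val_germ. Qed.

Lemma stalk_val_sum (I : Type) (r : seq I) (F : I -> stalk p) :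
  stalk_val (\sum_(i <- r) F i) = \sum_(i <- r) stalk_val (F i).
Proof.
exact: zmod_morph_sum stalk_valB _ _ _ _.
Qed.

Lemma stalk_val_frac (a : stalk p) : exists n b f,
  [/\ A n b, A n f, ~ ideal (p : zariski P) f & stalk_val a = b / f].
Proof.
have [W [hp [s ->]]] := germP a; rewrite stalk_val_germ.
have [W1 [W1p [n [c [f [Ac Af h1]]]]]] := zvalP s (exist _ p hp).
by have [nf e] := h1 _ W1p; exists n, c, f; split.
Qed.

Lemma frac_stalk_val n b f : A n b -> A n f -> ~ ideal (p : zariski P) f ->
  exists a : stalk p, stalk_val a = b / f.
Proof.
move=> Ab Af nf; pose W : opens (prime_lrSpace P) := D_opens P Af.
exists (@germ _ (prime_lrSpace P) p W nf
  (ZSect (is_section_cst (P := P) (W := W) Ab Af (fun q h => h)))).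
by rewrite stalk_val_germ.
Qed.

End StalkValue.

(** * The quotient of Proj by a finite group *)

Section GenericPoint.
Context {k K : fieldType} {inj : {rmorphism k -> K}} (A : gradedAlgebra inj).

Lemma generic_point (p : projPoint A) :
  exists z : projPoint A, forall n a, A n a -> (pt_set z a <-> a = 0).
Proof.
apply: (@hprime_point _ _ _ A [set a | a = 0]) => /=.
- split=> /= [//|n a b _ _ -> ->|m n a b _ _ ->]; first by rewrite subr0.
  by rewrite mulr0.
- by move/eqP; rewrite oner_eq0.
- by move=> m n a b _ _ /eqP; rewrite mulf_eq0 => /orP[] /eqP; [left|right].
- have [n [a [n0 Aa na]]] := pt_relevant p; exists n, a; split=> // a0.
  by apply: na; rewrite a0; exact: pt_zero.
Qed.

(** The generic point lies in every nonempty open set, so a section is a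
    constant function with values in K. *)
Lemma zsect_const (W : opens (Proj A)) (s : zsect W) p q : s p = s q.
Proof.
have [z hz] := generic_point (sval p).
have gen r : oset W z /\ forall Wz, s r = s (exist (oset W) z Wz).
  have near W1 : oset W1 (sval r) -> oset (W1 : opens (Proj A)) z.
    move=> W1r; have /zariski_openP /(_ _ W1r) [n [f [Af nf hf]]] := oset_open W1.
    by apply: hf => /(hz _ _ Af) f0; apply: nf; rewrite f0; exact: pt_zero.
  split=> [|Wz]; first by apply: near; exact: svalP.
  have [W1 [W1r [n [a [f [Aa Af h]]]]]] := zvalP s r.
  have [_ ->] := h r W1r.
  by have [_ ->] := h (exist (oset W) z Wz) (near _ W1r).
by have [Wz hp] := gen p; have [_ hq] := gen q; rewrite (hp Wz) (hq Wz).
Qed.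

(** Points are ideals of the algebra generated by homogeneous elements, so they
    contain the components of their elements. *)
Lemma pt_component (p : projPoint A) N (a : nat -> K) : (forall i, A i (a i)) ->
  pt_set p (\sum_(i < N) a i) -> forall i, (i < N)%N -> pt_set p (a i).
Proof.
move=> ha pa i iN.
have [M _ hM] : (\bigcup_M hsum A (pt_set p) M) (\sum_(i < N) a i).
  by rewrite -pt_setE.
have hp := hideal_proj p.
have [b [hb eb]] := hsum_mono hp (leq_maxr N M) hM.
have [_] := hb i; pose c j := if (j < N)%N then a j else 0.
suff -> : b i = c i by rewrite /c iN.
apply: (@graded_sum_inj _ _ _ A (maxn N M) b c) => [j|j||].
- by have [] := hb j.
- by rewrite /c; case: ifP => // _; exact: comp_zero.
- rewrite -eb (big_ord_widen_cond _ xpredT a (leq_maxl N M)) big_mkcond /=.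
  exact: eq_bigr.
- exact: leq_trans iN (leq_maxl _ _).
Qed.

Lemma pt_expN (p : projPoint A) d a n : A d a -> ~ pt_set p a -> ~ pt_set p (a ^+ n).
Proof.
move=> Aa na; elim: n => [|n IH]; first by rewrite expr0; exact: pt_one.
rewrite exprS => /(pt_prime (comp_total Aa)) [|//|//].
exact: comp_total (comp_exp n Aa).
Qed.

End GenericPoint.

Lemma zval_sum (k K : fieldType) (inj : {rmorphism k -> K}) (A : mulFamily inj)
    (P : primeSpace A) (W : opens (zariski P)) (I : Type) (r : seq I)
    (s : I -> zsect W) p :
  zval (\sum_(i <- r) s i) p = \sum_(i <- r) s i p.
Proof. by apply: (big_morph (fun t : zsect W => t p)). Qed.

Section Quotient.
Context {k K : fieldType} {inj : {rmorphism k -> K}} (A B : gradedAlgebra inj).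
(** A finite group acts on A with invariants B, and A is free over B with
    homogeneous basis e.  The group is given by the family sigma of its
    elements, indexed by C and closed under multiplication on the left. *)
Variables (C : finType) (sigma : C -> K -> K) (c1 : C).
Hypothesis sigmaB : forall c, zmod_morphism (sigma c).
Hypothesis sigmaM : forall c x y, sigma c (x * y) = sigma c x * sigma c y.
Hypothesis sigmaA : forall c n a, A n a -> A n (sigma c a).
Hypothesis sigma1 : forall x, sigma c1 x = x.
Hypothesis sigma_perm : forall c0, exists2 t : C -> C,
  injective t & forall c x, sigma c0 (sigma c x) = sigma (t c) x.
Hypothesis BE : forall n x, B n x <-> A n x /\ forall c, sigma c x = x.
Variables (N : nat) (e : 'I_N -> K) (eps : 'I_N -> nat).
Hypothesis Ae : forall j, A (eps j) (e j).
Hypothesis spanA : forall n a, A n a -> exists2 b : 'I_N -> K,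
  (forall j, if (eps j <= n)%N then B (n - eps j)%N (b j) else b j = 0) &
  a = \sum_(j < N) b j * e j.
Hypothesis freeA : forall b : 'I_N -> K, (forall j c, sigma c (b j) = b j) ->
  \sum_(j < N) b j * e j = 0 -> forall j, b j = 0.

Lemma BA n b : B n b -> A n b. Proof. by move/BE => []. Qed.

Lemma total_BA : total B `<=` total A.
Proof.
move=> x [n [a [ha ->]]]; exists n, a; split=> // i; exact: BA.
Qed.

Lemma sigma0 c : sigma c 0 = 0.
Proof. exact: zmod_morph0. Qed.

Lemma sigma_fixV c x : sigma c x = x -> sigma c x^-1 = x^-1.
Proof.
have [->|x0] := eqVneq x 0.
  by rewrite invr0.
move=> h; have s1 : sigma c 1 = 1.
  by apply: (mulIf x0); have := sigmaM c 1 x; rewrite mul1r h => <-.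
by apply: (mulIf x0); have := sigmaM c x^-1 x; rewrite mulVf // s1 h => <-.
Qed.

(** If a does not vanish at p, then neither does a power of a of degree larger
    than that of all e_j, and some coefficient of its expansion is an invariant
    of positive degree that does not vanish at p. *)
Lemma quot_relevant (p : projPoint A) : exists (n : nat) (b : K),
  [/\ (0 < n)%N, B n b & ~ (pt_set p `&` total B) b].
Proof.
have [n [a [n0 Aa na]]] := pt_relevant p.
pose M := (\max_(j < N) eps j).+1.
have epsM j : (eps j < n * M)%N.
  by apply: (@leq_trans M); rewrite ?ltnS ?leq_bigmax // leq_pmull.
have [b hb eb] := spanA (comp_exp M Aa).
apply: contrapT => h; apply: (pt_expN (n := M) Aa na); rewrite eb.
apply: (@hideal_sum _ _ _ A _ _ _ _ (n * M)%N _ (hideal_proj p)) => j _; have := hb j.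
rewrite ltnW ?epsM // => Bb; split.
  by rewrite -(subnK (ltnW (epsM j))); apply: comp_mul => //; exact: BA.
rewrite mulrC; apply: pt_mul; first exact: comp_total (Ae j).
apply: contrapT => nb; apply: h; exists (n * M - eps j)%N, (b j).
by rewrite subn_gt0 epsM; split=> // -[].
Qed.

Lemma quot_homog (p : projPoint A) x : (pt_set p `&` total B) x ->
  exists (n : nat) (a : 'I_n -> K),
    (forall i : 'I_n, B i (a i) /\ (pt_set p `&` total B) (a i)) /\ x = \sum_(i < n) a i.
Proof.
move=> [px /total_hsum[n [b [hb ex]]]].
exists n, (fun i => b i); split=> // i; have [Bb _] := hb i; split=> //.
split; last exact: comp_total Bb.
apply: (@pt_component _ _ _ A p n) => // [j|]; last by rewrite -ex.
by have [/BA] := hb j.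
Qed.

Definition quot_point (p : projPoint A) : projPoint B.
Proof.
refine (@ProjPoint k K inj B (pt_set p `&` total B) _ _ _ _ _ _
  (@quot_homog p) (@quot_relevant p)).
- by move=> x [].
- by split; [exact: pt_zero|apply: (@comp_total _ _ _ _ 0%N); exact: comp_zero].
- move=> a b [pa Ba] [pb Bb]; split; first exact: pt_sub.
  have [[n ha] [m hb]] := (total_hsum Ba, total_hsum Bb).
  apply: (@hsum_total _ _ _ _ (maxn n m)); apply: hsum_sub => //; first exact: hsum_mono (leq_maxl _ _) ha.
  exact: hsum_mono (leq_maxr _ _) hb.
- move=> a b Ba [pb Bb]; split; first by apply: pt_mul => //; exact: total_BA.
  have [[n ha] [m hb]] := (total_hsum Ba, total_hsum Bb).
  by apply: (@hsum_total _ _ _ _ (n + m)%N); exact: hsum_mul.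
- by move=> [/pt_one].
- move=> a b Ba Bb [/(pt_prime (total_BA Ba) (total_BA Bb))].
  by case=> h _; [left|right].
Defined.

Lemma quot_pointE p n b : B n b -> pt_set (quot_point p) b <-> pt_set p b.
Proof. by move=> Bb; split=> [[]//|pb]; split=> //; exact: comp_total Bb. Qed.

Definition quot_map : morphism (Proj A) (Proj B) :=
  @zmap _ _ _ _ _ _ _ (proj_primes B) (proj_primes A) idfun (fun _ => 1) id
    quot_point (fun _ => erefl) (fun _ => oner_neq0 _)
    (fun n b Bb => eq_ind_r (A n) (BA Bb) (mulr1 _))
    (fun p n b Bb => eq_ind_r (fun a => pt_set p a <-> pt_set (quot_point p) b)
       (iff_sym (quot_pointE p Bb)) (mulr1 _)).

Lemma quot_map_induced : induced_by_inclusion quot_map.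
Proof. by split=> // n b /BE[]. Qed.

(** The possible cofactors of an element of degree d in a product of degree n;
    subtraction of natural numbers being truncated, 0 is the only one when d
    exceeds n. *)
Let quo (d n : nat) : set K := [set a | if (d <= n)%N then A (n - d)%N a else a = 0].

Let quo_sub d n a a' : quo d n a -> quo d n a' -> quo d n (a - a').
Proof.
rewrite /quo /=; case: ifP => _; first exact: comp_sub.
by move=> -> ->; rewrite subr0.
Qed.

Let quo_mul d n l x a : A l x -> quo d n a -> quo d (l + n) (x * a).
Proof.
rewrite /quo /= => Ax; case: ifP => dn; last first.
  by move=> ->; rewrite mulr0; case: ifP => // _; exact: comp_zero.
move=> Aa; rewrite (leq_trans dn (leq_addl _ _)) -addnBA //; exact: comp_mul.
Qed.

Let quo_comp d n a b : A d b -> quo d n a -> A n (a * b).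
Proof.
rewrite /quo /= => Ab; case: ifP => dn; last first.
  by move=> ->; rewrite mul0r; exact: comp_zero.
by move=> Aa; rewrite -(subnK dn); exact: comp_mul.
Qed.

Let quo_opp d n a : quo d n a -> quo d n (- a).
Proof.
move=> h; rewrite -sub0r; apply: quo_sub => //; rewrite /quo /=.
by case: ifP => // _; exact: comp_zero.
Qed.

Let quo_prod d n (I : Type) (s : seq I) c b (a : I -> K) :
  A d b -> A n c -> (forall i, quo d n (a i)) ->
  exists2 w, quo d (size s * n)%N w &
    \prod_(i <- s) (c - a i * b) = c ^+ size s - w * b.
Proof.
move=> Ab Ac ha; elim: s => [|i s [w hw IH]].
  exists 0; last by rewrite big_nil expr0 mul0r subr0.
  by rewrite /quo /=; case: ifP => // _; exact: comp_zero.
have Ack : A (size s * n)%N (c ^+ size s) by rewrite mulnC; exact: comp_exp.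
exists (c ^+ size s * a i - (- (c * w)) - (w * b) * a i); last first.
  by rewrite big_cons IH /= exprS; ring.
have Awb := quo_comp Ab hw; rewrite /= mulSn.
apply: quo_sub; [apply: quo_sub|].
- by rewrite addnC; exact: quo_mul.
- by apply: quo_opp; exact: quo_mul.
- by rewrite addnC; exact: quo_mul.
Qed.

(** The homogeneous elements of the ideal generated by X and b. *)
Let adjoin (X : set K) (d : nat) (b : K) : set K :=
  [set w | exists n a, [/\ A n w, quo d n a & X (w - a * b)]].

Let adjoinP X d b n w : hideal A X -> A d b -> A n w -> adjoin X d b w ->
  exists2 a, quo d n a & X (w - a * b).
Proof.
move=> [X0 _ _] Ab Aw [m [a [Amw ha hX]]].
have [w0|w0] := eqVneq w 0; last first.
  by rewrite -(graded_deg_uniq Amw Aw w0); exists a.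
exists 0; last by rewrite w0 mul0r subr0.
by rewrite /quo /=; case: ifP => // _; exact: comp_zero.
Qed.

Let adjoin_hideal X d b : hideal A X -> A d b -> hideal A (adjoin X d b).
Proof.
move=> hX Ab; have [X0 Xs Xm] := hX; split.
- exists 0%N, 0; split; rewrite ?mul0r ?subr0 //; first exact: comp_zero.
  by rewrite /quo /=; case: ifP => // _; exact: comp_zero.
- move=> n x y Ax Ay /(adjoinP hX Ab Ax)[a ha hx] /(adjoinP hX Ab Ay)[a' ha' hy].
  exists n, (a - a'); split; [exact: comp_sub|exact: quo_sub|].
  have -> : x - y - (a - a') * b = (x - a * b) - (y - a' * b) by ring.
  by apply: (Xs n) => //; apply: comp_sub => //; exact: (quo_comp Ab).
- move=> l n x y Ax Ay /(adjoinP hX Ab Ay)[a ha hy].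
  exists (l + n)%N, (x * a); split; [exact: comp_mul|exact: quo_mul|].
  have -> : x * y - x * a * b = x * (y - a * b) by ring.
  by apply: (Xm l n) => //; apply: comp_sub => //; exact: (quo_comp Ab).
Qed.

(** Lying over, with an ideal J to be contained in the point found.  Among the
    homogeneous ideals containing J whose intersection with B lies in y choose
    a maximal one, X.  If some b in y were not in X, then X would contain
    z = c - a b for some homogeneous c in B outside y; but then the norm of z,
    which is congruent to a power of c modulo b, lies in X and B, hence in y,
    and so does c. *)
Lemma lying_over (y : projPoint B) (J : set K) : hideal A J ->
  J `<=` \bigcup_n A n -> (forall n b, B n b -> J b -> pt_set y b) ->
  exists2 x : projPoint A, quot_point x = y & J `<=` pt_set x.
Proof.
move=> hJ JA Jy.
pose Q X := [/\ hideal A X, J `<=` X, X `<=` \bigcup_n A n &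
  forall n b, B n b -> X b -> pt_set y b].
have [X [PX Xmax]] : exists X, (X = set0 \/ Q X) /\
    forall X', X `<` X' -> ~ (X' = set0 \/ Q X').
  apply: (Zorn_bigcup (P := [set X | X = set0 \/ Q X])) => Fm hF tot.
  have FQ X x : Fm X -> X x -> Q X.
    by move=> /hF [-> []|].
  have [e0|/set0P [x0 [X0 FX0 X0x0]]] := eqVneq (\bigcup_(X in Fm) X) set0.
    by left.
  right; have [[X00 _ _] JX0 _ _] := FQ _ _ FX0 X0x0; split.
  - split.
    + by exists X0.
    + move=> n a b Aa Ab [X1 FX1 Xa] [X2 FX2 Xb].
      have [X3 FX3 [X3a X3b]] : exists2 X3, Fm X3 & X3 a /\ X3 b.
        by case: (tot _ _ FX1 FX2) => h; [exists X2|exists X1] => //; split=> //;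
          exact/h.
      have [[_ Xs _] _ _ _] := FQ _ _ FX3 X3a.
      by exists X3 => //; exact: (Xs n).
    + move=> m n a b Aa Ab [X1 FX1 Xb]; have [[_ _ Xm] _ _ _] := FQ _ _ FX1 Xb.
      by exists X1 => //; exact: (Xm m n).
  - by move=> x /JX0; exists X0.
  - by move=> x [X1 FX1 X1x]; have [_ _ h _] := FQ _ _ FX1 X1x; exact: h.
  - by move=> n b Bb [X1 FX1 X1b]; have [_ _ _ h] := FQ _ _ FX1 X1b; exact: h Bb X1b.
have hJ0 : J 0 by case: hJ.
have [hX JX XA Xy] : Q X.
  case: PX => // X0; exfalso; apply: (Xmax J); last by right; split.
  by rewrite X0; split=> // /(_ 0 hJ0).
have [X0 Xs Xm] := hX.
have max d b : A d b -> ~ X b -> exists n c a,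
    [/\ B n c, ~ pt_set y c, quo d n a & X (c - a * b)].
  move=> Ab nXb; apply: contrapT => h; apply: (Xmax (adjoin X d b)); last first.
    right; split; first exact: adjoin_hideal.
    - move=> x Jx; have [n _ Ax] := JA _ Jx; exists n, 0; split=> //.
        by rewrite /quo /=; case: ifP => // _; exact: comp_zero.
      by rewrite mul0r subr0; exact: JX.
    - by move=> w [n [a [Aw _ _]]]; exists n.
    - move=> n c Bc /(adjoinP hX Ab (BA Bc)) [a ha hXc].
      by apply: contrapT => nc; apply: h; exists n, c, a.
  split=> [x Xx|/(_ b)].
    have [n _ Ax] := XA _ Xx; exists n, 0; split=> //; last by rewrite mul0r subr0.
    by rewrite /quo /=; case: ifP => // _; exact: comp_zero.
  move/(_ _)/nXb; apply; exists d, 1; split=> //; last by rewrite mul1r subrr.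
  by rewrite /quo /= leqnn subnn; exact: comp_one.
have X1 : ~ X 1.
  have B1 : B 0%N 1 by exact: comp_one.
  by move/(Xy _ _ B1); exact: pt_one.
(* If neither a nor b lies in X, then c = u a and c' = u' b modulo X for some c
   and c' in B outside y, and c * c' would be in X. *)
have Xprime m n a b : A m a -> A n b -> X (a * b) -> X a \/ X b.
  move=> Aa Ab Xab; apply: contrapT => /not_orP[/(max _ _ Aa) + /(max _ _ Ab)].
  move=> [l [c [u [Bc nc hu Xc]]]] [l' [c' [u' [Bc' nc' hu' Xc']]]].
  suff : X (c * c').
    move/(Xy _ _ (comp_mul Bc Bc'))/(pt_prime (comp_total Bc) (comp_total Bc')).
    by case.
  have -> : c * c' = (c' * (c - u * a) + (u * a) * (c' - u' * b)) + u * u' * (a * b).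
    by ring.
  have Aua := quo_comp Aa hu; have Aub := quo_comp Ab hu'.
  have [Ac Ac'] := (BA Bc, BA Bc').
  have h1 : A l (c - u * a) by exact: comp_sub.
  have h2 : A l' (c' - u' * b) by exact: comp_sub.
  have h3 : X (u * u' * (a * b)).
    have [p Au] : exists p, A p (u * u').
      move: hu hu'; rewrite /quo /=.
      case: ifP => _ Au; last first.
        by rewrite Au mul0r; exists 0%N; exact: comp_zero.
      case: ifP => _ Au'; last first.
        by rewrite Au' mulr0; exists 0%N; exact: comp_zero.
      by eexists; exact: comp_mul Au Au'.
    by apply: (Xm p (m + n)%N) => //; exact: comp_mul.
  have h4 : A (l + l')%N (u * u' * (a * b)).
    by rewrite mulrACA; exact: comp_mul.
  have h5 : A (l + l')%N (c' * (c - u * a)) by rewrite addnC; exact: comp_mul.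
  have h6 : A (l + l')%N (u * a * (c' - u' * b)) by exact: comp_mul.
  have h7 : X (c' * (c - u * a)) by exact: Xm Ac' h1 Xc.
  have h8 : X (u * a * (c' - u' * b)) by exact: Xm Aua h2 Xc'.
  apply: (hideal_add hX _ h4) => //; first exact: comp_add.
  exact: (hideal_add hX h5 h6).
have yX n b : B n b -> pt_set y b -> X b.
  move=> Bb yb; apply: contrapT => nXb.
  have [l [c [a [Bc nc ha Xz]]]] := max _ _ (BA Bb) nXb.
  have b0 : b != 0 by apply: contra_notN nXb => /eqP ->.
  have [[Ab fb] [Ac fc]] := ((BE n b).1 Bb, (BE l c).1 Bc).
  have az : A l (c - a * b) by apply: comp_sub => //; exact: (quo_comp (BA Bb)).
  have hs g : quo n l (sigma g a).
    move: ha; rewrite /quo /=; case: ifP => _; first exact: sigmaA.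
    by move=> ->; exact: sigma0.
  have [w hw ew] := quo_prod (enum C) Ab Ac hs.
  have eN : \prod_(g <- enum C) (c - sigma g a * b) = \prod_g sigma g (c - a * b).
    by rewrite big_enum; apply: eq_bigr => g _; rewrite sigmaB sigmaM fb fc.
  have sprod g (P : pred C) (f : C -> K) :
      sigma g (\prod_(i | P i) f i) = sigma g 1 * \prod_(i | P i) sigma g (f i).
    rewrite mulrC; apply/esym.
    apply: (big_rec2 (fun u v => u * sigma g 1 = sigma g v)); first by rewrite mul1r.
    by move=> i u v _ h; rewrite sigmaM -h mulrA.
  set Pi := \prod_g _ in eN.
  have fPi g : sigma g Pi = Pi.
    have [t ti ht] := sigma_perm g.
    have s1 : sigma g 1 = 1.
      have [B1 h] := (BE 0%N 1).1 (comp_one (A := B)); exact: h.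
    rewrite /Pi sprod s1 mul1r [RHS](reindex_inj ti) /=.
    by apply: eq_bigr => i _; rewrite ht.
  have XPi : X Pi.
    rewrite /Pi (bigD1 c1) //= sigma1 mulrC.
    have [p Ap] : exists p, A p (\prod_(i | i != c1) sigma i (c - a * b)).
      apply: (big_ind (fun x => exists p, A p x)).
      - by exists 0%N; exact: comp_one.
      - by move=> u v [p hu] [p' hv]; exists (p + p')%N; exact: comp_mul.
      - by move=> i _; exists l; exact: sigmaA.
    exact: Xm Ap az Xz.
  have Bck : B (size (enum C) * l)%N (c ^+ size (enum C)).
    by rewrite mulnC; exact: comp_exp.
  have ewb : w * b = c ^+ size (enum C) - Pi by rewrite -eN ew; ring.
  have APi : A (size (enum C) * l)%N Pi.
    have -> : Pi = c ^+ size (enum C) - w * b by rewrite ewb; ring.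
    by apply: comp_sub; [exact: BA|exact: (quo_comp Ab)].
  have yPi : pt_set y Pi by apply: (Xy (size (enum C) * l)%N) => //; exact/BE.
  have fck : forall g, sigma g (c ^+ size (enum C)) = c ^+ size (enum C).
    by have [] := (BE _ _).1 Bck.
  have fw g : sigma g w = w.
    by apply: (mulIf b0); rewrite -{1}(fb g) -sigmaM ewb sigmaB fPi fck.
  have ywb : pt_set y (w * b).
    move: hw; rewrite /quo /=; case: ifP => _; last first.
      by move=> ->; rewrite mul0r; exact: pt_zero.
    move=> Aw; apply: pt_mul => //; apply: (@comp_total _ _ _ _ (size (enum C) * l - n)%N).
    by apply/BE.
  apply: (pt_expN (n := size (enum C)) Bc nc).
  have -> : c ^+ size (enum C) = w * b - (0 - Pi) by rewrite ewb; ring.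
  by do 2?[apply: pt_sub => //]; exact: pt_zero.
have [||||x hx] := @hprime_point _ _ _ A X => //.
  have [n [b [n0 Bb nb]]] := pt_relevant y.
  by exists n, b; split=> //; [exact: BA|move/(Xy _ _ Bb)].
exists x; last by move=> z Jz; have [n _ Az] := JA _ Jz; apply/(hx _ _ Az)/JX.
apply: pt_ext => n b Bb; split.
  by move/(quot_pointE x Bb)/(hx _ _ (BA Bb)); exact: Xy Bb.
by move=> yb; apply/(quot_pointE x Bb)/(hx _ _ (BA Bb)); exact: yX Bb yb.
Qed.

Hypothesis genB : forall y : projPoint B, exists2 g, B 1%N g & ~ pt_set y g.

(** Lying over for the zero ideal. *)
Lemma quot_surj (y : projPoint B) : exists x, quot_point x = y.
Proof.
have [|||x <- _] := @lying_over y [set a | a = 0]; last by exists x.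
- split=> /= [//|n a b _ _ -> ->|m n a b _ _ ->]; first by rewrite subr0.
  by rewrite mulr0.
- by move=> _ ->; exists 0%N => //; exact: comp_zero.
- by move=> n b _ ->; exact: pt_zero.
Qed.

Lemma frac_fix n a f c : B n a -> B n f -> sigma c (a / f) = a / f.
Proof.
by move=> /BE[_ fa] /BE[_ ff]; rewrite sigmaM fa sigma_fixV.
Qed.

Lemma zsect_fix (W : opens (Proj B)) (s : zsect W) q c : sigma c (s q) = s q.
Proof.
have [W' [W'q [n [a [f [Ba Bf h]]]]]] := zvalP s q.
by have [_ ->] := h q W'q; exact: frac_fix Ba Bf.
Qed.

Section LocalBasis.
Variables (g : K) (Bg : B 1%N g).

Lemma local_free (b : 'I_N -> K) : g != 0 ->
  (forall j c, sigma c (b j) = b j) ->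
  \sum_(j < N) b j * (e j / g ^+ eps j) = 0 -> forall j, b j = 0.
Proof.
move=> g0 fb s0 j; have gX : g ^+ eps j != 0 by rewrite expf_neq0.
apply: (mulIf (invr_neq0 gX)); rewrite mul0r.
apply: (freeA (b := fun j => b j / g ^+ eps j)) => [i c|]; last first.
  by rewrite -[RHS]s0; apply: eq_bigr => i _; rewrite mulrAC -mulrA.
rewrite sigmaM fb sigma_fixV //.
by have /BE[_] := comp_exp (eps i) Bg.
Qed.

(** If s is a quotient of elements of A at every point over y, then its
    denominators form an ideal contained in none of these points, so by lying
    over some denominator h lies in B and not in y; expand h * s in the basis. *)
Lemma descend (y : projPoint B) (s : K) : ~ pt_set y g ->
  (forall x, quot_point x = y ->
     exists n a f, [/\ A n a, A n f, ~ pt_set x f & s = a / f]) ->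
  exists2 b : 'I_N -> K,
    (forall j, exists n a f, [/\ B n a, B n f, ~ pt_set y f & b j = a / f]) &
    s = \sum_(j < N) b j * (e j / g ^+ eps j).
Proof.
move=> ng hs; pose J := [set a | exists2 n, A n a & A n (a * s)].
have JE n a : A n a -> J a -> A n (a * s).
  move=> Aa [m Am Ams]; have [->|a0] := eqVneq a 0.
    by rewrite mul0r; exact: comp_zero.
  by rewrite (graded_deg_uniq Aa Am a0).
have hJ : hideal A J.
  split.
  - by exists 0%N; rewrite ?mul0r; exact: comp_zero.
  - move=> n a b Aa Ab /(JE _ _ Aa) Ja /(JE _ _ Ab) Jb.
    by exists n; rewrite ?mulrBl; exact: comp_sub.
  - move=> m n a b Aa Ab /(JE _ _ Ab) Jb.
    by exists (m + n)%N; rewrite -?mulrA; exact: comp_mul.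
have [n [h [Bh Jh nh]]] : exists n h, [/\ B n h, J h & ~ pt_set y h].
  apply: contrapT => H; have [|n b Bb Jb|x xy Jx] := lying_over (y := y) hJ.
  - by move=> a [n Aa _]; exists n.
  - by apply: contrapT => nb; apply: H; exists n, b.
  have [n [a [f [Aa Af nf es]]]] := hs x xy.
  apply: (nf); apply: Jx; exists n => //.
  by rewrite es mulrC divfK //; exact: (@ideal_neq0 _ _ _ _ (proj_primes A) x).
have h0 : h != 0 by exact: (@ideal_neq0 _ _ _ _ (proj_primes B) y).
have g0 : g != 0 by exact: (@ideal_neq0 _ _ _ _ (proj_primes B) y).
have [b hb eb] := spanA (JE _ _ (BA Bh) Jh).
exists (fun j => b j * g ^+ eps j / h) => [j|].
  exists n, (b j * g ^+ eps j), h; split=> //; have := hb j.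
  case: ifP => [ej Bb|_ ->]; last by rewrite mul0r; exact: comp_zero.
  by rewrite -(subnK ej); apply: comp_mul => //; exact: comp_exp1.
apply: (mulfI h0); rewrite eb mulr_sumr; apply: eq_bigr => j _.
by field; rewrite ?expf_neq0 ?h0 ?g0.
Qed.

Let W : opens (Proj B) := D_opens (proj_primes B) Bg.

Let pre_ndvd j (x : Proj A) : oset (mpreim quot_map W) x ->
  ~ ideal (x : pts (proj_primes A)) (g ^+ eps j).
Proof. by move=> nx; apply: pt_expN (BA Bg) _ => xg; exact: nx ((quot_pointE x Bg).2 xg). Qed.

Definition local_basis j : sect (Proj A) (mpreim quot_map W) :=
  ZSect (is_section_cst (P := proj_primes A) (Ae j)
    (comp_exp1 (BA Bg) (eps j)) (@pre_ndvd j)).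

Let Phi (W' : opens (Proj B)) (h : oset W' `<=` oset W)
    (c : {ffun 'I_N -> sect (Proj B) W'}) : sect (Proj A) (mpreim quot_map W') :=
  \sum_(i < N) pull quot_map W' (c i) *
    res (Proj A) (preim_subset (cf := @mor_cont _ _ _ quot_map) h) (local_basis i).

Let PhiE W' h c (x : {x | oset (mpreim quot_map W') x}) :
  (@Phi W' h c : zsect _) x = \sum_(j < N)
    (c j : zsect W') (exist (oset W') (quot_point (sval x)) (svalP x)) *
    (e j / g ^+ eps j).
Proof. by rewrite /Phi zval_sum. Qed.

(** Since all sections are constant functions, a section over the preimage of W'
    is a single element s of K, and the coefficients given by descend at the
    various points of W' agree by the independence of the e_j. *)
Lemma local_basis_bij (W' : opens (Proj B)) (h : oset W' `<=` oset W) :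
  bijective (@Phi W' h).
Proof.
have g0 q : oset W' q -> g != 0.
  by move=> /h; exact: (@ideal_neq0 _ _ _ _ (proj_primes B)).
have inj_Phi : injective (@Phi W' h).
  move=> c c' ecc; apply/ffunP => j; apply: zsect_eq => q.
  have [x xq] := quot_surj (sval q).
  have Wx : oset (mpreim quot_map W') x by move: (svalP q); rewrite -xq.
  have := congr1 (fun s : @zsect _ _ _ _ (proj_primes A) (mpreim quot_map W') =>
    s (exist _ x Wx)) ecc.
  rewrite !PhiE; set q' := exist _ _ _; have -> : q' = q by exact: sig_eq.
  move/eqP; rewrite -subr_eq0 -sumrB => /eqP e0.
  apply/eqP; rewrite -subr_eq0; apply/eqP.
  apply: (@local_free (fun j => (c j : zsect W') q - (c' j : zsect W') q)).
  - exact: g0 (svalP q).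
  - by move=> i d; rewrite sigmaB !zsect_fix.
  - by rewrite -[RHS]e0; apply: eq_bigr => i _; rewrite mulrBl.
suff /choice [Psi hPsi] : forall s, exists c, @Phi W' h c = s.
  by exists Psi => // c; apply: inj_Phi; rewrite hPsi.
move=> s; have [[q0 Wq0]|nW] := pselect (exists q, oset W' q); last first.
  by exists [ffun=> 0]; apply: zsect_eq => x; case: nW; exists (quot_point (sval x)); exact: (svalP x).
have loc q : oset W' q -> exists2 b : 'I_N -> K,
    (forall j, exists n a f, [/\ B n a, B n f, ~ pt_set (q : projPoint B) f & b j = a / f]) &
    forall x, (s : zsect _) x = \sum_(j < N) b j * (e j / g ^+ eps j).
  move=> Wq; have [x0 xq0] := quot_surj q.
  have Wx0 : oset (mpreim quot_map W') x0 by move: Wq; rewrite -xq0.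
  have [x xq|b hb eb] := @descend q ((s : zsect _) (exist _ x0 Wx0)) (h _ Wq).
    have Wx : oset (mpreim quot_map W') x by move: Wq; rewrite -xq.
    have [W1 [W1x [n [a [f [Aa Af hf]]]]]] := zvalP s (exist _ x Wx).
    have [nf ef] := hf _ W1x; exists n, a, f; split=> //.
    by rewrite -ef; exact: zsect_const.
  by exists b => // x; rewrite -eb; exact: zsect_const.
have [b hb eb] := loc _ Wq0.
have [x0 xq0] := quot_surj q0.
have Wx0 : oset (mpreim quot_map W') x0 by move: Wq0; rewrite -xq0.
have fb (q : projPoint B) (b' : 'I_N -> K) j c :
    (forall j, exists n a f, [/\ B n a, B n f, ~ pt_set q f & b' j = a / f]) ->
    sigma c (b' j) = b' j.
  by move=> /(_ j) [n [a [f [Ba Bf _ ->]]]]; exact: frac_fix Ba Bf.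
have secb j : is_section (P := proj_primes B) (fun _ : {q | oset W' q} => b j).
  move=> q; have [b' hb' eb'] := loc _ (svalP q).
  have ebb : b j = b' j.
    apply/eqP; rewrite -subr_eq0; apply/eqP.
    apply: (@local_free (fun j => b j - b' j)); first exact: g0 Wq0.
      by move=> i c; rewrite sigmaB (fb q0) // (fb (sval q)).
    under eq_bigr do rewrite mulrBl.
    by rewrite sumrB -(eb (exist _ x0 Wx0)) -(eb' (exist _ x0 Wx0)) subrr.
  have [n [a [f [Ba Bf nf ef]]]] := hb' j.
  exists (D_opens (proj_primes B) Bf); split=> //.
  by exists n, a, f; split=> // q'; split=> //; rewrite ebb.
exists [ffun j => ZSect (secb j) : sect (Proj B) W']; apply: zsect_eq => x.
by rewrite PhiE eb; apply: eq_bigr => j _; rewrite ffunE.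
Qed.

End LocalBasis.

Lemma quot_local_basis (y : Proj B) : exists W : opens (Proj B),
  [/\ oset W y, affine_open W, affine_open (mpreim quot_map W) &
    exists f : 'I_N -> sect (Proj A) (mpreim quot_map W),
      forall (W' : opens (Proj B)) (h : oset W' `<=` oset W),
        bijective (fun c : {ffun 'I_N -> sect (Proj B) W'} =>
          \sum_(i < N) pull quot_map W' (c i) *
            res (Proj A) (preim_subset (cf := @mor_cont _ _ _ quot_map) h) (f i))].
Proof.
have [g Bg ng] := genB y.
have g0 : g != 0 by exact: (@ideal_neq0 _ _ _ _ (proj_primes B) y).
exists (D_opens (proj_primes B) Bg); split=> //.
- exact: (basic_affine Bg g0).
- apply: (basic_affine (BA Bg) g0); apply/seteqP; split=> x /= nx xg; apply: nx.
    exact: (quot_pointE x Bg).2 xg.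
  by case: xg.
- by exists (local_basis Bg) => W' h; exact: local_basis_bij.
Qed.

Lemma quot_degree : has_degree quot_map N.
Proof.
by move=> y; have [W [Wy _ _ hW]] := quot_local_basis y; exists W; split.
Qed.

Lemma quot_finite : finite_morphism quot_map.
Proof.
move=> y; have [W [Wy aW aW' [f hf]]] := quot_local_basis y; exists W; split=> //.
exists N, f => s; have [Psi _ hPsi] := hf W (fun _ h => h).
exists (Psi s); rewrite -{1}(hPsi s); apply: eq_bigr => i _; congr (_ * _).
exact: zs_res_id.
Qed.

Lemma quot_stalk_val (x : Proj A) (a : stalk (quot_map x)) :
  stalk_val (stalk_map a) = stalk_val a.
Proof.
have [W [hp [s ->]]] := germP a; rewrite stalk_map_germ !stalk_val_germ /=.
by congr (zval s _); exact: sig_eq.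
Qed.

(** As subrings of K, the stalk at x is the localization, at the elements of A
    outside of x, of the ring of fractions with numerator in A and denominator
    in B outside of y, and this ring is free over the stalk at y. *)
Lemma quot_flat : flat quot_map.
Proof.
move=> x; pose y := quot_point x; have [g Bg ng] := genB y.
have ng' : ~ pt_set x g by move=> xg; apply: ng; apply/(quot_pointE x Bg).
have g0 : g != 0 by exact: (@ideal_neq0 _ _ _ _ (proj_primes B) y).
have gX n : g ^+ n != 0 by rewrite expf_neq0.
have BgX n : B n (g ^+ n) by exact: comp_exp1.
have /choice [f hf] : forall j, exists f : stalk x, stalk_val f = e j / g ^+ eps j.
  move=> j; apply: (frac_stalk_val (P := proj_primes A) (Ae j) (BA (BgX _))).
  exact: pt_expN (BA Bg) ng'.
have valE (c : 'I_N -> stalk (quot_map x)) :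
    stalk_val (\sum_(i < N) stalk_map (c i) * f i) =
    \sum_(j < N) stalk_val (c j) * (e j / g ^+ eps j).
  rewrite stalk_val_sum; apply: eq_bigr => j _.
  by rewrite stalk_valM hf quot_stalk_val.
have fixv (a : stalk (quot_map x)) d : sigma d (stalk_val a) = stalk_val a.
  by have [n [b [h [Bb Bh _ ->]]]] := stalk_val_frac a; exact: frac_fix Bb Bh.
have MP (z : stalk x) :
    (exists c : 'I_N -> stalk (quot_map x), z = \sum_(i < N) stalk_map (c i) * f i)
    <-> (exists n a h, [/\ A n a, B n h, ~ pt_set y h & stalk_val z = a / h]).
  split=> [[c ->]|[n [a [h [Aa Bh nh ez]]]]]; last first.
    have h0 : h != 0 by exact: (@ideal_neq0 _ _ _ _ (proj_primes B) y).
    have [b hb eb] := spanA Aa.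
    have /choice [c hc] : forall j, exists c : stalk (quot_map x),
        stalk_val c = b j * g ^+ eps j / h.
      move=> j; apply: (frac_stalk_val (P := proj_primes B) (n := n)) => //.
      have := hb j; case: ifP => [ej Bb|_ ->]; last by rewrite mul0r; exact: comp_zero.
      by rewrite -(subnK ej); exact: comp_mul.
    exists c; apply: stalk_val_inj; rewrite valE ez eb mulr_suml.
    by apply: eq_bigr => j _; rewrite hc; field; rewrite ?gX ?h0.
  rewrite valE; apply: (big_ind (fun v => exists n a h,
    [/\ A n a, B n h, ~ pt_set y h & v = a / h])).
  - exists 0%N, 0, 1; rewrite mul0r; split=> //; first exact: comp_zero.
    exact: (@pt_one _ _ _ _ y).
  - move=> _ _ [n [a [h [Aa Bh nh ->]]]] [m [a' [h' [Aa' Bh' nh' ->]]]].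
    exists (n + m)%N, (a * h' + a' * h), (h * h'); split.
    + apply: comp_add; first by apply: comp_mul => //; exact: BA.
      by rewrite addnC; apply: comp_mul => //; exact: BA.
    + exact: comp_mul.
    + by move/(pt_prime (comp_total Bh) (comp_total Bh')) => [].
    + by rewrite addf_div //; exact: (@ideal_neq0 _ _ _ _ (proj_primes B) y).
  - move=> j _; have [n [b [h [Bb Bh nh ->]]]] := stalk_val_frac (c j).
    exists (n + eps j)%N, (b * e j), (h * g ^+ eps j); split.
    + by apply: comp_mul => //; exact: BA.
    + exact: comp_mul.
    + move/(pt_prime (comp_total Bh) (comp_total (BgX _))) => [//|].
      exact: pt_expN Bg ng.
    + by rewrite mulf_div.
pose T : set (stalk x) := [set t | exists n a,
  [/\ A n a, ~ pt_set x a & stalk_val t = a / g ^+ n]].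
apply: (@flat_localization _ _ (@stalk_map _ _ _ quot_map x) _ _ N f T).
- by move=> a b; apply: stalk_val_inj; rewrite stalk_valB !quot_stalk_val stalk_valB.
- by move=> a b; apply: stalk_val_inj; rewrite stalk_valM !quot_stalk_val stalk_valM.
- move=> c /(congr1 (@stalk_val _ _ _ _ _ x)); rewrite valE stalk_val0 => e0 j.
  apply: stalk_val_inj; rewrite stalk_val0; move: j; apply: (local_free Bg g0) => //.
- exists 0%N, 1; rewrite expr0 divr1 stalk_val1; split=> //; first exact: comp_one.
  exact: pt_one.
- move=> a b [n [u [Au nu eu]]] [m [v [Av nv ev]]]; exists (n + m)%N, (u * v).
  rewrite stalk_valM eu ev mulf_div exprD; split=> //; first exact: comp_mul.
  by move/(pt_prime (comp_total Au) (comp_total Av)) => [].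
- move=> t [n [u [Au nu eu]]].
  have u0 : u != 0 by exact: (@ideal_neq0 _ _ _ _ (proj_primes A) x).
  have [t' et'] := frac_stalk_val (P := proj_primes A) (p := x) (BA (BgX n)) Au nu.
  exists t'; apply: stalk_val_inj; rewrite stalk_valM eu et' stalk_val1.
  by field; rewrite gX u0.
- move=> t m [n [u [Au nu eu]]] /MP[l [a [h [Aa Bh nh em]]]]; apply/MP.
  exists (n + l)%N, (u * a), (g ^+ n * h); split; try exact: comp_mul.
    move/(pt_prime (comp_total (BgX n)) (comp_total Bh)) => [|//].
    exact: pt_expN Bg ng.
  by rewrite stalk_valM eu em mulf_div.
- move=> b; have [n [a [h [Aa Ah nh eb]]]] := stalk_val_frac b.
  have h0 : h != 0 by exact: (@ideal_neq0 _ _ _ _ (proj_primes A) x).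
  have [t et] := frac_stalk_val (P := proj_primes A) (p := x) Ah (BA (BgX n))
    (pt_expN (n := n) (BA Bg) ng').
  exists t; first by exists n, h.
  apply/MP; exists n, a, (g ^+ n); split=> //; first exact: pt_expN Bg ng.
  by rewrite stalk_valM et eb; field; rewrite gX h0.
Qed.

End Quotient.

(** * Polynomial subalgebras *)

Section FracLift.
Context (R : idomainType) (K : fieldType) (psi : {rmorphism R -> K}).
Hypothesis psi_inj : injective psi.

(** The injectivity of psi is made an argument so that the homomorphism
    structures below can be attached to frac_lift. *)
Definition frac_lift : {fraction R} -> K :=
  let _ := psi_inj in fun x => psi \n_(repr x) / psi \d_(repr x).

Let psi_neq0 a : a != 0 -> psi a != 0.
Proof. by rewrite -(inj_eq psi_inj) rmorph0. Qed.

Lemma frac_liftE a b : b != 0 ->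
  frac_lift (FracField.tofrac a / FracField.tofrac b) = psi a / psi b.
Proof.
move=> b0; set x := _ / _; rewrite /frac_lift /=.
have db0 : \d_(repr x) != 0 by exact: denom_ratioP.
have e : FracField.tofrac (a * \d_(repr x)) =
    FracField.tofrac (\n_(repr x) * b) :> {fraction R}.
  rewrite !rmorphM /=; apply/eqP; rewrite -eqr_div ?tofrac_eq0 //.
  by rewrite -(fracE x).
apply/eqP; rewrite eqr_div ?psi_neq0 // -!rmorphM.
by move/eqP: e; rewrite tofrac_eq => /eqP ->.
Qed.

Lemma frac_lift_tofrac a : frac_lift (FracField.tofrac a) = psi a.
Proof. by have := frac_liftE a (oner_neq0 R); rewrite !rmorph1 !divr1. Qed.

Lemma frac_liftB : zmod_morphism frac_lift.
Proof.
move=> x y; have [a [b [b0 ->]]] := fracP x; have [c [e [e0 ->]]] := fracP y.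
rewrite -mulNr -rmorphN addf_div ?tofrac_eq0 // -!rmorphM -rmorphD.
rewrite !frac_liftE ?mulf_neq0 // -mulNr -rmorphN.
by rewrite addf_div ?psi_neq0 // rmorphD !rmorphM !rmorphN.
Qed.

Lemma frac_liftM : monoid_morphism frac_lift.
Proof.
split=> [|x y]; first by rewrite -(rmorph1 (@FracField.tofrac R)) frac_lift_tofrac rmorph1.
have [a [b [b0 ->]]] := fracP x; have [c [e [e0 ->]]] := fracP y.
rewrite mulf_div -!rmorphM !frac_liftE ?mulf_neq0 // mulf_div.
by rewrite -!rmorphM.
Qed.

HB.instance Definition _ :=
  GRing.isZmodMorphism.Build {fraction R} K frac_lift frac_liftB.
HB.instance Definition _ :=
  GRing.isMonoidMorphism.Build {fraction R} K frac_lift frac_liftM.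

End FracLift.

Arguments frac_lift {R K psi} psi_inj x.

Section PolynomialAlgebra.
Context {F K : fieldType} {inj : {rmorphism F -> K}} (r : nat).
Variables (b : 'I_r -> K) (d : 'I_r -> nat).

Definition peval : {mpoly F[r]} -> K := mmap inj b.

HB.instance Definition _ := GRing.RMorphism.on peval.

Lemma peval_const c : peval c%:MP = inj c. Proof. exact: mmapC. Qed.

Lemma peval_var i : peval 'X_i = b i.
Proof. by rewrite /peval mmapX mmap1U. Qed.

Lemma peval_mon (m : 'X_{1..r}) : peval 'X_[m] = \prod_(i < r) b i ^+ m i.
Proof. by rewrite /peval mmapX. Qed.

Lemma pevalZ c p : peval (c *: p) = inj c * peval p.
Proof. exact: mmapZ. Qed.

Lemma peval_homog (A : mulFamily inj) n p : (forall i, A (d i) (b i)) ->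
  p \is ishomog1 n (wdeg d) -> A n (peval p).
Proof.
move=> Ab /dhomogP hp; rewrite [p]mpolyE rmorph_sum big_seq_cond.
apply: (big_ind (A n)) => [|x y|m /andP[mp _]]; first exact: comp_zero.
  exact: comp_add.
rewrite /= pevalZ -[n]add0n; apply: comp_mul; first exact: comp_scal.
rewrite -(hp _ mp) peval_mon /= /wdeg.
apply: (big_rec2 (fun e x => A e x)); first exact: comp_one.
by move=> i e x _ Ax; apply: comp_mul => //; rewrite mulnC; exact: comp_exp.
Qed.

Lemma poly_proj_isomorphic (A : gradedAlgebra inj) : injective peval ->
  (forall i, A (d i) (b i)) ->
  (forall n x, A n x -> exists2 p, p \is ishomog1 n (wdeg d) & x = peval p) ->
  isomorphic (Proj A) (weighted_proj_space F d).
Proof.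
move=> b_inj Ab Ap.
pose phi : {rmorphism polyFrac F r -> K} := frac_lift b_inj.
apply: (@proj_isomorphic _ _ _ _ _ (wpoly F d) A phi).
- by move=> c; rewrite /= frac_lift_tofrac; exact: peval_const.
- by move=> n _ [p hp ->] /=; rewrite frac_lift_tofrac; exact: peval_homog.
- move=> n x /Ap[p hp ->]; exists (FracField.tofrac p); first by exists p.
  by rewrite /= frac_lift_tofrac.
Qed.

End PolynomialAlgebra.

(** * Rings spanned by finitely many elements over a subring *)

Section Spanning.
Context {F K : fieldType} (inj : {rmorphism F -> K}).

Definition subring (C : set K) : Prop :=
  [/\ forall c, C (inj c), forall x y, C x -> C y -> C (x - y) &
      forall x y, C x -> C y -> C (x * y)].

Section Subring.
Variables (C : set K) (hC : subring C).

Lemma subring0 : C 0. Proof. by rewrite -(rmorph0 inj); case: hC. Qed.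
Lemma subring1 : C 1. Proof. by rewrite -(rmorph1 inj); case: hC. Qed.
Lemma subringN x : C x -> C (- x).
Proof. by have [_ hB _] := hC; rewrite -sub0r; apply: hB; exact: subring0. Qed.
Lemma subringD x y : C x -> C y -> C (x + y).
Proof.
by have [_ hB _] := hC; rewrite -{2}[y]opprK => Cx Cy; apply/hB/subringN.
Qed.
Lemma subringM x y : C x -> C y -> C (x * y). Proof. by case: hC => _ _; exact. Qed.
Lemma subringX x n : C x -> C (x ^+ n).
Proof.
move=> Cx; elim: n => [|n IH]; first by rewrite expr0; exact: subring1.
by rewrite exprS; exact: subringM.
Qed.
Lemma subring_sum (I : Type) (s : seq I) (P : pred I) (f : I -> K) :
  (forall i, P i -> C (f i)) -> C (\sum_(i <- s | P i) f i).
Proof.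
by move=> h; apply: big_ind => //; [exact: subring0|move=> x y; exact: subringD].
Qed.
Lemma subring_prod (I : Type) (s : seq I) (P : pred I) (f : I -> K) :
  (forall i, P i -> C (f i)) -> C (\prod_(i <- s | P i) f i).
Proof.
by move=> h; apply: big_ind => //; [exact: subring1|move=> x y; exact: subringM].
Qed.
End Subring.

Definition gen (X : set K) : set K :=
  [set z | forall C, subring C -> X `<=` C -> C z].

Lemma gen_subring X : subring (gen X).
Proof.
split=> [c C [? _ _] _ //|x y hx hy C hC XC|x y hx hy C hC XC].
  by have [_ hB _] := hC; apply: hB; [exact: hx|exact: hy].
by apply: subringM => //; [exact: hx|exact: hy].
Qed.

Lemma sub_gen X : X `<=` gen X. Proof. by move=> x Xx C _; exact. Qed.

Lemma gen_min X C : subring C -> X `<=` C -> gen X `<=` C.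
Proof. by move=> hC XC x; exact. Qed.

Definition coefs_in (C : set K) (p : {poly K}) : Prop := forall i, C p`_i.

Lemma monic_division C (p q : {poly K}) : subring C -> p \is monic ->
  coefs_in C p -> coefs_in C q -> exists u v,
  [/\ q = u * p + v, coefs_in C u, coefs_in C v & (size v < size p)%N].
Proof.
move=> hC pm Cp; have p0 : (0 < size p)%N by rewrite size_poly_gt0 monic_neq0.
have [n] := ubnP (size q); elim: n q => // n IH q; rewrite ltnS => qn Cq.
have [qp|pq] := ltnP (size q) (size p).
  by exists 0, q; split; rewrite ?mul0r ?add0r // => i; rewrite coef0; exact: subring0 hC.
pose k := (size q - size p)%N; pose c := lead_coef q.
pose t := c *: 'X^k; pose q' := q - t * p.
have q0 : (0 < size q)%N by exact: leq_trans p0 pq.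
have tpE i : (t * p)`_i = if (i < k)%N then 0 else c * p`_(i - k).
  by rewrite -scalerAl coefZ coefXnM; case: ifP; rewrite ?mulr0.
have Ct : coefs_in C t.
  move=> i; rewrite coefZ coefXn; apply: (subringM hC); first exact: Cq.
  by case: eqP => _; [exact: subring1 hC|exact: subring0 hC].
have Cq' : coefs_in C q'.
  have [_ hB _] := hC => i; rewrite coefB tpE; apply: hB => //.
  by case: ifP => _; [exact: subring0 hC|exact: (subringM hC (Cq _) (Cp _))].
have sq' : (size q' < size q)%N.
  rewrite -(ltn_predK q0) ltnS; apply/leq_sizeP => j hj; rewrite coefB tpE.
  have kj : (k <= j)%N.
    by apply: leq_trans hj; rewrite /k -subn1; apply: leq_sub2l.
  rewrite ltnNge kj /=; move: hj; rewrite leq_eqVlt => /orP[/eqP <-|hj].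
    have -> : ((size q).-1 - k = (size p).-1)%N by rewrite /k -subn1; lia.
    by rewrite -![_`_(_).-1]/(lead_coef _) (monicP pm) mulr1 subrr.
  have h1 : (size q <= j)%N by rewrite -(ltn_predK q0).
  have h2 : (size p <= j - k)%N by rewrite /k; lia.
  by rewrite [q`__]nth_default // [p`__]nth_default // mulr0 subrr.
have [u [v [eq' Cu Cv sv]]] := IH q' (leq_trans sq' qn) Cq'.
exists (u + t), v; split=> //; last by move=> i; rewrite coefD; exact: (subringD hC).
by rewrite mulrDl addrAC -eq' /q' subrK.
Qed.

Variable A : mulFamily inj.

(** N bounds the rank of X over C from above.  Degrees are recorded so that the
    coefficients can later be made homogeneous, and 1 is one of the spanning
    elements so that the elements of C have an evident expansion. *)
Definition spans (C : set K) (N : nat) (X : set K) : Prop :=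
  exists (I : finType) (e : I -> K) (eps : I -> nat) (i0 : I),
  [/\ #|I| = N, e i0 = 1 /\ eps i0 = 0%N, forall i, A (eps i) (e i) &
    forall x, X x -> exists2 c : I -> K, forall i, C (c i) & x = \sum_i c i * e i].

Lemma spans_refl C : spans C 1 C.
Proof.
exists unit, (fun _ => 1), (fun _ => 0%N), tt; split=> //; rewrite ?card_unit //.
  by move=> _; exact: comp_one.
move=> x Cx; exists (fun _ => x) => //.
by rewrite (bigD1 tt) //= big1 ?addr0 ?mulr1 // => -[].
Qed.

Lemma spans_trans C D N M X : spans C N D -> spans D M X -> spans C (N * M) X.
Proof.
move=> [I [e [eps [i0 [<- [e0 eps0] Ae hD]]]]] [J [f [eta [j0 [<- [f0 eta0] Af hX]]]]].
exists (I * J)%type, (fun ij => e ij.1 * f ij.2), (fun ij => (eps ij.1 + eta ij.2)%N),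
  (i0, j0).
rewrite card_prod /= e0 f0 mulr1 eps0 eta0; split=> // [ij|x /hX[c hc ->]].
  exact: comp_mul.
have /choice [d hd] : forall j, exists d : I -> K,
    (forall i, C (d i)) /\ c j = \sum_i d i * e i.
  by move=> j; have [d ? ?] := hD _ (hc j); exists d.
exists (fun ij => d ij.2 ij.1) => [ij|]; first by have [] := hd ij.2.
rewrite -(pair_bigA _ (fun i j => d j i * (e i * f j))) exchange_big /=.
apply: eq_bigr => j _; have [_ ->] := hd j; rewrite mulr_suml.
by apply: eq_bigr => i _; rewrite mulrA.
Qed.

Lemma spans_subset C N X Y : Y `<=` X -> spans C N X -> spans C N Y.
Proof.
move=> YX [I [e [eps [i0 [? ? ? h]]]]]; exists I, e, eps, i0; split=> // x /YX.
exact: h.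
Qed.

(** Reduce polynomials in z modulo p. *)
Lemma spans_monic C (p : {poly K}) n z dz : subring C -> p \is monic ->
  coefs_in C p -> size p = n.+1 -> root p z -> A dz z ->
  spans C n (gen (C `|` [set z])).
Proof.
move=> hC pm Cp sp rz Az.
case: n sp => [|n] sp.
  (* A constant polynomial has no root. *)
  have [c c0 ep] : exists2 c, c != 0 & p = c%:P by apply/size_poly1P; rewrite sp.
  by move: rz; rewrite ep rootC (negPf c0).
exists 'I_n.+1, (fun i : 'I_n.+1 => z ^+ i), (fun i : 'I_n.+1 => dz * i)%N, ord0.
rewrite card_ord expr0 muln0; split=> // [i|x hx]; first exact: comp_exp.
suff [q Cq ->] : exists2 q, coefs_in C q & x = q.[z].
  have [u [v [-> _ Cv sv]]] := monic_division hC pm Cp Cq.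
  exists (fun i : 'I_n.+1 => v`_i) => //; rewrite hornerD hornerM (rootP rz) mulr0 add0r.
  rewrite (@horner_coef_wide _ n.+1) //; by rewrite -ltnS -sp.
apply: (gen_min (C := [set x | exists2 q, coefs_in C q & x = q.[z]])) hx.
  split=> [c|_ _ [p1 C1 ->] [p2 C2 ->]|_ _ [p1 C1 ->] [p2 C2 ->]].
  - exists (inj c)%:P; rewrite ?hornerC // => i; rewrite coefC.
    by case: eqP => _; [case: hC|exact: subring0 hC].
  - exists (p1 - p2); rewrite ?hornerD ?hornerN // => i; rewrite coefB.
    by case: hC => _ hB _; exact: hB.
  - exists (p1 * p2); rewrite ?hornerM // => i; rewrite coefM.
    by apply: (subring_sum hC) => // j _; exact: (subringM hC).
move=> y [Cy|->].
  exists y%:P; rewrite ?hornerC // => i; rewrite coefC.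
  by case: eqP => _ //; exact: subring0 hC.
exists 'X; rewrite ?hornerX // => i; rewrite coefX.
by case: eqP => _; [exact: subring1 hC|exact: subring0 hC].
Qed.

(** If C contains the sum g of the reciprocals of the z + w, w in W, and the
    reciprocals of the differences of the w, then products of the 1 / (z + w)
    are linear combinations of them: partial fractions handle w <> w', and the
    square of 1 / (z + w) appears when it is multiplied by g. *)
Lemma spans_recip C z w0 (W : seq K) : subring C -> uniq (w0 :: W) ->
  (forall w w', w \in w0 :: W -> w' \in w0 :: W -> w != w' -> C (w - w')^-1) ->
  (forall w, w \in w0 :: W -> z + w != 0) ->
  C (\sum_(w <- w0 :: W) (z + w)^-1) ->
  (forall w, w \in W -> A 1%N (z + w)^-1) ->
  spans C (size (w0 :: W)) (gen (C `|` [set (z + w)^-1 | w in [set` w0 :: W]])).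
Proof.
move=> hC uW hW z0 Cg AW; set W0 := w0 :: W in uW hW z0 Cg *.
(* 1 takes the place of 1 / (z + w0), which the sum g makes redundant. *)
pose e (i : 'I_(size W0)) := if i == 0%N :> nat then 1 else (z + W0`_i)^-1.
exists 'I_(size W0), e, (fun i : 'I_(size W0) => (i != 0%N :> nat) : nat), ord0.
rewrite card_ord; split=> // [i|x hx].
  rewrite /e; case: (val i) (ltn_ord i) => [_|j jW] /=; first exact: comp_one.
  by apply: AW; exact: mem_nth.
pose M := [set x | exists2 c : 'I_(size W0) -> K, forall i, C (c i) &
  x = \sum_i c i * e i].
suff : M x by [].
have MB y y' : M y -> M y' -> M (y - y').
  move=> [c Cc ->] [c' Cc' ->]; exists (fun i => c i - c' i).
    by move=> i; case: hC => _ hB _; exact: hB.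
  by rewrite -sumrB; apply: eq_bigr => i _; rewrite mulrBl.
have MZ a y : C a -> M y -> M (a * y).
  move=> Ca [c Cc ->]; exists (fun i => a * c i) => [i|]; first exact: (subringM hC).
  by rewrite mulr_sumr; apply: eq_bigr => i _; rewrite mulrA.
have Me i : M (e i).
  exists (fun j => (j == i)%:R) => [j|].
    by case: eqP => _; [exact: subring1 hC|exact: subring0 hC].
  rewrite (bigD1 i) //= eqxx mul1r big1 ?addr0 // => j /negPf ->.
  by rewrite mul0r.
have M1 : M 1 by have := Me ord0.
have MC a : C a -> M a by move=> Ca; rewrite -[a]mulr1; exact: MZ.
have MD y y' : M y -> M y' -> M (y + y').
  move=> My My'; rewrite -[y']opprK -[- y']sub0r; do 2?[apply: (MB) => //].
  by apply: MC; exact: subring0 hC.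
have Msum (s : seq K) (P : pred K) (f : K -> K) :
    (forall w, w \in s -> P w -> M (f w)) -> M (\sum_(w <- s | P w) f w).
  move=> h; rewrite big_seq_cond; apply: (big_ind M) => //.
    by apply: MC; exact: subring0 hC.
  by move=> w /andP[]; exact: h.
have MuW w : w \in W -> M (z + w)^-1.
  move=> wW; have hi : (index w W < size W)%N by rewrite index_mem.
  by have := Me (lift ord0 (Ordinal hi)); rewrite /e /= nth_index.
have Mu w : w \in W0 -> M (z + w)^-1.
  rewrite inE => /orP[/eqP ->|]; last exact: MuW.
  have -> : (z + w0)^-1 = \sum_(w <- W0) (z + w)^-1 - \sum_(w <- W) (z + w)^-1.
    by rewrite big_cons addrK.
  by apply: MB; [exact: MC|apply: Msum => w' w'W _; exact: MuW].
have Muu w w' : w \in W0 -> w' \in W0 -> w != w' -> M ((z + w)^-1 * (z + w')^-1).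
  move=> wW wW' nw; have -> : (z + w)^-1 * (z + w')^-1 =
      (w' - w)^-1 * ((z + w)^-1 - (z + w')^-1).
    have d0 : w' - w != 0 by rewrite subr_eq0 eq_sym.
    by field; rewrite d0 !z0.
  apply: MZ; first by apply: hW => //; rewrite eq_sym.
  by apply: MB; exact: Mu.
have Mu2 w : w \in W0 -> M ((z + w)^-1 * (z + w)^-1).
  move=> wW; have -> : (z + w)^-1 * (z + w)^-1 =
      (\sum_(w <- W0) (z + w)^-1) * (z + w)^-1 -
      \sum_(w' <- W0 | w' != w) (z + w')^-1 * (z + w)^-1.
    by rewrite (bigD1_seq w) //= mulrDl -mulr_suml addrK.
  by apply: MB; [apply: MZ => //; exact: Mu|apply: Msum => w' w'W nw; exact: Muu].
have Mee i j : M (e i * e j).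
  have [i0|i0] := eqVneq (i : nat) 0%N; first by rewrite {1}/e i0 eqxx mul1r.
  have [j0|j0] := eqVneq (j : nat) 0%N; first by rewrite {2}/e j0 eqxx mulr1.
  rewrite /e (negPf i0) (negPf j0).
  have [->|nij] := eqVneq W0`_i W0`_j; first by apply: Mu2; exact: mem_nth.
  by apply: Muu => //; exact: mem_nth.
have MM y y' : M y -> M y' -> M (y * y').
  move=> [c Cc ->] [c' Cc' ->]; rewrite mulr_suml.
  apply: (big_ind M) => //; first by apply: MC; exact: subring0 hC.
  move=> i _; rewrite mulr_sumr; apply: (big_ind M) => //.
    by apply: MC; exact: subring0 hC.
  by move=> j _; rewrite mulrACA; apply: MZ => //; exact: (subringM hC).
apply: gen_min hx; first by split=> // c; apply: MC; case: hC.
by move=> y [Cy|[w wW <-]]; [exact: MC|exact: Mu].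
Qed.

End Spanning.

(** * Recognizing a ring of invariants *)

(** Dedekind's independence of characters.  In a shortest relation with c_j <> 0
    and c_i <> 0, choose y with sigma_i y <> sigma_j y; replacing x by y x and
    subtracting sigma_j y times the relation gives a shorter one in which the
    coefficient of sigma_i is not 0. *)
Lemma dedekind (K : fieldType) (J : finType) (X : set K) (sigma : J -> K -> K) :
  X 1 -> (forall x y, X x -> X y -> X (x * y)) ->
  (forall j, sigma j 1 = 1) ->
  (forall j x y, sigma j (x * y) = sigma j x * sigma j y) ->
  (forall i j, i != j -> exists2 x, X x & sigma i x != sigma j x) ->
  forall c : J -> K, (forall x, X x -> \sum_j c j * sigma j x = 0) ->
  forall j, c j = 0.
Proof.
move=> X1 XM s1 sM dist c; have [n] := ubnP #|[pred j | c j != 0]|.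
elim: n c => // n IH c; rewrite ltnS => cn hc j; apply/eqP.
apply: contraT => cj.
have [i /andP[ij ci]|noi] := pickP [pred i | (i != j) && (c i != 0)].
  have [y Xy yij] := dist _ _ ij.
  pose d i := c i * (sigma i y - sigma j y).
  have : d i = 0.
    apply: IH => [|x Xx].
      apply: leq_trans cn; apply: proper_card; apply/properP; split.
        apply/fintype.subsetP => l; rewrite !inE /d; apply: contraNneq => ->.
        by rewrite mul0r.
      by exists j; rewrite !inE // /d subrr mulr0 eqxx.
    transitivity (\sum_i c i * sigma i (y * x) - sigma j y * \sum_i c i * sigma i x).
      rewrite mulr_sumr -sumrB; apply: eq_bigr => l _; rewrite /d sM; ring.
    by rewrite !hc ?mulr0 ?subr0 //; exact: XM.
  by move/eqP; rewrite mulf_eq0 (negPf ci) /= subr_eq0 (negPf yij).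
have := hc 1 X1; rewrite (bigD1 j) //= s1 mulr1 big1 ?addr0 => [e|i ij].
  by rewrite e eqxx in cj.
by have := noi i; rewrite /= ij /= => /negbFE/eqP ->; rewrite mul0r.
Qed.

(** As many automorphisms as spanning elements force the latter to be
    independent over the fixed field: by Dedekind's theorem the square matrix
    of the sigma_j (e_i) is invertible. *)
Lemma spanning_free (K : fieldType) (N : nat) (X C : set K)
    (sigma : 'I_N -> K -> K) (e : 'I_N -> K) :
  X 1 -> (forall x y, X x -> X y -> X (x * y)) ->
  (forall j, sigma j 1 = 1) -> (forall j, zmod_morphism (sigma j)) ->
  (forall j x y, sigma j (x * y) = sigma j x * sigma j y) ->
  (forall i j, i != j -> exists2 x, X x & sigma i x != sigma j x) ->
  (forall j c, C c -> sigma j c = c) ->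
  (forall x, X x -> exists2 c : 'I_N -> K, forall i, C (c i) & x = \sum_i c i * e i) ->
  forall b : 'I_N -> K, (forall i j, sigma j (b i) = b i) ->
  \sum_i b i * e i = 0 -> forall i, b i = 0.
Proof.
move=> X1 XM s1 sB sM dist Cfix span b bfix b0.
pose M := \matrix_(j < N, i < N) sigma j (e i).
have uM : M \in unitmx.
  rewrite -row_free_unit -kermx_eq0; apply/eqP/row_matrixP => l.
  rewrite row0; set v := row l _.
  have vM : v *m M = 0 by rewrite -row_mul mulmx_ker row0.
  apply/rowP => j; rewrite [RHS]mxE; move: j.
  apply: (@dedekind K 'I_N X sigma X1 XM s1 sM dist (fun j => v 0 j)) => x /span[c hc ->].
  transitivity (\sum_i c i * (v *m M) 0 i); last first.
    by rewrite big1 // => i _; rewrite vM mxE mulr0.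
  under eq_bigr => j _ do rewrite (zmod_morph_sum (sB j)) mulr_sumr.
  rewrite exchange_big; apply: eq_bigr => i _ /=; rewrite mxE mulr_sumr.
  by apply: eq_bigr => j _; rewrite sM Cfix // [M _ _]mxE mulrCA.
pose w := \col_i b i.
have Mw : M *m w = 0.
  apply/colP => j; rewrite !mxE.
  have := congr1 (sigma j) b0; rewrite (zmod_morph0 (sB j)) (zmod_morph_sum (sB j)) => {2}<-; apply: eq_bigr => i _.
  by rewrite !mxE sM bfix mulrC.
move=> i; have : w = 0 by rewrite -(mulKmx uM w) Mw mulmx0.
by move/colP/(_ i); rewrite !mxE.
Qed.

Lemma spans_ord (F K : fieldType) (inj : {rmorphism F -> K}) (A : mulFamily inj)
    C N X : spans A C N X ->
  exists (e : 'I_N -> K) (eps : 'I_N -> nat) (i0 : 'I_N),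
  [/\ e i0 = 1 /\ eps i0 = 0%N, forall i, A (eps i) (e i) &
    forall x, X x -> exists2 c : 'I_N -> K, forall i, C (c i) & x = \sum_i c i * e i].
Proof.
move=> [I [e [eps [i0 [<- e0 Ae hX]]]]].
exists (e \o enum_val), (eps \o enum_val), (enum_rank i0).
rewrite /= enum_rankK; split=> // x /hX[c hc ->].
exists (c \o enum_val) => [i|]; first exact: hc.
by rewrite [LHS](reindex _ (onW_bij _ (@enum_val_bij I))).
Qed.

(** The mean value bound for x ^ r - y ^ r, used to compare growth rates. *)
Lemma expn_diff r x y : (y <= x)%N ->
  (x ^ r <= y ^ r + r * (x - y) * x ^ r.-1)%N.
Proof.
move=> yx; elim: r => [|[|r] IH]; rewrite ?expn0 ?expn1 //=; first lia.
rewrite expnS (leq_trans (leq_mul (leqnn x) IH)) //= mulnDr.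
have h1 : (x * y ^ r.+1 <= y ^ r.+2 + (x - y) * x ^ r.+1)%N.
  rewrite -{1}(subnK yx) mulnDl addnC -expnS leq_add2l leq_mul2l.
  by rewrite leq_exp2r ?yx ?orbT.
apply: (leq_trans (leq_add h1 (leqnn _))).
rewrite mulnCA -expnS -addnA leq_add2l.
by rewrite -mulnDl leq_mul2r mulSn orbC leqnn.
Qed.

Section Recognition.
Context {F : finFieldType} {K : fieldType} {inj : {rmorphism F -> K}}.
Local Notation ev := (peval (inj := inj)).
Variables (A : gradedAlgebra inj) (r : nat) (b : 'I_r -> K) (d : 'I_r -> nat).
Hypotheses (Ab : forall i, A (d i) (b i)) (d_gt0 : forall i, (0 < d i)%N).
Let C : set K := range (ev b).
Variables (N : nat) (e : 'I_N -> K) (eps : 'I_N -> nat) (i0 : 'I_N).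
Hypotheses (e0 : e i0 = 1) (eps0 : eps i0 = 0%N) (Ae : forall i, A (eps i) (e i)).
Hypothesis spanA : forall n x, A n x ->
  exists2 c : 'I_N -> K, forall i, C (c i) & x = \sum_i c i * e i.

(** The coefficients of a homogeneous element can be taken homogeneous: keep
    only the components of the right degree. *)
Lemma graded_span n x : A n x -> exists2 p : 'I_N -> {mpoly F[r]},
  (forall i, if (eps i <= n)%N then p i \is ishomog1 (n - eps i) (wdeg d) : Prop
             else p i = 0) &
  x = \sum_i ev b (p i) * e i.
Proof.
move=> Ax; have [c hc ex] := spanA Ax.
have /choice [p hp] : forall i, exists p, ev b p = c i.
  by move=> i; have [p _ <-] := hc i; exists p.
pose T := (\sum_(i < N) (eps i + mmeasure (wdeg d) (p i)) + n.+1)%N.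
pose q t i := if (eps i <= t)%N then pihomog (wdeg d) (t - eps i)%N (p i) else 0.
pose a t := \sum_i ev b (q t i) * e i.
have Aa t : A t (a t).
  apply: comp_sum => i _; rewrite /q; case: leqP => h.
    rewrite -[t in A t](subnK h); apply: comp_mul => //.
    by apply: peval_homog => //; exact: pihomogP.
  by rewrite rmorph0 mul0r; exact: comp_zero.
have nT : (n < T)%N by rewrite /T addnS ltnS leq_addl.
have sa : \sum_(t < T) a t = x.
  rewrite exchange_big /= ex; apply: eq_bigr => i _; rewrite -mulr_suml -hp.
  congr (_ * _); have hT : (eps i + mmeasure (wdeg d) (p i) <= T)%N.
    by rewrite /T (bigD1 i) //= -addnA leq_addr.
  have eT : T = (eps i + (T - eps i))%N.
    by rewrite subnKC // (leq_trans _ hT) // leq_addr.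
  rewrite eT big_split_ord /= big1 ?add0r; last first.
    by move=> t _; rewrite /q leqNgt ltn_ord rmorph0.
  rewrite [in RHS](pihomog_partitionE (mf := wdeg d) (k := (T - eps i)%N) (p := p i)).
    rewrite rmorph_sum; apply: eq_bigr => t _.
    by rewrite /q leq_addr addKn.
  by rewrite leq_subRL // (leq_trans _ hT) // leq_addr.
pose c' t := if t == n then x else 0.
exists (q n) => [i|].
  by rewrite /q; case: leqP => // _; exact: pihomogP.
have -> : x = c' n by rewrite /c' eqxx.
apply/esym; apply: (@graded_sum_inj _ _ _ A T a c') => // [t|].
  by rewrite /c'; case: eqP => [->//|_]; exact: comp_zero.
rewrite sa (bigD1 (Ordinal nT)) //= /c' eqxx big1 ?addr0 // => t nt.
by case: eqP => // et; case/eqP: nt; exact: val_inj.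
Qed.

Section Growth.
Variable y : 'I_r -> K.
Hypotheses (Ay : forall i, A 1%N (y i)) (y_free : injective (ev y)).

(** Polynomials of degree at most D in each variable are counted as functions on
    a box of exponents. *)
Let box D : finType := {ffun 'I_r -> 'I_D.+1}.
Let bm D (a : box D) : 'X_{1..r} := [multinom (a i : nat) | i < r].
Let pb D (T : finType) (j : T) (c : {ffun T * box D -> F}) : {mpoly F[r]} :=
  \sum_(a : box D) c (j, a) *: 'X_[bm a].
Let in_box D (p : {mpoly F[r]}) := forall m, m \in msupp p -> forall i, (m i <= D)%N.

Let bm_inj D : injective (@bm D).
Proof.
move=> a a' h; apply/ffunP => i; apply: val_inj.
by have := congr1 (fun m : 'X_{1..r} => m i) h; rewrite !mnmE.
Qed.

Let pbE D (T : finType) (j : T) (c : {ffun T * box D -> F}) a : (pb j c)@_(bm a) = c (j, a).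
Proof.
rewrite raddf_sum (bigD1 a) //= mcoeffZ mcoeffX eqxx mulr1 big1 ?addr0 // => a' na.
by rewrite mcoeffZ mcoeffX (inj_eq (@bm_inj D)) (negPf na) mulr0.
Qed.

Let pb_box D (T : finType) (j : T) (c : {ffun T * box D -> F}) : in_box D (pb j c).
Proof.
move=> m mp i; have [[a ->]|nm] := pselect (exists a, m = @bm D a).
  by rewrite mnmE -ltnS.
move: mp; rewrite mcoeff_msupp raddf_sum /= big1 ?eqxx // => a _.
by rewrite mcoeffZ mcoeffX; case: eqP => [em|_]; [case: nm; exists a|rewrite mulr0].
Qed.

Let in_box_eq D p p' : in_box D p -> in_box D p' ->
  (forall a : box D, p@_(bm a) = p'@_(bm a)) -> p = p'.
Proof.
move=> hp hp' h; apply/mpolyP => m.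
have [hm|hm] := pselect (forall i, (m i <= D)%N).
  pose a : box D := [ffun i => inord (m i)].
  have -> : m = bm a.
    by apply/mnmP => i; rewrite mnmE ffunE inordK // ltnS.
  exact: h.
have z q : in_box D q -> q@_m = 0.
  by move=> hq; apply/eqP; rewrite mcoeff_eq0; apply/negP => /hq.
by rewrite !z.
Qed.

Let in_boxD D p p' : in_box D p -> in_box D p' -> in_box D (p + p').
Proof.
by move=> hp hp' m /msuppD_le; rewrite mem_cat => /orP[/hp|/hp'].
Qed.

(** A nontrivial relation p among the b_i makes the elements of A too few.  The
    polynomials in y of degree at most n in each variable have coefficients,
    with respect to the e_j, of degree at most D in each variable; adding to
    these coefficients arbitrary multiples of p does not change the element of
    A represented.  Comparing numbers of parameters, for polynomials of degree
    at most D - s where s bounds the degrees of p, contradicts the growth of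
    (n + 1) ^ r. *)
Lemma peval_inj : injective (ev b).
Proof.
move=> p1 p2 e12; apply/eqP; rewrite -subr_eq0; set p := p1 - p2.
have pb0 : ev b p = 0 by rewrite rmorphB /= e12 subrr.
apply: contraT => p0; exfalso.
have [s hs] : exists s, in_box s p.
  exists (\max_(m <- msupp p) mdeg m)%N => m mp i.
  apply: leq_trans (leq_bigmax_seq _ mp _) => //.
  by rewrite mdegE (bigD1 i) //= leq_addr.
pose n := (N * (r * s * r.+1 ^ r.-1) + s)%N.
pose D := (r * n + s)%N.
have lift (a : box n) : exists q : 'I_N -> {mpoly F[r]},
    (forall i, in_box D (q i)) /\
    ev y 'X_[bm a] = \sum_i ev b (q i) * e i.
  have Aa : A (\sum_i a i)%N (ev y 'X_[bm a]).
    rewrite peval_mon (eq_bigr (fun i => y i ^+ a i)) => [|i _]; last by rewrite mnmE.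
    apply: (big_rec2 (fun t x => A t x)); first exact: comp_one.
    by move=> i t x _ Ax; apply: comp_mul => //; rewrite -[X in A X]mul1n; exact: comp_exp.
  have [q hq eq] := graded_span Aa; exists q; split=> // i m mq l.
  have := hq i; case: leqP => hi; last by move=> q0; rewrite q0 msupp0 in mq.
  move=> /dhomogP/(_ _ mq) /= em.
  have sa : (\sum_i a i <= r * n)%N.
    rewrite -[r in (r * _)%N]card_ord -sum_nat_const; apply: leq_sum => j _.
    by rewrite -ltnS.
  apply: leq_trans (leq_trans sa (leq_addr _ _)).
  apply: leq_trans (leq_subr (eps i) _); rewrite -em /wdeg (bigD1 l) //=.
  by apply: leq_trans (leq_addr _ _); rewrite leq_pmulr.
have /choice [q hq] := lift.
pose L (c : {ffun unit * box n -> F}) i := \sum_(a : box n) c (tt, a) *: q a i.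
have LE c : \sum_i ev b (L c i) * e i = ev y (pb tt c).
  rewrite rmorph_sum /=; transitivity (\sum_(a : box n) \sum_i
      inj (c (tt, a)) * (ev b (q a i) * e i)).
    rewrite exchange_big; apply: eq_bigr => i _; rewrite rmorph_sum mulr_suml.
    by apply: eq_bigr => a _; rewrite /= pevalZ mulrA.
  by apply: eq_bigr => a _; rewrite -mulr_sumr pevalZ; have [_ ->] := hq a.
have Lbox c i : in_box D (L c i).
  move=> m /msupp_sum_le /flattenP[_ /mapP[a _ ->]] /msuppZ_le.
  by have [h _] := hq a; exact: h.
pose D' := (r * n)%N.
have pbox (u : {ffun 'I_N * box D' -> F}) i : in_box D (p * pb i u).
  move=> m /msuppM_le /allpairsP[[m1 m2] /= [h1 h2 ->]] l.
  rewrite mnmDE /D addnC leq_add //; first exact: pb_box h2 l.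
  exact: hs.
pose f (cu : {ffun unit * box n -> F} * {ffun 'I_N * box D' -> F}) :
    {ffun 'I_N * box D -> F} :=
  [ffun ia => (L cu.1 ia.1 + p * pb ia.1 cu.2)@_(bm ia.2)].
have f_inj : injective f.
  move=> [c u] [c' u'] ef.
  have ei i : L c i + p * pb i u = L c' i + p * pb i u'.
    apply: (@in_box_eq D) => [||a]; try exact: in_boxD.
    by have := congr1 (fun g : {ffun 'I_N * box D -> F} => g (i, a)) ef; rewrite !ffunE.
  have ec : c = c'.
    have : ev y (pb tt c) = ev y (pb tt c').
      rewrite -!LE; apply: eq_bigr => i _; congr (_ * _).
      by have := congr1 (ev b) (ei i); rewrite !rmorphD !rmorphM /= pb0 !mul0r !addr0.
    move/y_free => h; apply/ffunP => -[[] a].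
    by rewrite -(pbE tt c) h pbE.
  rewrite ec; congr (_, _); apply/ffunP => -[i a].
  have := ei i; rewrite ec => /addrI /(mulfI p0) h.
  by rewrite -(pbE i u) h pbE.
have := leq_card f f_inj; rewrite card_prod !card_ffun !card_prod card_unit mul1n.
rewrite !card_ffun !card_ord -expnD leq_exp2l; last exact: card_finNzRing_gt1.
have yD : (D'.+1 <= D.+1)%N by rewrite ltnS leq_addr.
move=> h1; have h2 := expn_diff r yD.
have h3 : (n.+1 ^ r <= N * (r * s * D.+1 ^ r.-1))%N.
  have e1 : (D.+1 - D'.+1 = s)%N by rewrite subSS /D addKn.
  rewrite e1 in h2; have := leq_trans h1 (leq_mul (leqnn N) h2).
  by rewrite mulnDr addnC leq_add2l.
have h4 : (D.+1 <= r.+1 * n.+1)%N by rewrite /D; have : (s <= n)%N by [rewrite leq_addl]; nia.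
have h5 : (n.+1 ^ r <= N * (r * s * (r.+1 ^ r.-1 * n.+1 ^ r.-1)))%N.
  apply: leq_trans h3 _; rewrite !leq_mul2l -expnMn.
  by case: (r.-1) => [|r']; rewrite ?expn0 ?leq_exp2r ?h4 ?orbT.
move: h5; rewrite leqNgt => /negP; apply.
case: (posnP r) => [->|r0]; first by rewrite !mul0n muln0.
have -> : (n.+1 ^ r = n.+1 * n.+1 ^ r.-1)%N by rewrite -expnS prednK.
rewrite !mulnA ltn_mul2r expn_gt0 /=.
by rewrite ltnS /n -!mulnA leq_addr.
Qed.

End Growth.

Variable sigma : 'I_N -> K -> K.
Hypotheses (sigma1 : forall j, sigma j 1 = 1)
  (sigmaB : forall j, zmod_morphism (sigma j))
  (sigmaM : forall j x y, sigma j (x * y) = sigma j x * sigma j y).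
Hypothesis sigma_dist : forall i j, i != j ->
  exists2 x, (\bigcup_n A n) x & sigma i x != sigma j x.
Hypothesis sigma_inj : forall j c, sigma j (inj c) = inj c.
Hypothesis sigma_b : forall j i, sigma j (b i) = b i.

Lemma sigma_peval j p : sigma j (ev b p) = ev b p.
Proof.
rewrite [p]mpolyE rmorph_sum /= (zmod_morph_sum (sigmaB j)).
apply: eq_bigr => m _; rewrite pevalZ sigmaM sigma_inj peval_mon.
congr (_ * _); rewrite (big_morph (sigma j) (sigmaM j) (sigma1 j)).
apply: eq_bigr => i _; elim: (m i) => [|k IH]; first by rewrite expr0.
by rewrite exprS sigmaM IH sigma_b.
Qed.

Lemma span_coef_free (a : 'I_N -> K) : (forall i j, sigma j (a i) = a i) ->
  \sum_i a i * e i = 0 -> forall i, a i = 0.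
Proof.
apply: (@spanning_free K N (\bigcup_n A n) C sigma e) => //.
- by exists 0%N => //; exact: comp_one.
- by move=> x y [n _ Ax] [m _ Ay]; exists (n + m)%N => //; exact: comp_mul.
- by move=> j _ [p _ <-]; exact: sigma_peval.
- by move=> x [n _]; exact: spanA.
Qed.

(** An invariant x has the expansion x * 1, where 1 is a basis element, and
    this is its expansion with coefficients in the polynomial subalgebra. *)
Lemma invariant_poly n x : A n x -> (forall j, sigma j x = x) ->
  exists2 p, p \is ishomog1 n (wdeg d) & x = ev b p.
Proof.
move=> Ax fx; have [p hp ex] := graded_span Ax; exists (p i0).
  by have := hp i0; rewrite eps0 leq0n subn0.
apply/eqP; rewrite -subr_eq0; apply/eqP.
have := @span_coef_free (fun i => x * (i == i0)%:R - ev b (p i)).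
move=> /(_ _ _ i0); rewrite eqxx mulr1; apply=> [i j|].
  rewrite sigmaB sigma_peval sigmaM fx; congr (_ * _ - _).
  case: eqP => _; first exact: sigma1.
  exact: zmod_morph0.
under eq_bigr do rewrite mulrBl; rewrite sumrB -ex (bigD1 i0) //= eqxx e0 !mulr1.
rewrite big1 ?addr0 ?subrr // => i /negPf ->.
by rewrite mulr0 mul0r.
Qed.

End Recognition.

(** * Frobenius and finite fields *)

Section FiniteField.
Context {F : finFieldType} {K : fieldType} (inj : {rmorphism F -> K}).
Local Notation q := #|F|.

Lemma card_field_pnat : [pchar K].-nat q.
Proof.
have [p pp chp] := finPcharP F.
have chK : p \in [pchar K] by exact: rmorph_pchar chp.
have := pprimeChar_pgroup chp; rewrite /pgroup cardsT => pq.
by apply: sub_in_pnat pq => l _ /eqP ->.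
Qed.

Lemma frobeniusD (x y : K) n : (x + y) ^+ (q ^ n) = x ^+ (q ^ n) + y ^+ (q ^ n).
Proof. by apply: exprDn_pchar; rewrite pnatX card_field_pnat. Qed.

Lemma frobenius_inj (c : F) n : inj c ^+ (q ^ n) = inj c.
Proof.
rewrite -rmorphXn; congr (inj _); elim: n => [|n IH]; first by rewrite expr1.
by rewrite expnSr exprM IH expf_card.
Qed.

Lemma card_field_eq0 : q%:R = 0 :> F.
Proof.
have [p pp chp] := finPcharP F.
have := pprimeChar_pgroup chp; rewrite /pgroup cardsT => /p_natP[n en].
apply/eqP; rewrite -(dvdn_pcharf chp) en; case: n en => [|n] en.
  by have := card_finNzRing_gt1 F; rewrite en.
by rewrite expnS dvdn_mulr.
Qed.

Lemma expf_card1 (x : F) : x != 0 -> x ^+ (q - 1) = 1.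
Proof.
move=> x0; apply: (mulfI x0); rewrite -exprS mulr1 subn1 prednK.
  exact: expf_card.
exact: ltnW (card_finNzRing_gt1 F).
Qed.

Lemma sum_powers (x : F) : x != 0 ->
  \sum_(k < q - 1) x ^+ k = if x == 1 then -1 else 0.
Proof.
move=> x0; have q0 : (0 < q)%N by exact: ltnW (card_finNzRing_gt1 F).
case: eqP => [->|/eqP x1].
  under eq_bigr do rewrite expr1n; rewrite sumr_const card_ord.
  by rewrite natrB // card_field_eq0 sub0r.
have := subrX1 x (q - 1); rewrite expf_card1 // subrr => /esym/eqP.
by rewrite mulf_eq0 subr_eq0 (negPf x1) => /eqP.
Qed.

End FiniteField.

(** * Semi-invariants *)

Section VariableDivision.
Context (F : fieldType) (r : nat) (i : 'I_r).

Let rho : {mpoly F[r]} -> {mpoly F[r]} :=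
  mmap (@mpolyC r F) (fun j => if j == i then 0 else 'X_j).

HB.instance Definition _ := GRing.RMorphism.on rho.

Let rho_dec (p : {mpoly F[r]}) : exists u, p = rho p + 'X_i * u.
Proof.
rewrite [p]mpolyE; apply: (big_ind (fun p => exists u, p = rho p + 'X_i * u)).
- by exists 0; rewrite rmorph0 mulr0 addr0.
- by move=> p1 p2 [u eu] [v ev]; exists (u + v); rewrite {1}eu {1}ev rmorphD /=; ring.
move=> m _; have [u eu] : exists u, 'X_[m] = rho 'X_[m] + 'X_i * u :> {mpoly F[r]}.
  rewrite /rho mmapX /mmap1; have [m0|m0] := eqVneq (m i) 0%N.
    exists 0; rewrite mulr0 addr0 mpolyXE_id; apply: eq_bigr => j _.
    by case: eqP => [->|//]; rewrite m0 !expr0.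
  exists 'X_[m - U_(i)]; rewrite (bigD1 i) //= eqxx expr0n (negPf m0) mul0r add0r.
  by rewrite -mpolyXD addmC submK // lep1mP.
exists (p@_m *: u); rewrite {1}eu scalerDr; congr (_ + _); last by rewrite -scalerAr.
by rewrite /rho mmapZ mul_mpolyC.
Qed.

(** 'X_i divides p exactly when substituting 0 for it kills p, and the target of
    this substitution has no nilpotent elements. *)
Lemma mpolyX_dvd_exp (p t : {mpoly F[r]}) k : p ^+ k = 'X_i * t ->
  exists u, p = 'X_i * u.
Proof.
move=> /(congr1 rho); rewrite rmorphXn rmorphM /= {2}/rho mmapX mmap1U eqxx mul0r.
move/eqP; rewrite expf_eq0 => /andP[_ /eqP e].
by have [u eu] := rho_dec p; exists u; rewrite eu e add0r.
Qed.

End VariableDivision.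

Lemma peval_subring (F K : fieldType) (inj : {rmorphism F -> K}) r (b : 'I_r -> K) C p :
  subring inj C -> (forall i, C (b i)) -> C (peval (inj := inj) b p).
Proof.
move=> hC Cb; rewrite [p]mpolyE rmorph_sum; apply: (subring_sum hC) => m _.
rewrite /= pevalZ peval_mon; apply: (subringM hC); first by case: hC.
by apply: (subring_prod hC) => i _; exact: (subringX hC).
Qed.

Lemma range_peval_subring (F K : fieldType) (inj : {rmorphism F -> K}) r
  (b : 'I_r -> K) : subring inj (range (peval (inj := inj) b)).
Proof.
split=> [c|_ _ [p _ <-] [p' _ <-]|_ _ [p _ <-] [p' _ <-]].
- by exists c%:MP => //; exact: peval_const.
- by exists (p - p') => //; rewrite rmorphB.
- by exists (p * p') => //; rewrite rmorphM.
Qed.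

Section SemiInvariants.
Context {F : finFieldType} {K : fieldType} {inj : {rmorphism F -> K}}.
Local Notation q := #|F|.
Variables (A : mulFamily inj) (T : Type) (mulT : T -> T -> T)
  (sigma : T -> K -> K) (chi : T -> F).
Hypotheses (sigmaB : forall g, zmod_morphism (sigma g))
  (sigmaM : forall g x y, sigma g (x * y) = sigma g x * sigma g y)
  (sigma_inj : forall g c, sigma g (inj c) = inj c)
  (sigma_mul : forall g h x, sigma g (sigma h x) = sigma (mulT g h) x)
  (sigmaA : forall g n x, A n x -> A n (sigma g x)).
Hypotheses (chi_neq0 : forall g, chi g != 0)
  (chi_mul : forall g h, chi (mulT g h) = chi g * chi h)
  (chi_surj : forall a, a != 0 -> exists g, chi g = a).
Variables (r : nat) (b : 'I_r -> K) (i1 : 'I_r) (l : K) (dl : nat) (c : F).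
Hypotheses (b_free : injective (peval (inj := inj) b)) (l_neq0 : l != 0)
  (c_neq0 : c != 0) (Al : A dl l) (sigma_l : forall g, sigma g l = inj (chi g) * l)
  (lX : l ^+ (q - 1) = inj c * b i1).
Hypothesis inv_poly : forall n x, A n x -> (forall g, sigma g x = x) ->
  exists p, x = peval (inj := inj) b p.

Let b' i := if i == i1 then l else b i.
Let B' : set K := range (peval (inj := inj) b').

(** An element s invariant under the kernel of chi is the sum of its components
    of weights chi ^+ k, 0 <= k < q - 1.  The product of the component s_k
    with l ^+ (q - 1 - k) is invariant, hence a polynomial p_k in the b_i; the
    (q - 1)-st power of p_k is divisible by b_i1, since that of s_k is again
    a polynomial in the b_i; thus p_k itself is divisible by b_i1, which is
    l ^+ (q - 1) up to a constant, and s_k is l ^+ k times a polynomial. *)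
Lemma semi_invariants n s : A n s ->
  (forall g h, chi g = chi h -> sigma g s = sigma h s) -> B' s.
Proof.
move=> As hs; have hB' : subring inj B' by exact: range_peval_subring.
have ic0 : inj c != 0 by rewrite fmorph_eq0.
have Bl : B' l by exists 'X_i1 => //; rewrite peval_var /b' eqxx.
have BX : B' (b i1).
  have -> : b i1 = inj c^-1 * l ^+ (q - 1) by rewrite lX fmorphV mulKf.
  by apply: (subringM hB'); [case: hB'|exact: (subringX hB')].
have BP p : B' (peval (inj := inj) b p).
  apply: peval_subring => // i; have [-> //|ni] := eqVneq i i1.
  by exists 'X_i => //; rewrite peval_var /b' (negPf ni).
have sX g x k : (0 < k)%N -> sigma g (x ^+ k) = sigma g x ^+ k.
  case: k => // k _; elim: k => [|k IH]; first by rewrite !expr1.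
  by rewrite exprS sigmaM IH -exprS.
have [g0 _] := chi_surj (oner_neq0 F).
have /choice [t ht] : forall a, exists g, a != 0 -> chi g = a.
  move=> a; have [->|a0] := eqVneq a 0; first by exists g0 => /eqP.
  by have [g hg] := chi_surj a0; exists g.
pose w k := - \sum_(a : F | a != 0) inj (a^-1 ^+ k) * sigma (t a) s.
have Aw k : A n (w k).
  apply: comp_opp; apply: (big_ind (A n)); first exact: comp_zero.
    by move=> x y; exact: comp_add.
  move=> a _; rewrite -[n]add0n; apply: comp_mul; first exact: comp_scal.
  exact: sigmaA.
have sw g k : sigma g (w k) = inj (chi g ^+ k) * w k.
  rewrite /w (zmod_morphN (sigmaB g)) mulrN (zmod_morph_sum (sigmaB g)); congr (- _).
  have x0 := chi_neq0 g.
  rewrite [in RHS](reindex_inj (mulfI x0)) mulr_sumr /=.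
  apply: eq_big => [a|a a0]; first by rewrite mulf_eq0 (negPf x0).
  rewrite sigmaM sigma_inj sigma_mul mulrA -rmorphM; congr (inj _ * _).
    by rewrite invfM exprMn mulrA -exprMn mulfV // expr1n mul1r.
  by apply: hs; rewrite chi_mul !ht // mulf_neq0.
have ws : \sum_(k < q - 1) w k = s.
  have e1 : sigma (t 1) s = s.
    have [gi hgi] := chi_surj (invr_neq0 (chi_neq0 g0)).
    have -> : sigma (t 1) s = s; last by [].
    have h1 : chi (mulT (t 1) (t 1)) = chi (t 1) by rewrite chi_mul !ht ?oner_neq0 ?mulr1.
    have := hs _ _ h1; rewrite -sigma_mul => h2.
    apply/eqP; rewrite -subr_eq0 -[_ - _]opprK oppr_eq0.
    have inj1 x : sigma (t 1) x = 0 -> x = 0.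
      move=> hx; apply/eqP; apply: contraT => x0.
      have := sigmaM (t 1) x x^-1; rewrite hx mul0r divff // -(rmorph1 inj).
      by rewrite sigma_inj rmorph1 => /eqP; rewrite oner_eq0.
    by apply/eqP; rewrite opprB; apply: inj1; rewrite sigmaB h2 subrr.
  rewrite /w sumrN exchange_big /= (bigD1 1) ?oner_neq0 //= [X in _ + X]big1 => [|a /andP[a0 a1]].
    rewrite addr0 -mulr_suml -rmorph_sum /= invr1 sum_powers ?oner_neq0 //.
    by rewrite eqxx e1 rmorphN rmorph1 mulN1r opprK.
  rewrite -mulr_suml -rmorph_sum /= sum_powers ?invr_neq0 //.
  by rewrite invr_eq1 (negPf a1) rmorph0 mul0r.
rewrite -ws; apply: (subring_sum hB') => k _.
have q1 : (0 < q - 1)%N by rewrite subn_gt0 card_finNzRing_gt1.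
have [k0|k0] := posnP k.
  have [|p ->] := inv_poly (Aw k); last exact: BP.
  by move=> g; rewrite sw k0 expr0 rmorph1 mul1r.
have kq : (0 < q - 1 - k)%N by rewrite subn_gt0.
have Apow x dx e : A dx x -> exists n', A n' (x ^+ e).
  by move=> Ax; exists (dx * e)%N; exact: comp_exp.
have [m Alk] := Apow l dl (q - 1 - k)%N Al.
have [g|p ep] := inv_poly (comp_mul Alk (Aw k)).
  rewrite sigmaM sX // sw sigma_l exprMn -rmorphXn.
  rewrite mulrACA -rmorphM -exprD subnK ?(ltnW (ltn_ord k)) //.
  by rewrite expf_card1 // rmorph1 mul1r.
have [m' Awk] := Apow _ _ (q - 1)%N (Aw k).
have [g|t' et] := inv_poly Awk.
  by rewrite sX // sw exprMn -rmorphXn -exprM mulnC exprM expf_card1 // expr1n rmorph1 mul1r.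
have [u eu] : exists u, p = 'X_i1 * u.
  apply: (@mpolyX_dvd_exp _ _ i1 p (c ^+ (q - 1 - k) *: 'X_i1 ^+ (q - 1 - k).-1 * t') (q - 1)).
  apply: b_free; rewrite rmorphXn /= -ep exprMn -exprM mulnC exprM lX et.
  rewrite exprMn !rmorphM /= pevalZ !rmorphXn /= peval_var.
  by rewrite -{2}(prednK kq) exprS; ring.
have -> : w k = inj c^-1 * l ^+ k * peval (inj := inj) b u.
  apply: (mulfI (expf_neq0 (q - 1 - k) l_neq0)); rewrite ep eu rmorphM /= peval_var.
  have lk : l ^+ (q - 1 - k) * l ^+ k = inj c * b i1.
    by rewrite -exprD subnK ?(ltnW (ltn_ord k)).
  by rewrite [RHS]mulrA [X in _ = X * _]mulrCA lk fmorphV mulKf.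
apply: (subringM hB' _ (BP u)); apply: (subringM hB'); first by case: hB'.
exact: (subringX hB').
Qed.

End SemiInvariants.

(** * The additive polynomials of a flag *)

Lemma logarithmic_derivative (K : fieldType) (s : seq K) (T : K) :
  (forall a, a \in s -> T - a != 0) ->
  (\prod_(a <- s) ('X - a%:P))^`().[T] =
  (\prod_(a <- s) (T - a)) * \sum_(a <- s) (T - a)^-1.
Proof.
elim: s => [|a s IH] h; first by rewrite !big_nil derivC horner0 mulr0.
have hs b : b \in s -> T - b != 0 by move=> bs; apply: h; rewrite inE bs orbT.
have ha : T - a != 0 by apply: h; rewrite inE eqxx.
rewrite !big_cons derivM derivXsubC mul1r hornerD hornerM IH // hornerXsubC.
rewrite horner_prod (eq_bigr (fun b => T - b)) => [|b _]; last by rewrite hornerXsubC.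
rewrite mulrDr mulrAC divff // mul1r; congr (_ + _); by rewrite mulrA.
Qed.

(** The logarithmic derivative of T ^+ q - T, whose derivative is -1. *)
Lemma sum_recip_field (F : finFieldType) (K : fieldType) (inj : {rmorphism F -> K})
    (T : K) : (forall a, T - inj a != 0) ->
  T ^+ #|F| - T != 0 /\ \sum_(a : F) (T - inj a)^-1 = - (T ^+ #|F| - T)^-1.
Proof.
move=> hT; have e : 'X^#|F| - 'X = \prod_(a <- [seq inj a | a <- enum F]) ('X - a%:P) :> {poly K}.
  have := congr1 (map_poly inj) (finField_genPoly F).
  rewrite rmorphB rmorphXn /= map_polyX => ->.
  rewrite rmorph_prod big_map big_enum /=; apply: eq_bigr => a _.
  by rewrite rmorphB /= map_polyX map_polyC.
have hs a : a \in [seq inj a | a <- enum F] -> T - a != 0 by case/mapP => b _ ->.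
have ev : T ^+ #|F| - T = \prod_(a <- [seq inj a | a <- enum F]) (T - a).
  have := congr1 (horner^~ T) e; rewrite /= hornerD hornerN hornerXn hornerX => ->.
  by rewrite horner_prod; apply: eq_bigr => b _; rewrite hornerXsubC.
have n0 : T ^+ #|F| - T != 0.
  by rewrite ev prodf_seq_neq0; apply/allP => a /hs.
split=> //; have := logarithmic_derivative hs; rewrite -ev -e.
rewrite derivB derivXn derivX hornerD hornerN hornerMn hornerXn hornerC.
rewrite -mulr_natr -(rmorph_nat inj) card_field_eq0 rmorph0 mulr0 sub0r => h.
by apply: (mulfI n0); rewrite mulrN divff // h big_map big_enum.
Qed.

Section Flag.
Context {F : finFieldType} {K : fieldType} (inj : {rmorphism F -> K}) (V : lmodType F).
Local Notation q := #|F|.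
Variables (iota : V -> K) (x : nat -> V) (r : nat).
Hypotheses (iotaD : forall u v, iota (u + v) = iota u + iota v)
  (iotaZ : forall c v, iota (c *: v) = inj c * iota v)
  (iota_eq0 : forall v, iota v = 0 -> v = 0).

Let q_gt0 : (0 < q)%N. Proof. exact: ltnW (card_finNzRing_gt1 F). Qed.

Let inj_q (a : F) : inj a ^+ q = inj a.
Proof. by have := frobenius_inj inj a 1; rewrite expn1. Qed.

Let exprq (y : K) : y ^+ q = y ^+ (q - 1) * y.
Proof. by rewrite -exprSr subn1 prednK. Qed.

Let frobenius_sum n (f : 'I_n -> K) : (\sum_j f j) ^+ q = \sum_j f j ^+ q.
Proof.
apply: (big_morph (fun y => y ^+ q)); last by rewrite expr0n gtn_eqF.
by move=> y y'; rewrite -[in LHS](expn1 q) (frobeniusD inj) expn1.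
Qed.

(** The substitution z = T y in the recursion for E reduces it to the
    polynomial T - T ^+ q, whose roots are the scalars. *)
Let artin_schreier (T y : K) : y != 0 ->
  T * y - y^-1 ^+ (q - 1) * (T * y) ^+ q = (T - T ^+ q) * y.
Proof.
move=> y0; rewrite exprMn [y ^+ q]exprq.
transitivity (T * y - (y^-1 * y) ^+ (q - 1) * (T ^+ q * y)).
  by rewrite [(y^-1 * y) ^+ _]exprMn; congr (_ - _); rewrite [RHS]mulrACA -[RHS]mulrA.
by rewrite mulVf // expr1n mul1r mulrBl.
Qed.

(** The subspace V_i spanned by x_0, .., x_{i-1}, as the list of its elements, so
    that sums and products over V_i are available. *)
Fixpoint flag (i : nat) : seq V :=
  if i is j.+1 then [seq a *: x j + w | a <- enum F, w <- flag j] else [:: 0].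

Hypothesis x_free : forall i, (i < r)%N -> x i \notin flag i.
Hypothesis flag_full : forall v, v \in flag r.

Lemma flagS i v : reflect (exists a w, w \in flag i /\ v = a *: x i + w) (v \in flag i.+1).
Proof.
apply: (iffP allpairsP) => [[[a w] /= [_ hw ->]]|[a [w [hw ->]]]].
  by exists a, w.
by exists (a, w); rewrite mem_enum.
Qed.

Lemma flag_lin i c u v : u \in flag i -> v \in flag i -> c *: u + v \in flag i.
Proof.
elim: i u v => [|i IH] u v.
  by rewrite !inE => /eqP -> /eqP ->; rewrite scaler0 addr0.
move=> /flagS[a [w [hw ->]]] /flagS[b [w' [hw' ->]]]; apply/flagS.
exists (c * a + b), (c *: w + w'); split; first exact: IH.
by rewrite scalerDr scalerDl scalerA addrACA.
Qed.

Lemma flag0 i : 0 \in flag i.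
Proof.
elim: i => [|i IH]; first by rewrite inE.
by apply/flagS; exists 0, 0; rewrite scale0r addr0.
Qed.

Lemma flagZ i c u : u \in flag i -> c *: u \in flag i.
Proof. by move=> hu; rewrite -[_ *: _]addr0; apply: flag_lin => //; exact: flag0. Qed.

Lemma flagB i u v : u \in flag i -> v \in flag i -> u - v \in flag i.
Proof. by move=> hu hv; rewrite addrC -scaleN1r; exact: flag_lin. Qed.

Lemma flag_sub i j v : (i <= j)%N -> v \in flag i -> v \in flag j.
Proof.
move=> /subnKC <-; elim: (j - i)%N => [|k IH] h; first by rewrite addn0.
rewrite addnS; apply/flagS; exists 0, v; rewrite scale0r add0r; split=> //.
exact: IH.
Qed.

Lemma flag_x i j : (i < j)%N -> x i \in flag j.
Proof.
move=> ij; apply: (flag_sub ij); apply/flagS; exists 1, 0.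
by rewrite scale1r addr0 flag0.
Qed.

Lemma size_flag i : size (flag i) = (q ^ i)%N.
Proof. by elim: i => //= i IH; rewrite size_allpairs IH -cardE expnS. Qed.

Lemma flag_uniq i : (i <= r)%N -> uniq (flag i).
Proof.
elim: i => //= i IH ir; apply: allpairs_uniq; [exact: enum_uniq|exact/IH/ltnW|].
move=> [a w] [b w'] /allpairsP[[a1 w1] /= [_ hw [-> ->]]] /allpairsP[[b1 w1'] /= [_ hw' [-> ->]]] e.
have d : (a1 - b1) *: x i = w1' - w1.
  rewrite scalerBl; apply/eqP; rewrite subr_eq addrAC eq_sym subr_eq addrC.
  by rewrite [_ + w1']addrC in e *; rewrite e addrC.
have [ab|ab] := eqVneq a1 b1; first by move: e; rewrite ab => /addrI ->.
case/negP: (x_free ir); rewrite -[x i](scalerK (a := a1 - b1)) ?subr_eq0 // d.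
by apply: flagZ; exact: flagB.
Qed.

Lemma iota0 : iota 0 = 0. Proof. by rewrite -(scale0r 0) iotaZ rmorph0 mul0r. Qed.
Lemma iotaN v : iota (- v) = - iota v.
Proof. by rewrite -scaleN1r iotaZ rmorphN rmorph1 mulN1r. Qed.
Lemma iotaB u v : iota (u - v) = iota u - iota v.
Proof. by rewrite iotaD iotaN. Qed.
Lemma iota_inj : injective iota.
Proof.
by move=> u v e; apply/eqP; rewrite -subr_eq0; apply/eqP/iota_eq0; rewrite iotaB e subrr.
Qed.

(** E_i(z) is the F-linear polynomial in z with roots V_i = < x_0, .., x_{i-1} >
    and with linear coefficient 1, namely z times the product of the 1 - z / v
    over the nonzero v in V_i. *)
Fixpoint E (i : nat) (z : K) : K :=
  if i is j.+1 then E j z - (E j (iota (x j)))^-1 ^+ (q - 1) * E j z ^+ q else z.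

Definition gx (i : nat) : K := (E i (iota (x i)))^-1.

Lemma E_add i z z' : E i (z + z') = E i z + E i z'.
Proof.
elim: i z z' => //= i IH z z'; rewrite IH -[X in (_ + _) ^+ X]expn1 frobeniusD //.
by rewrite expn1; ring.
Qed.

Lemma E_scale i c z : E i (inj c * z) = inj c * E i z.
Proof.
by elim: i => //= i ->; rewrite exprMn inj_q; ring.
Qed.

Lemma E_root i v : v \in flag i -> E i (iota v) = 0.
Proof.
elim: i v => [|i IH] v; first by rewrite inE => /eqP ->; exact: iota0.
move=> /flagS[a [w [hw ->]]]; rewrite iotaD iotaZ /= E_add E_scale (IH w hw) addr0.
rewrite exprMn inj_q mulrCA.
have [->|y0] := eqVneq (E i (iota (x i))) 0.
  by rewrite expr0n gtn_eqF // !mulr0 subr0.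
by rewrite [_ ^+ q]exprq [_^-1 ^+ _ * _]mulrA -exprMn mulVf // expr1n mul1r subrr.
Qed.

(** A root of E_{i+1} is mapped by E_i to an element of F y, y = E_i(x_i), since
    only the elements T of F satisfy T ^+ q = T. *)
Lemma E_kernel i v : (i <= r)%N -> E i (iota v) = 0 -> v \in flag i.
Proof.
elim: i v => [|i IH] v ir; first by move=> /iota_eq0 ->; rewrite inE.
move=> /= ev; apply/flagS; have y0 : E i (iota (x i)) != 0.
  by apply: contra (x_free ir) => /eqP/IH; apply; exact: ltnW.
set y := E i (iota (x i)) in ev y0; pose T := E i (iota v) / y.
have [T0|T0] := pselect (forall a, T - inj a != 0).
  have [n0 _] := sum_recip_field T0; case/negP: n0.
  have eT : E i (iota v) = T * y by rewrite divfK.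
  move: ev; rewrite eT artin_schreier // => /eqP; rewrite mulf_eq0 (negPf y0) orbF.
  by rewrite subr_eq0 eq_sym -subr_eq0.
have [a /eqP] : exists a, T = inj a.
  apply: contrapT => h; apply: T0 => a; apply/eqP => /eqP; rewrite subr_eq0 => /eqP e.
  by apply: h; exists a.
rewrite -(inj_eq (mulIf y0)) divfK // => /eqP e.
exists a, (v - a *: x i); split; last by rewrite addrC subrK.
apply: IH; first exact: ltnW.
by rewrite -scaleNr iotaD iotaZ E_add E_scale e rmorphN mulNr subrr.
Qed.

Lemma E_x_neq0 i : (i < r)%N -> E i (iota (x i)) != 0.
Proof.
by move=> ir; apply: contra (x_free ir) => /eqP/E_kernel; apply; exact: ltnW.
Qed.

Lemma gx_neq0 i : (i < r)%N -> gx i != 0.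
Proof. by move=> ir; rewrite invr_eq0 E_x_neq0. Qed.

(** V_{i+1} is the union of the a x_i + V_i; the sum over V_i of the reciprocals
    of z + a x_i + w is 1 / (E_i(z) + a y), y = E_i(x_i), by induction, and the
    sum of these over a in F is a logarithmic derivative. *)
Lemma E_recip i z : (i <= r)%N -> (forall w, w \in flag i -> z + iota w != 0) ->
  E i z != 0 /\ (E i z)^-1 = \sum_(w <- flag i) (z + iota w)^-1.
Proof.
elim: i z => [|i IH] z ir hz.
  by rewrite big_seq1 iota0 addr0; split=> //; have := hz 0 (flag0 0); rewrite iota0 addr0.
have y0 := E_x_neq0 ir; set y := E i (iota (x i)) in y0.
have ha a : E i z + inj a * y != 0 /\
    (E i z + inj a * y)^-1 = \sum_(w <- flag i) (z + iota (a *: x i + w))^-1.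
  have -> : E i z + inj a * y = E i (z + iota (a *: x i)).
    by rewrite E_add iotaZ E_scale.
  have [|w hw|n0 ->] := IH (z + iota (a *: x i)); first exact: ltnW.
    by rewrite -addrA -iotaD; apply: hz; apply/flagS; exists a, w.
  by split=> //; apply: eq_bigr => w _; rewrite -addrA -iotaD.
pose T := E i z / y.
have hT a : T - inj a != 0.
  rewrite -(inj_eq (mulIf y0)) mulrBl mul0r divfK //.
  by have [] := ha (- a); rewrite rmorphN mulNr.
have [n0 es] := sum_recip_field hT.
have eE : E i.+1 z = - (y * (T ^+ q - T)).
  have eT : E i z = T * y by rewrite divfK.
  by rewrite /= -/y eT artin_schreier //; ring.
split; first by rewrite eE oppr_eq0 mulf_neq0.
rewrite eE invrN invfM -mulrN -es mulr_sumr.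
rewrite /= big_allpairs_dep /= big_enum /= [RHS](eq_bigl xpredT) //.
rewrite [RHS](reindex_inj (@oppr_inj F)) /=.
apply: eq_bigr => a _; have [_ <-] := ha (- a).
rewrite -invfM; congr (_^-1); rewrite mulrBr [y * T]mulrC divfK //.
by rewrite rmorphN mulNr [y * _]mulrC.
Qed.

Lemma gx_sum i : (i < r)%N -> gx i = \sum_(w <- flag i) (iota (x i) + iota w)^-1.
Proof.
move=> ir; have [|w hw|_ e] := @E_recip i (iota (x i)); [exact: ltnW| |exact: e].
rewrite -iotaD; apply: contra (x_free ir) => /eqP/iota_eq0 /eqP.
by rewrite addr_eq0 => /eqP ->; rewrite -scaleN1r; exact: flagZ.
Qed.

(** The coefficients of E_i: E_i(z) is the sum of the d_ij z^(q^j). *)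
Fixpoint dcoef (i j : nat) : K :=
  match i, j with
  | 0%N, 0%N => 1
  | 0%N, _.+1 => 0
  | i'.+1, 0%N => dcoef i' 0
  | i'.+1, j'.+1 => dcoef i' j'.+1 - gx i' ^+ (q - 1) * dcoef i' j' ^+ q
  end.

Lemma dcoef0 i : dcoef i 0 = 1. Proof. by elim: i. Qed.

Lemma dcoef_gt i j : (i < j)%N -> dcoef i j = 0.
Proof.
elim: i j => [|i IH] [|j] //= ij.
by rewrite !IH // ?(ltnW ij) // expr0n gtn_eqF // mulr0 subr0.
Qed.

Lemma E_coef i z : E i z = \sum_(j < i.+1) dcoef i j * z ^+ (q ^ j).
Proof.
elim: i => [|i IH]; first by rewrite big_ord1 mul1r expr1.
rewrite [LHS]/= IH [RHS]big_ord_recl /=.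
rewrite frobenius_sum mulr_sumr.
under [in RHS]eq_bigr => j _ do rewrite mulrBl.
rewrite sumrB addrA; congr (_ - _); last first.
  by apply: eq_bigr => j _; rewrite exprMn -exprM -expnSr mulrA.
rewrite big_ord_recl; congr (_ + _).
rewrite [RHS]big_ord_recr /= dcoef_gt ?mul0r ?addr0 //.
Qed.

Lemma dcoef_diag i : dcoef i.+1 i.+1 = - (gx i ^+ (q - 1) * dcoef i i ^+ q).
Proof. by rewrite /= dcoef_gt // sub0r. Qed.

Lemma dcoef_diag_neq0 i : (i <= r)%N -> dcoef i i != 0.
Proof.
elim: i => [|i IH] ir; first exact: oner_neq0.
by rewrite dcoef_diag oppr_eq0 mulf_neq0 // expf_neq0 ?gx_neq0 // IH // ltnW.
Qed.

(** The recursion for the coefficients of E_{i+1} solved for those of E_i. *)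
Lemma dcoef_down i j :
  dcoef i j = \sum_(k < j.+1) gx i ^+ (q ^ k - 1) * dcoef i.+1 (j - k)%N ^+ (q ^ k).
Proof.
elim: j => [|j IH]; first by rewrite big_ord1 subnn mul1r expr1 !dcoef0.
have -> : dcoef i j.+1 = dcoef i.+1 j.+1 + gx i ^+ (q - 1) * dcoef i j ^+ q.
  by rewrite /= subrK.
rewrite {1}IH frobenius_sum mulr_sumr [RHS]big_ord_recl; congr (_ + _).
  by rewrite subnn expr0 mul1r expr1 subn0.
apply: eq_bigr => k _; rewrite !lift0 subSS exprMn -!exprM -expnSr.
rewrite mulrA -exprD; congr (_ ^+ _ * _).
have qk : (0 < q ^ k)%N by rewrite expn_gt0 q_gt0.
have h1 : (q <= q ^ k * q)%N by rewrite leq_pmull.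
by rewrite expnSr mulnBl mul1n; have := q_gt0; lia.
Qed.

(** E_i / d_ii is monic, hence the product of the z - w for w in V_i; the ccoef i
    are its coefficients and fx i its value at x_i. *)
Definition ccoef (i j : nat) : K := dcoef i j / dcoef i i.
Definition fx (i : nat) : K := (gx i * dcoef i i)^-1.

Lemma fx_neq0 i : (i < r)%N -> fx i != 0.
Proof.
by move=> ir; rewrite invr_eq0 mulf_neq0 ?gx_neq0 ?dcoef_diag_neq0 // ltnW.
Qed.

Lemma ccoef_gt i j : (i < j)%N -> ccoef i j = 0.
Proof. by move=> ij; rewrite /ccoef dcoef_gt // mul0r. Qed.

Lemma ccoef_diag i : (i <= r)%N -> ccoef i i = 1.
Proof. by move=> ir; rewrite /ccoef divff // dcoef_diag_neq0. Qed.

Lemma fx_coef i : fx i = \sum_(j < i.+1) ccoef i j * iota (x i) ^+ (q ^ j).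
Proof.
rewrite /fx /gx invfM invrK E_coef mulr_suml.
by apply: eq_bigr => j _; rewrite /ccoef mulrAC.
Qed.

Lemma P_coef i z : \sum_(j < i.+1) ccoef i j * z ^+ (q ^ j) = E i z / dcoef i i.
Proof.
by rewrite E_coef mulr_suml; apply: eq_bigr => j _; rewrite /ccoef mulrAC.
Qed.

(** Recursions as for E, but with fx in place of gx: the monic polynomials satisfy
    P_{i+1} = P_i ^+ q - f_i ^+ (q - 1) P_i. *)
Lemma ccoefS0 i : (i < r)%N -> ccoef i.+1 0 = - (fx i ^+ (q - 1) * ccoef i 0).
Proof.
move=> ir; have g0 := gx_neq0 ir; have d0 := dcoef_diag_neq0 (ltnW ir).
rewrite /ccoef !dcoef0 dcoef_diag /fx !mul1r invrN invfM; congr (- _).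
rewrite -!exprVn invfM exprMn -mulrA; congr (_ * _).
by rewrite -exprSr subn1 prednK.
Qed.

Lemma ccoefSS i j : (i < r)%N ->
  ccoef i.+1 j.+1 = ccoef i j ^+ q - fx i ^+ (q - 1) * ccoef i j.+1.
Proof.
move=> ir; have g0 := gx_neq0 ir; have d0 := dcoef_diag_neq0 (ltnW ir).
rewrite /ccoef dcoef_diag /fx.
have -> : dcoef i.+1 j.+1 = dcoef i j.+1 - gx i ^+ (q - 1) * dcoef i j ^+ q by [].
move: (gx i) g0 (dcoef i i) d0 (dcoef i j) (dcoef i j.+1) => g g0 d d0 a b.
rewrite exprMn exprVn [(_ * _)^-1 ^+ _]exprVn exprMn [d ^+ q]exprq.
have := expf_neq0 (q - 1) g0; have := expf_neq0 (q - 1) d0.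
move: (d ^+ (q - 1)) (g ^+ (q - 1)) => u v u0 v0.
by field; rewrite oppr_eq0 !mulf_neq0 ?d0 ?u0 ?v0.
Qed.

Lemma prod_fx : (\prod_(i < r) fx i) ^+ (q - 1) = (-1) ^+ r * ccoef r 0.
Proof.
suff h m : (m <= r)%N -> (\prod_(i < m) fx i) ^+ (q - 1) = (-1) ^+ m * ccoef m 0.
  exact: h.
elim: m => [|m IH] mr.
  by rewrite big_ord0 expr1n /ccoef !dcoef0 divr1 mulr1.
rewrite big_ord_recr exprMn IH ?(ltnW mr) // ccoefS0 // exprS; ring.
Qed.

Section FlagAction.
Variables (sigma : {rmorphism K -> K}) (tau : V -> V).
Hypothesis sigma_iota : forall v, sigma (iota v) = iota (tau v).

Section Unipotent.
Hypothesis tau_flag : forall i, (i < r)%N -> tau (x i) - x i \in flag i.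

Let E_act_gx i : (i < r)%N -> (forall z, sigma (E i z) = E i (sigma z)) ->
  sigma (gx i) = gx i.
Proof.
move=> ir h; rewrite /gx fmorphV h sigma_iota -[tau _](subrK (x i)) iotaD E_add.
by rewrite (E_root (tau_flag ir)) add0r.
Qed.

Lemma E_act i z : (i <= r)%N -> sigma (E i z) = E i (sigma z).
Proof.
elim: i z => //= i IH z ir.
have gi := E_act_gx ir (fun z => IH z (ltnW ir)).
by rewrite rmorphB rmorphM !rmorphXn /= IH ?(ltnW ir) // -/(gx i) gi.
Qed.

Lemma gx_act i : (i < r)%N -> sigma (gx i) = gx i.
Proof. by move=> ir; apply: E_act_gx => // z; apply/E_act/ltnW. Qed.

Lemma fx_act i : (i < r)%N -> sigma (fx i) = fx i.
Proof.
move=> ir; rewrite fmorphV rmorphM /= gx_act //; congr (_ * _)^-1.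
suff h m j : (m <= r)%N -> sigma (dcoef m j) = dcoef m j by apply/h/ltnW.
elim: m j => [|m IH] [|j] mr /=; rewrite ?rmorph1 ?rmorph0 //; first exact/IH/ltnW.
by rewrite rmorphB rmorphM !rmorphXn /= !IH ?gx_act // ltnW.
Qed.

End Unipotent.

(** Applying an automorphism of V to E_r permutes its roots and preserves its
    linear coefficient 1, hence preserves E_r. *)
Lemma dcoef_act j : (forall v, exists u, tau u = v) ->
  sigma (dcoef r j) = dcoef r j.
Proof.
move=> tau_surj; have [jr|rj] := leqP j r; last by rewrite !dcoef_gt // rmorph0.
pose p (c : nat -> K) : {poly K} := \sum_(k < r.+1) c k *: 'X^(q ^ k).
have pev c z : (p c).[z] = \sum_(k < r.+1) c k * z ^+ (q ^ k).
  by rewrite /p horner_sum; apply: eq_bigr => k _; rewrite hornerZ hornerXn.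
have q_inj : injective (expn q) by move=> a b /eqP; rewrite eqn_exp2l ?card_finNzRing_gt1 // => /eqP.
have pc c k : (k <= r)%N -> (p c)`_(q ^ k) = c k.
  move=> kr; rewrite /p coef_sum (bigD1 (Ordinal (n := r.+1) kr)) //=.
  rewrite coefZ coefXn eqxx mulr1 big1 ?addr0 // => l nl.
  rewrite coefZ coefXn; case: eqP => [/q_inj e|_]; last by rewrite mulr0.
  by case/eqP: nl; apply: val_inj.
have root_p v : (p (dcoef r)).[iota v] = 0.
  by rewrite pev -E_coef E_root.
have root_s v : (p (sigma \o dcoef r)).[iota v] = 0.
  have [u <-] := tau_surj v; rewrite pev -sigma_iota.
  have := congr1 sigma (E_coef r (iota u)); rewrite E_root // rmorph0 => e0; rewrite [RHS]e0.
  rewrite rmorph_sum; apply: eq_bigr => k _ /=.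
  by rewrite rmorphM rmorphXn.
have d0 := dcoef_diag_neq0 (leqnn r).
pose del := (sigma (dcoef r r) - dcoef r r) / dcoef r r.
pose c k := sigma (dcoef r k) - dcoef r k - del * dcoef r k.
have crr : c r = 0 by rewrite /c /del divfK // subrr.
have p0 : p c = 0.
  apply/eqP; apply: contraT => pn0.
  have rts : all (root (p c)) [seq iota v | v <- flag r].
    apply/allP => _ /mapP[v _ ->]; apply/rootP.
    transitivity ((p (sigma \o dcoef r)).[iota v] - (p (dcoef r)).[iota v]
                  - del * (p (dcoef r)).[iota v]).
      rewrite !pev mulr_sumr -!sumrB; apply: eq_bigr => k _ /=; rewrite /c; ring.
    by rewrite root_s root_p mulr0 !subr0.
  have := max_poly_roots pn0 rts; rewrite map_inj_uniq; last exact: iota_inj.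
  rewrite size_map size_flag flag_uniq // => /(_ isT); rewrite ltnNge => /negP[].
  apply/leq_sizeP => l hl; rewrite /p coef_sum big1 // => k _; rewrite coefZ coefXn.
  case: eqP => [e|_]; last by rewrite mulr0.
  suff -> : c k = 0 by rewrite mul0r.
  suff -> : (k : nat) = r by [].
  apply/eqP; rewrite eqn_leq -ltnS ltn_ord /=.
  by rewrite -(leq_exp2l _ _ (card_finNzRing_gt1 F)) -e.
have ck k : (k <= r)%N -> c k = 0 by move=> kr; rewrite -(pc c k kr) p0 coef0.
have del0 : del = 0.
  have := ck 0%N (leq0n r); rewrite /c dcoef0 rmorph1 mulr1 subrr sub0r.
  by move/eqP; rewrite oppr_eq0 => /eqP.
have := ck j jr; rewrite /c del0 mul0r subr0 => /eqP.
by rewrite subr_eq0 => /eqP.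
Qed.

End FlagAction.

Section FlagDegrees.
Variable A : mulFamily inj.

Section SymmetricAlgebra.
Hypothesis Aiota : forall v, A 1%N (iota v).

Let fx_deg_of i : (forall j, (j <= i)%N -> A (q ^ i - q ^ j)%N (ccoef i j)) ->
  A (q ^ i)%N (fx i).
Proof.
move=> h; rewrite fx_coef.
apply: (big_ind (A (q ^ i)%N)) => [|y z|j _]; first exact: comp_zero.
  exact: comp_add.
have ji : (j <= i)%N by rewrite -ltnS.
rewrite -[(q ^ i)%N](subnK (leq_pexp2l q_gt0 ji)); apply: comp_mul; first exact: h.
by rewrite -{1}[(q ^ j)%N]mul1n; exact: comp_exp.
Qed.

Lemma ccoef_deg i j : (i <= r)%N -> (j <= i)%N -> A (q ^ i - q ^ j)%N (ccoef i j).
Proof.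
elim: i j => [|i IH] j ir.
  by rewrite leqn0 => /eqP ->; rewrite subnn ccoef_diag //; exact: comp_one.
have Afx := fx_deg_of (fun j => IH j (ltnW ir)).
have Afq : A ((q - 1) * q ^ i)%N (fx i ^+ (q - 1)) by rewrite mulnC; exact: comp_exp.
have qi : (0 < q ^ i)%N by rewrite expn_gt0 q_gt0.
case: j => [_|j ji].
  rewrite ccoefS0 //; apply: comp_opp.
  have -> : (q ^ i.+1 - q ^ 0 = (q - 1) * q ^ i + (q ^ i - q ^ 0))%N.
    by rewrite expnS mulnBl mul1n addnBA // subnK // leq_pmull.
  by apply: comp_mul => //; exact: IH (ltnW ir) (leq0n i).
rewrite ccoefSS //; apply: comp_sub.
  have -> : (q ^ i.+1 - q ^ j.+1 = (q ^ i - q ^ j) * q)%N by rewrite mulnBl -!expnSr.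
  by apply: comp_exp; exact: IH (ltnW ir) ji.
have [ij|ij] := leqP j.+1 i; last by rewrite ccoef_gt // mulr0; exact: comp_zero.
have -> : (q ^ i.+1 - q ^ j.+1 = (q - 1) * q ^ i + (q ^ i - q ^ j.+1))%N.
  rewrite expnS mulnBl mul1n addnBA; last exact: leq_pexp2l.
  by rewrite subnK // leq_pmull.
by apply: comp_mul => //; exact: IH (ltnW ir) ij.
Qed.

Lemma fx_deg i : (i < r)%N -> A (q ^ i)%N (fx i).
Proof. by move=> ir; apply: fx_deg_of => j; apply/ccoef_deg/ltnW. Qed.

End SymmetricAlgebra.

Section ReciprocalAlgebra.
Hypothesis Arecip : forall v, v != 0 -> A 1%N (iota v)^-1.

Lemma x_flag_neq0 i w : (i < r)%N -> w \in flag i -> x i + w != 0.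
Proof.
move=> ir hw; apply: contra (x_free ir); rewrite addr_eq0 => /eqP ->.
by rewrite -scaleN1r; exact: flagZ.
Qed.

Lemma gx_deg i : (i < r)%N -> A 1%N (gx i).
Proof.
move=> ir; rewrite gx_sum // big_seq_cond.
apply: (big_ind (A 1%N)) => [|y z|w /andP[hw _]]; first exact: comp_zero.
  exact: comp_add.
by rewrite -iotaD; apply: Arecip; exact: x_flag_neq0.
Qed.

Lemma dcoef_deg i j : (i <= r)%N -> A (q ^ j - 1)%N (dcoef i j).
Proof.
elim: i j => [|i IH] [|j] ir; rewrite ?dcoef0 ?subnn; try exact: comp_one.
  exact: comp_zero.
apply: comp_sub; first exact/IH/ltnW.
have qj : (0 < q ^ j)%N by rewrite expn_gt0 q_gt0.
have -> : (q ^ j.+1 - 1 = 1 * (q - 1) + (q ^ j - 1) * q)%N.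
  have h1 : (q <= q ^ j * q)%N by rewrite leq_pmull.
  by rewrite expnSr mulnBl !mul1n; have := q_gt0; lia.
by apply: comp_mul; apply: comp_exp; [exact: gx_deg|apply/IH/ltnW].
Qed.

Lemma fx_recip_deg i : (i < r)%N -> A (q ^ i)%N (fx i)^-1.
Proof.
move=> ir; have qi : (0 < q ^ i)%N by rewrite expn_gt0 q_gt0.
rewrite /fx invrK -[(q ^ i)%N](subnKC qi); apply: comp_mul; first exact: gx_deg.
exact/dcoef_deg/ltnW.
Qed.

End ReciprocalAlgebra.

Lemma spans_tower (C : nat -> set K) (n : nat -> nat) m : subring inj (C 0%N) ->
  (forall i, (i < m)%N -> spans A (C i) (n i) (C i.+1)) ->
  spans A (C 0%N) (\prod_(i < m) n i) (C m).
Proof.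
move=> hC; elim: m => [|m IH] h; first by rewrite big_ord0; exact: spans_refl.
rewrite big_ord_recr /=; apply: spans_trans (h m _) => //.
by apply: IH => i im; apply/h/ltnW.
Qed.

Let peval_range m (b : 'I_m -> K) := range (peval (inj := inj) b).

Let in_peval m (b : 'I_m -> K) i : peval_range b (b i).
Proof. by exists 'X_i => //; rewrite peval_var. Qed.

Lemma ccoef_in C i j : subring inj C -> (i <= r)%N ->
  (forall k, (k < i)%N -> C (iota (x k))) -> C (ccoef i j).
Proof.
move=> hC; elim: i j => [|i IH] j ir hx.
  case: j => [|j]; first by rewrite ccoef_diag //; exact: subring1 hC.
  by rewrite ccoef_gt //; exact: subring0 hC.
have {}IH l : C (ccoef i l).
  by apply: IH => [|k ki]; [exact: ltnW|apply/hx/ltnW].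
have Cf : C (fx i ^+ (q - 1)).
  apply: (subringX hC); rewrite fx_coef; apply: (subring_sum hC) => k _.
  by apply: (subringM hC (IH k)); apply: (subringX hC); exact: hx.
case: j => [|j].
  by rewrite ccoefS0 //; apply: (subringN hC); exact: (subringM hC).
rewrite ccoefSS //; have [_ hB _] := hC; apply: hB; first exact: (subringX hC).
exact: (subringM hC).
Qed.

Let P i : {poly K} := \sum_(j < i.+1) ccoef i j *: 'X^(q ^ j).

Let P_eval i z : (P i).[z] = E i z / dcoef i i.
Proof.
rewrite -P_coef /P horner_sum; apply: eq_bigr => k _.
by rewrite hornerZ hornerXn.
Qed.

Let P_monic i : (i <= r)%N -> P i \is monic /\ size (P i) = (q ^ i).+1.
Proof.
move=> ir; rewrite /P big_ord_recr /= ccoef_diag // scale1r.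
have sz : (size (\sum_(j < i) ccoef i j *: 'X^(q ^ j))%R < size ('X^(q ^ i) : {poly K}))%N.
  rewrite size_polyXn ltnS; apply: (leq_trans (size_sum _ _ _)).
  apply/bigmax_leqP => j _; apply: (leq_trans (size_scale_leq _ _)).
  by rewrite size_polyXn ltn_exp2l ?card_finNzRing_gt1.
by rewrite addrC size_polyDl // size_polyXn monicE lead_coefDl // lead_coefXn.
Qed.

Let P_coefs C i : subring inj C -> (forall j, C (ccoef i j)) -> coefs_in C (P i).
Proof.
move=> hC hc k; rewrite coef_sum; apply: (subring_sum hC) => j _.
rewrite coefZ coefXn; apply: (subringM hC) => //.
by case: eqP => _; [exact: subring1 hC|exact: subring0 hC].
Qed.

Let gen_iota C : subring inj C -> (forall k, (k < r)%N -> C (iota (x k))) ->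
  gen inj (range iota) `<=` C.
Proof.
move=> hC hx; apply: gen_min => // _ [v _ <-].
suff h m : (m <= r)%N -> forall w, w \in flag m -> C (iota w).
  exact: (h r (leqnn r)).
elim: m => [|m IH] mr w.
  by rewrite inE => /eqP ->; rewrite iota0; exact: subring0 hC.
move=> /flagS[a [u [hu ->]]]; rewrite iotaD iotaZ; apply: (subringD hC).
  by apply: (subringM hC); [case: hC|exact: hx].
by apply: IH => //; exact: ltnW.
Qed.

Section SymmetricGeneration.
Hypothesis Aiota : forall v, A 1%N (iota v).

(** Both statements adjoin the x_i to B one after the other; x_i is a root of
    P_i - f_i in the first case and of P_r / P_i in the second. *)
Let iota_tower (B : set K) (n : nat -> nat) : subring inj B ->
  (forall i C, (i < r)%N -> subring inj C -> B `<=` C ->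
     (forall k, (k < i)%N -> C (iota (x k))) ->
     exists p : {poly K}, [/\ p \is monic, coefs_in C p, size p = (n i).+1 &
       root p (iota (x i))]) ->
  spans A B (\prod_(i < r) n i) (gen inj (range iota)).
Proof.
move=> hB h.
pose C i := gen inj (B `|` [set y | exists2 k, (k < i)%N & y = iota (x k)]).
have hC i : subring inj (C i) by exact: gen_subring.
have BC i : B `<=` C i by move=> y By; apply: sub_gen; left.
have xC i k : (k < i)%N -> C i (iota (x k)).
  by move=> ki; apply: sub_gen; right; exists k.
have C0 : C 0%N = B.
  apply/seteqP; split; last exact: BC.
  by apply: gen_min => // y [//|[k]].
rewrite -C0; apply: (spans_subset (X := C r)); first by apply: gen_iota => // k /xC.
apply: spans_tower => // i ir; have [p [pm Cp sp rp]] := h i (C i) ir (hC i) (BC i) (xC i).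
apply: spans_subset (spans_monic (hC i) pm Cp sp rp (Aiota (x i))).
apply: gen_min; first exact: gen_subring.
move=> y [By|[k ki ->]]; first by apply: sub_gen; left; exact: BC.
move: ki; rewrite ltnS leq_eqVlt => /orP[/eqP ->|ki]; apply: sub_gen; first by right.
by left; exact: xC.
Qed.

Lemma spans_sym_unipotent :
  spans A (peval_range (fun i : 'I_r => fx i)) (\prod_(i < r) q ^ i)
    (gen inj (range iota)).
Proof.
apply: iota_tower => [|i C ir hC BC xC]; first exact: range_peval_subring.
have Cf : C (fx i) by apply: BC; exact: (in_peval (fun i : 'I_r => fx i) (Ordinal ir)).
have [pm sp] := P_monic (ltnW ir).
have sz : (size (fx i)%:P < size (P i))%N.
  by rewrite sp; apply: leq_ltn_trans (size_polyC_leq1 _) _; rewrite ltnS expn_gt0 q_gt0.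
exists (P i - (fx i)%:P); split.
- by rewrite monicE lead_coefDl ?size_polyN // -monicE.
- move=> k; have [_ hB _] := hC; rewrite coefB; apply: hB.
    by apply: P_coefs => // j; apply: ccoef_in => //; exact: ltnW.
  by rewrite coefC; case: eqP => _ //; exact: subring0 hC.
- by rewrite size_polyDl ?size_polyN.
- apply/rootP; rewrite hornerD hornerN hornerC P_eval /fx /gx invfM invrK.
  by rewrite subrr.
Qed.

Lemma spans_sym_GL :
  spans A (peval_range (fun i : 'I_r => ccoef r i)) (\prod_(i < r) (q ^ r - q ^ i))
    (gen inj (range iota)).
Proof.
apply: (iota_tower (n := fun i => (q ^ r - q ^ i)%N)) => [|i C ir hC BC xC]; first exact: range_peval_subring.
have Cc j : C (ccoef r j).
  have [rj|jr] := ltnP j r; last first.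
    move: jr; rewrite leq_eqVlt => /orP[/eqP <-|rj].
      by rewrite ccoef_diag //; exact: subring1 hC.
    by rewrite ccoef_gt //; exact: subring0 hC.
  by apply: BC; exact: (in_peval (fun i : 'I_r => ccoef r i) (Ordinal rj)).
have [im si] := P_monic (ltnW ir); have [rm sr] := P_monic (leqnn r).
have CPi : coefs_in C (P i).
  by apply: P_coefs => // j; apply: ccoef_in => //; exact: ltnW.
have [u [v [e Cu Cv sv]]] := monic_division hC im CPi (P_coefs hC Cc).
have Pi_root w : w \in flag i -> (P i).[iota w] = 0.
  by move=> hw; rewrite P_eval E_root // mul0r.
have Pr_root w : (P r).[iota w] = 0 by rewrite P_eval E_root // mul0r.
have v0 : v = 0.
  apply/eqP; apply: contraT => vn0.
  have rts : all (root v) [seq iota w | w <- flag i].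
    apply/allP => _ /mapP[w hw ->]; apply/rootP.
    have := Pr_root w; rewrite e hornerD hornerM Pi_root // mulr0 add0r; exact.
  have := max_poly_roots vn0 rts; rewrite map_inj_uniq; last exact: iota_inj.
  rewrite size_map size_flag flag_uniq ?(ltnW ir) // => /(_ isT).
  by rewrite ltnNge -ltnS -si sv.
rewrite v0 addr0 in e; exists u; split=> //.
- by rewrite -(monicMr _ im) -e.
- have := congr1 (fun p : {poly K} => size p) e.
  have un0 : u != 0 by apply: contraTneq rm => u0; rewrite e u0 mul0r monicE lead_coef0 eq_sym oner_eq0.
  rewrite size_Mmonic // sr si addnS /= => h.
  have : (0 < size u)%N by rewrite size_poly_gt0.
  by move: h; case: (size u) => // k h _; lia.
- apply/rootP; have := Pr_root (x i); rewrite e hornerM => /eqP.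
  rewrite mulf_eq0 => /orP[/eqP//|]; rewrite P_eval mulf_eq0 invr_eq0.
  by rewrite (negPf (E_x_neq0 ir)) (negPf (dcoef_diag_neq0 (ltnW ir))).
Qed.

End SymmetricGeneration.

Section ReciprocalGeneration.
Hypothesis Arecip : forall v, v != 0 -> A 1%N (iota v)^-1.

Let recips : set K := [set (iota v)^-1 | v in [set v | v != 0]].

(** Let C_i be generated by the g_j and the reciprocals of the nonzero elements of V_i.
    Up to scalars, the new reciprocals in C_{i+1} are the 1 / (x_i + w), w in
    V_i, and their sum is g_i. *)
Lemma spans_recip_unipotent :
  spans A (peval_range (fun i : 'I_r => gx i)) (\prod_(i < r) q ^ i)
    (gen inj recips).
Proof.
set B := peval_range _; have hB : subring inj B by exact: range_peval_subring.
pose C i := gen inj (B `|` [set (iota v)^-1 | v in [set v | v != 0 /\ v \in flag i]]).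
have hC i : subring inj (C i) by exact: gen_subring.
have BC i : B `<=` C i by move=> y By; apply: sub_gen; left.
have vC i v : v != 0 -> v \in flag i -> C i (iota v)^-1.
  by move=> v0 hv; apply: sub_gen; right; exists v.
have C0 : C 0%N = B.
  apply/seteqP; split; last exact: BC.
  apply: gen_min => // y [//|[v [v0]]]; rewrite inE => /eqP ev.
  by rewrite ev eqxx in v0.
rewrite -C0; apply: (spans_subset (X := C r)).
  apply: gen_min => // _ [v /= v0 <-]; exact: vC.
apply: (spans_tower (n := fun i => (q ^ i)%N)) => // i ir.
rewrite -size_flag -(size_map iota).
have uW : uniq [seq iota w | w <- flag i].
  by rewrite map_inj_uniq; [exact/flag_uniq/ltnW|exact: iota_inj].
have W0 : flag i != [::] by apply/eqP => e; have := flag0 i; rewrite e.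
have gi : C i (gx i) by apply: BC; exact: (in_peval (fun i : 'I_r => gx i) (Ordinal ir)).
have hz w : w \in [seq iota w | w <- flag i] -> iota (x i) + w != 0.
  case/mapP => w' hw' ->; rewrite -iotaD; apply: contra (x_flag_neq0 ir hw').
  by move/eqP/iota_eq0/eqP.
have hA w : w \in [seq iota w | w <- flag i] -> A 1%N (iota (x i) + w)^-1.
  by case/mapP => w' hw' ->; rewrite -iotaD; apply: Arecip; exact: x_flag_neq0.
have hd w w' : w \in [seq iota w | w <- flag i] -> w' \in [seq iota w | w <- flag i] ->
    w != w' -> C i (w - w')^-1.
  case/mapP => u hu -> /mapP[u' hu' ->] ne; rewrite -iotaB; apply: vC.
    by rewrite subr_eq0; apply: contra ne => /eqP ->.
  exact: flagB.
have hg : C i (\sum_(w <- [seq iota w | w <- flag i]) (iota (x i) + w)^-1).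
  by rewrite big_map -gx_sum.
have sub : C i.+1 `<=` gen inj (C i `|` [set (iota (x i) + w)^-1 |
    w in [set` [seq iota w | w <- flag i]]]).
  have hG := @gen_subring _ _ inj (C i `|` [set (iota (x i) + w)^-1 |
    w in [set` [seq iota w | w <- flag i]]]).
  apply: gen_min => // y [By|[v [v0 /flagS[a [w [hw ev]]]] <-]].
    by apply: sub_gen; left; exact: BC.
  have [a0|a0] := eqVneq a 0.
    apply: sub_gen; left; apply: vC => //.
    by rewrite ev a0 scale0r add0r.
  have -> : iota v = inj a * (iota (x i) + iota (a^-1 *: w)).
    by rewrite ev -iotaD -iotaZ scalerDr scalerA mulfV // scale1r.
  rewrite invfM; apply: (subringM hG); first by rewrite -fmorphV; case: hG.
  apply: sub_gen; right; exists (iota (a^-1 *: w)) => //=.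
  by apply: map_f; exact: flagZ.
move: uW hz hA hd hg sub; case: (flag i) W0 => // w0 W _ uW hz hA hd hg sub.
apply: (spans_subset sub); rewrite map_cons; apply: spans_recip => //.
by move=> w wW; apply: hA; rewrite map_cons inE wW orbT.
Qed.

(** Starting from E_r the g_i are adjoined in descending order: g_i together
    with the coefficients of E_{i+1} determines those of E_i, and it is
    constrained by the vanishing of d_{i,i+1}. *)
Lemma spans_recip_GL :
  spans A (peval_range (fun i : 'I_r => dcoef r i.+1))
    (\prod_(k < r) (q ^ (r - k) - 1) * \prod_(i < r) q ^ i) (gen inj recips).
Proof.
set B := peval_range _; have hB : subring inj B by exact: range_peval_subring.
pose C k := gen inj (B `|` [set y | exists2 i, (r - k <= i < r)%N & y = gx i]).
have hC k : subring inj (C k) by exact: gen_subring.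
have BC k : B `<=` C k by move=> y By; apply: sub_gen; left.
have gC k i : (r - k <= i < r)%N -> C k (gx i).
  by move=> hi; apply: sub_gen; right; exists i.
have C0 : C 0%N = B.
  apply/seteqP; split; last exact: BC.
  by apply: gen_min => // y [//|[i]]; rewrite subn0; lia.
apply: (@spans_trans _ _ _ _ B (peval_range (fun i : 'I_r => gx i))); last exact: spans_recip_unipotent.
rewrite -C0; apply: (spans_subset (X := C r)).
  move=> _ [p _ <-]; apply: peval_subring => // i; apply: gC.
  by rewrite subnn ltn_ord.
have dC k j : (k <= r)%N -> C k (dcoef (r - k) j).
  elim: k j => [|k IH] j kr.
    rewrite subn0; case: j => [|j]; first by rewrite dcoef0; exact: subring1 (hC 0%N).
    have [jr|rj] := ltnP j r; last by rewrite dcoef_gt //; exact: subring0 (hC 0%N).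
    by apply: BC; exact: (in_peval (fun i : 'I_r => dcoef r i.+1) (Ordinal jr)).
  rewrite dcoef_down; apply: (subring_sum (hC k.+1)) => l _.
  apply: (subringM (hC k.+1)); apply: (subringX (hC k.+1)); first by apply: gC; lia.
  have -> : ((r - k.+1).+1 = r - k)%N by lia.
  have := IH (j - l)%N (ltnW kr); apply: gen_min => // y [By|[i hi ->]].
    exact: BC.
  by apply: gC; lia.
apply: (spans_tower (n := fun k => (q ^ (r - k) - 1)%N)) => // k kr.
pose i := (r - k.+1)%N; have ei : (r - k = i.+1)%N by rewrite /i; lia.
have ir : (i < r)%N by rewrite /i; lia.
have qgt n : (0 < q ^ n)%N by rewrite expn_gt0 q_gt0.
pose c l := dcoef i.+1 (i.+1 - l)%N ^+ (q ^ l).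
pose p : {poly K} := \sum_(l < i.+2) c l *: 'X^(q ^ l - 1).
have c1 : c i.+1 = 1 by rewrite /c subnn dcoef0 expr1n.
have sz : (size (\sum_(l < i.+1) c l *: 'X^(q ^ l - 1))%R < size ('X^(q ^ i.+1 - 1) : {poly K}))%N.
  rewrite size_polyXn ltnS; apply: (leq_trans (size_sum _ _ _)).
  apply/bigmax_leqP => l _; apply: (leq_trans (size_scale_leq _ _)).
  rewrite size_polyXn subn1 prednK // leq_subRL // add1n.
  by rewrite ltn_exp2l ?card_finNzRing_gt1.
have ep : p = 'X^(q ^ i.+1 - 1) + \sum_(l < i.+1) c l *: 'X^(q ^ l - 1).
  by rewrite /p big_ord_recr /= c1 scale1r addrC.
have pm : p \is monic by rewrite ep monicE lead_coefDl // lead_coefXn.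
have sp : size p = (q ^ (r - k) - 1).+1 by rewrite ep size_polyDl // size_polyXn ei.
have Cp : coefs_in (C k) p.
  move=> m; rewrite coef_sum; apply: (subring_sum (hC k)) => l _.
  rewrite coefZ coefXn; apply: (subringM (hC k)).
    apply: (subringX (hC k)); have := dC k (i.+1 - l)%N (ltnW kr).
    by rewrite {1}ei.
  by case: eqP => _; [exact: subring1 (hC k)|exact: subring0 (hC k)].
have rp : root p (gx i).
  apply/rootP; rewrite /p horner_sum.
  rewrite -[RHS](dcoef_gt (ltnSn i)) [RHS]dcoef_down.
  by apply: eq_bigr => l _; rewrite hornerZ hornerXn mulrC.
apply: spans_subset (spans_monic (hC k) pm Cp sp rp (gx_deg Arecip ir)).
apply: gen_min; first exact: gen_subring.
move=> y [By|[j hj ->]]; first by apply: sub_gen; left; exact: BC.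
have [->|nji] := eqVneq j i; first by apply: sub_gen; right.
by apply: sub_gen; left; apply: gC; move/eqP: nji; rewrite /i; lia.
Qed.

End ReciprocalGeneration.

End FlagDegrees.

(** Right multiplication by the unitriangular matrix of the coefficients of the
    P_k turns the Moore matrix into the matrix of the P_k(x_i), which is
    triangular since P_k vanishes at x_i for i < k. *)
Lemma moore_det :
  \det (\matrix_(i < r, j < r) iota (x i) ^+ (q ^ j)) = \prod_(i < r) fx i.
Proof.
pose M := \matrix_(i < r, j < r) iota (x i) ^+ (q ^ j).
pose U := \matrix_(j < r, k < r) ccoef k j.
have tU : \det U = 1.
  rewrite -det_tr det_trig.
    by rewrite big1 // => i _; rewrite !mxE ccoef_diag // ltnW.
  by apply/is_trig_mxP => i j ij; rewrite !mxE ccoef_gt.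
have MU : M *m U = \matrix_(i < r, k < r) (E k (iota (x i)) / dcoef k k).
  apply/matrixP => i k; rewrite !mxE -P_coef.
  rewrite (big_ord_widen_cond r xpredT (fun j => ccoef k j * iota (x i) ^+ (q ^ j)) (ltn_ord k)).
  rewrite [RHS]big_mkcond /=; apply: eq_bigr => j _; rewrite !mxE mulrC.
  by case: ltnP => // kj; rewrite ccoef_gt // mul0r.
rewrite -/M; have -> : \det M = \det (M *m U) by rewrite det_mulmx tU mulr1.
rewrite MU det_trig.
  by apply: eq_bigr => i _; rewrite mxE /fx /gx invfM invrK.
by apply/is_trig_mxP => i k ik; rewrite mxE E_root ?mul0r //; exact: flag_x.
Qed.

End Flag.

(** * The action on the field of fractions *)

Section ConcreteAction.
Context {F : fieldType} {V : vectType F}.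
Local Notation n := (\dim {:V}).
Local Notation K := (polyFrac F n).
Local Notation kc := (polyConst F n).
Local Notation ev := (peval (inj := kc)).

Definition linform (v : V) : K := FracField.tofrac (sym_vect v).

Lemma linformD u v : linform (u + v) = linform u + linform v.
Proof. by rewrite /linform linearD rmorphD. Qed.

Lemma linformZ c v : linform (c *: v) = kc c * linform v.
Proof. by rewrite /linform linearZ /= -mul_mpolyC rmorphM. Qed.

Lemma linform_eq0 v : linform v = 0 -> v = 0.
Proof. by move/eqP; rewrite tofrac_eq0 sym_vect_eq0 => /eqP. Qed.

Lemma linform_neq0 v : v != 0 -> linform v != 0.
Proof. by apply: contra => /eqP/linform_eq0 ->. Qed.

Lemma sym_vect_basis (i : 'I_n) : sym_vect (vbasis {:V})`_i = 'X_i.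
Proof.
by have := sym_mapX \1%VF i; rewrite sym_map1 id_lfunE.
Qed.

Lemma tofrac_peval (p : {mpoly F[n]}) :
  FracField.tofrac p = ev (fun i => linform (vbasis {:V})`_i) p.
Proof.
rewrite {1}[p]mpolyE [in RHS](mpolyE p) !rmorph_sum; apply: eq_bigr => m _.
rewrite /= pevalZ -mul_mpolyC rmorphM /= peval_mon mpolyXE_id rmorph_prod.
congr (_ * _); apply: eq_bigr => i _.
by rewrite rmorphXn /= /linform sym_vect_basis.
Qed.

Section OneElement.
Variables (g : 'End(V)) (kg : lker g == 0%VS).

Let gI : injective (sym_map g) := sym_map_inj kg.

Lemma actE a b : b != 0 -> act g (FracField.tofrac a / FracField.tofrac b) =
  FracField.tofrac (sym_map g a) / FracField.tofrac (sym_map g b).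
Proof. by move=> b0; exact: frac_mapE. Qed.

Lemma act_zmod : zmod_morphism (act g). Proof. exact: frac_mapB. Qed.
Lemma act_mul x y : act g (x * y) = act g x * act g y. Proof. exact: frac_mapM. Qed.
Lemma act_kc c : act g (kc c) = kc c.
Proof.
rewrite /act /= frac_map_tofrac //.
congr (FracField.tofrac _); exact: comp_mpolyC.
Qed.
Lemma act1 : act g 1 = 1. Proof. by rewrite -(rmorph1 kc) act_kc. Qed.
Lemma act_monoid : monoid_morphism (act g).
Proof. by split; [exact: act1|exact: act_mul]. Qed.
Lemma act_linform v : act g (linform v) = linform (g v).
Proof.
rewrite /act /linform frac_map_tofrac //; congr (FracField.tofrac _).
exact: sym_map_vect.
Qed.

(** For the lemmas that expect a homomorphism of rings; the action is one only
    for injective g, so act itself does not carry this structure. *)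
Lemma act_rmorphism : exists s : {rmorphism K -> K}, forall x, s x = act g x.
Proof.
pose f := act g.
pose h1 := GRing.isZmodMorphism.Build _ _ f act_zmod.
pose h2 := GRing.isMonoidMorphism.Build _ _ f act_monoid.
pose s : {rmorphism K -> K} := HB.pack f h1 h2.
by exists s.
Qed.

Lemma actV x : act g x^-1 = (act g x)^-1.
Proof. by have [s hs] := act_rmorphism; rewrite -!hs fmorphV. Qed.

End OneElement.

Lemma act_comp (g h : 'End(V)) x : lker g == 0%VS -> lker h == 0%VS ->
  act h (act g x) = act (h \o g)%VF x.
Proof.
move=> kg kh; have gI := sym_map_inj kg.
have [a [b [b0 ->]]] := fracP x.
have gb0 : sym_map g b != 0.
  by apply: contra b0 => /eqP gb; apply/eqP/gI; rewrite gb rmorph0.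
rewrite actE // [in LHS]actE // actE //; last exact: lker_comp.
by congr (FracField.tofrac _ / FracField.tofrac _); rewrite sym_map_comp.
Qed.

Lemma act_id x : act (V := V) \1%VF x = x.
Proof.
have [a [b [b0 ->]]] := fracP x.
by rewrite actE ?lker_one // !sym_map1.
Qed.

Lemma sym_linform v : symAlg V 1%N (linform v).
Proof.
exists (sym_vect v) => //; apply/dhomogP => m.
rewrite /sym_vect => /msupp_sum_le /flattenP[s /mapP[i _ ->]].
move=> /msuppZ_le; rewrite msuppX inE => /eqP ->.
rewrite /= /wdeg (bigD1 i) //= mnm1E eqxx big1 // => j nj.
by rewrite mnm1E eq_sym (negPf nj).
Qed.

Lemma sym_act (g : 'End(V)) m x : lker g == 0%VS -> symAlg V m x -> symAlg V m (act g x).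
Proof.
move=> kg [p hp ->]; rewrite tofrac_peval; have [s hs] := act_rmorphism kg.
rewrite -hs.
have -> : s (ev (fun i => linform (vbasis {:V})`_i) p) =
    ev (fun i => linform (g (vbasis {:V})`_i)) p.
  rewrite /peval /mmap rmorph_sum; apply: eq_bigr => l _.
  rewrite rmorphM /= hs act_kc //; congr (_ * _); rewrite /mmap1 rmorph_prod.
  by apply: eq_bigr => i _; rewrite rmorphXn /= hs act_linform.
by apply: (@peval_homog _ _ _ _ _ (fun _ => 1%N)) => // i; exact: sym_linform.
Qed.

Lemma rec_linform v : v != 0 -> recAlg V 1%N (linform v)^-1.
Proof.
move=> v0; exists [:: (1, [tuple v])]; split.
  by move=> p; rewrite inE => /eqP -> w; rewrite /= inE => /eqP ->.
by rewrite big_seq1 /= big_seq1 rmorph1 mul1r.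
Qed.

Lemma rec_act (g : 'End(V)) m x : lker g == 0%VS -> recAlg V m x -> recAlg V m (act g x).
Proof.
move=> kg [t [ht ->]]; have [s hs] := act_rmorphism kg.
exists [seq (p.1, map_tuple g p.2) | p <- t]; split.
  move=> _ /mapP[p pt ->] _ /mapP[w wp ->].
  by apply: contra (ht p pt w wp) => /eqP gw; move/lker0P: kg => /(_ w 0); rewrite linear0 gw => ->.
rewrite big_map -hs rmorph_sum; apply: eq_bigr => p _ /=.
rewrite rmorphM /= hs act_kc //; congr (_ * _).
rewrite rmorph_prod big_map; apply: eq_bigr => w _ /=.
by rewrite hs /vect_inv actV // -/(linform w) act_linform.
Qed.

Lemma sym_gen m x : symAlg V m x -> gen kc (range linform) x.
Proof.
move=> [p _ ->]; rewrite tofrac_peval; apply: peval_subring => [|i].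
  exact: gen_subring.
by apply: sub_gen; exists (vbasis {:V})`_i.
Qed.

Lemma rec_gen m x : recAlg V m x -> gen kc [set (linform v)^-1 | v in [set v | v != 0]] x.
Proof.
move=> [t [ht ->]]; have hG := @gen_subring _ _ kc [set (linform v)^-1 | v in [set v : V | v != 0]].
rewrite big_seq_cond; apply: (subring_sum hG) => p /andP[pt _].
apply: (subringM hG); first by case: hG.
rewrite big_seq_cond; apply: (subring_prod hG) => v /andP[vp _].
by apply: sub_gen; exists v => //; exact: ht pt v vp.
Qed.

Lemma sym_growth : injective (ev (fun i : 'I_n => linform (vbasis {:V})`_i)).
Proof.
by move=> p p'; rewrite -!tofrac_peval => /eqP; rewrite tofrac_eq => /eqP.
Qed.

(** Multiplying a polynomial relation between the inverses of the variables by
    a power of their product gives one between the variables. *)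
Lemma rec_growth :
  injective (ev (fun i : 'I_n => (linform (vbasis {:V})`_i)^-1)).
Proof.
move=> p1 p2 /eqP; rewrite -subr_eq0 -rmorphB => /eqP e.
apply/eqP; rewrite -subr_eq0; apply/eqP; set p := p1 - p2 in e *.
pose D := \max_(m <- msupp p) mdeg m.
have hD m i : m \in msupp p -> (m i <= D)%N.
  move=> mp; apply: (@leq_trans (mdeg m)); last exact: leq_bigmax_seq.
  by rewrite mdegE (bigD1 i) //= leq_addr.
pose co (m : 'X_{1..n}) : 'X_{1..n} := [multinom (D - m i)%N | i < n].
pose p' := \sum_(m <- msupp p) p@_m *: 'X_[co m].
have b0 (i : 'I_n) : linform (vbasis {:V})`_i != 0.
  apply: linform_neq0.
  have vi : (vbasis {:V})`_i \in (vbasis {:V} : seq V) by rewrite mem_nth ?size_tuple.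
  exact: free_not0 (basis_free (vbasisP {:V})) vi.
have e' : p' = 0.
  apply/eqP; rewrite -(tofrac_eq0 p') tofrac_peval rmorph_sum /=; apply/eqP.
  have e2 : \sum_(m <- msupp p) kc p@_m *
      mmap1 (fun i : 'I_n => (linform (vbasis {:V})`_i)^-1) m = 0 := e.
  transitivity ((\prod_(i < n) linform (vbasis {:V})`_i ^+ D) *
      \sum_(m <- msupp p) kc p@_m *
      mmap1 (fun i : 'I_n => (linform (vbasis {:V})`_i)^-1) m); last by rewrite e2 mulr0.
  rewrite mulr_sumr big_seq [RHS]big_seq.
  apply: eq_bigr => m mp /=; rewrite pevalZ mulrCA; congr (_ * _).
  rewrite peval_mon /mmap1 -big_split; apply: eq_bigr => i _ /=; rewrite mnmE.
  by rewrite exprVn -{2}(subnK (hD m i mp)) exprD mulfK // expf_neq0.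
apply/mpolyP => m; rewrite mcoeff0.
have [mp|mp] := boolP (m \in msupp p); last by rewrite memN_msupp_eq0.
have := congr1 (mcoeff (co m)) e'; rewrite mcoeff0 raddf_sum /= (bigD1_seq m) ?msupp_uniq //=.
rewrite mcoeffZ mcoeffX eqxx mulr1 big_seq_cond big1 ?addr0 // => l /andP[lp nl].
rewrite mcoeffZ mcoeffX; case: eqP => [ec|_]; last by rewrite mulr0.
case/eqP: nl; apply/mnmP => i; have := congr1 (fun t : 'X_{1..n} => t i) ec.
by rewrite !mnmE; have := hD l i lp; have := hD m i mp; lia.
Qed.

Lemma sym_dist (g h : 'End(V)) : lker g == 0%VS -> lker h == 0%VS -> g != h ->
  exists2 x, (\bigcup_m symAlg V m) x & act g x != act h x.
Proof.
move=> kg kh ngh; have [v ngv] : exists v, g v != h v.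
  apply: contrapT => H; case/eqP: ngh; apply/lfunP => v; apply/eqP.
  by apply: contraT => nv; case: H; exists v.
exists (linform v); first by exists 1%N => //; exact: sym_linform.
by rewrite !act_linform // tofrac_eq -subr_eq0 -linearB sym_vect_eq0 subr_eq0.
Qed.

Lemma rec_dist (g h : 'End(V)) : lker g == 0%VS -> lker h == 0%VS -> g != h ->
  exists2 x, (\bigcup_m recAlg V m) x & act g x != act h x.
Proof.
move=> kg kh ngh; have [v ngv] : exists v, g v != h v.
  apply: contrapT => H; case/eqP: ngh; apply/lfunP => v; apply/eqP.
  by apply: contraT => nv; case: H; exists v.
have v0 : v != 0 by apply: contraNneq ngv => ->; rewrite !linear0.
exists (linform v)^-1; first by exists 1%N => //; exact: rec_linform.
rewrite !actV // (inj_eq invr_inj) !act_linform // tofrac_eq -subr_eq0 -linearB.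
by rewrite sym_vect_eq0 subr_eq0.
Qed.

End ConcreteAction.

(** * Unipotent groups and flags *)

(** A group of unipotent matrices over a finite field of characteristic p is a
    finite p-group, so it fixes a nonzero vector of any nonzero module over
    this field, in particular of the quotient by a proper submodule W. *)
Lemma unipotent_fixed_vector (F : finFieldType) (n : nat) (gT : finGroupType)
    (v : gT -> 'M[F]_n.+1) (P : set 'M[F]_n.+1) (W : 'M[F]_n.+1) :
  injective v -> v 1%g = 1%:M -> (forall x y, v (x * y)%g = v x *m v y) ->
  P 1%:M -> (forall M N, P M -> P N -> P (M *m N)) ->
  (forall M, P M -> exists u, v u = M) ->
  (forall M, P M -> exists k, iter k (fun h => h *m (M - 1%:M)) 1%:M = 0) ->
  (forall M, P M -> (W *m M <= W)%MS) -> ~~ row_full W ->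
  exists w : 'rV[F]_n.+1, ~~ (w <= W)%MS /\ forall M, P M -> (w *m M - w <= W)%MS.
Proof.
move=> v_inj v1 vM P1 PM vS Puni PW nfW.
have [p pp chp] := finPcharP F.
pose G0 : {set gT} := finset (fun u => `[< P (v u) >]).
have G0P u : reflect (P (v u)) (u \in G0).
  by rewrite [u \in G0]finset.in_set; exact: asboolP.
have gG : group_set G0.
  apply/group_setP; split; first by apply/G0P; rewrite v1.
  by move=> x y /G0P Px /G0P Py; apply/G0P; rewrite vM; exact: PM.
pose G := Group gG.
have rG : mx_repr G v by split=> // x y _ _; exact: vM.
pose rho := MxRepresentation rG.
have vX u m : v (u ^+ m)%g = v u ^+ m.
  by elim: m => [|m IH]; rewrite ?expg0 ?v1 // expgSr exprSr vM IH.
have pG : pgroup p G.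
  apply/pgroupP => l lp /(Cauchy lp) [u /G0P Pu1 ou].
  have [k hk] := Puni _ Pu1.
  have e1 : (v u - 1) ^+ k = 0.
    by rewrite -hk; elim: (k) => [|k' IH]; rewrite ?expr0 // exprSr IH.
  have chP : p \in [pchar {poly F}] by rewrite pchar_poly.
  have pk : (k <= p ^ k)%N by apply/ltnW/ltn_expl/prime_gt1.
  have e2 : ('X - 1) ^+ (p ^ k) = 'X ^+ (p ^ k) - 1 :> {poly F}.
    have pn : [pchar {poly F}].-nat (p ^ k)%N by rewrite pnatX pnatE ?chP.
    have := exprDn_pchar ('X - 1) 1 pn; rewrite subrK expr1n => ->.
    by rewrite addrK.
  have e3 : v u ^+ (p ^ k) = 1.
    have := congr1 (horner_mx (v u)) e2.
    rewrite rmorphXn !rmorphB /= rmorphXn /= horner_mx_X rmorph1.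
    rewrite -(subnK pk) exprD e1 mulr0 subnK // => /esym/eqP.
    by rewrite subr_eq0 => /eqP.
  have e4 : (u ^+ (p ^ k) = 1)%g by apply: v_inj; rewrite vX e3 v1.
  have : (l %| p ^ k)%N by rewrite -ou order_dvdn e4.
  by rewrite Euclid_dvdX // => /andP[]; rewrite dvdn_prime2.
have modW : mxmodule rho W.
  by apply/mxmoduleP => u /G0P Pu1; exact: PW.
have n0 : (0 < \rank (cokermx W))%N.
  rewrite lt0n mxrank_eq0; apply: contra nfW => /eqP c0.
  by rewrite -sub1mx submxE c0 mulmx0.
have := rfix_pgroup_pchar chp (factmod_repr modW) n0 pG (subxx G).
set R := rfix_mx _ _ => R0.
pose w := nz_row R; have w0 : w != 0 by rewrite nz_row_eq0.
have wfix : forall u, u \in G -> w *m factmod_repr modW u = w.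
  by apply/rfix_mxP; exact: nz_row_sub.
exists (val_factmod w); split.
  by rewrite -in_factmod_eq0 val_factmodK.
move=> M PM1; have [u eu] := vS _ PM1; rewrite -eu in PM1 *.
have uG : u \in G by apply/G0P.
rewrite -in_factmod_eq0 linearB /= -[v u]/(rho u).
by rewrite (in_factmodJ modW) // val_factmodK wfix // subrr.
Qed.

(** The ambient finite group consists of all invertible matrices. *)
Lemma kolchin_step (F : finFieldType) (n : nat) (P : set 'M[F]_n) (W : 'M[F]_n) :
  P 1%:M -> (forall M N, P M -> P N -> P (M *m N)) ->
  (forall M, P M -> M \in unitmx) ->
  (forall M, P M -> exists k, iter k (fun h => h *m (M - 1%:M)) 1%:M = 0) ->
  (forall M, P M -> (W *m M <= W)%MS) -> ~~ row_full W ->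
  exists w : 'rV[F]_n, ~~ (w <= W)%MS /\ forall M, P M -> (w *m M - w <= W)%MS.
Proof.
case: n P W => [|n] P W P1 PM Pu Puni PW nfW.
  by case/negP: nfW; rewrite /row_full -leqn0 rank_leq_col.
apply: (@unipotent_fixed_vector F n {'GL_n.+1[F]} (fun u => GLval u)) => //.
- exact: val_inj.
- by move=> M PM1; exists (FinRing.Unit (Pu _ PM1)).
Qed.

Import passmx.

Section Flags.
Context {F : finFieldType} {V : vectType F}.
Local Notation n := (\dim {:V}).
Local Notation q := #|F|.
Local Notation vb := (vbasis {:V}).
Let vbP : basis_of {:V} vb := vbasisP {:V}.

Lemma flag_ext (x y : nat -> V) m : (forall i, (i < m)%N -> x i = y i) ->
  flag x m = flag y m.
Proof.
elim: m => //= m IH h; rewrite IH => [|i im]; last by apply/h/ltnW.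
by rewrite h.
Qed.

Section FlagGroup.
Variable x : nat -> V.
Hypothesis x_free : forall i, (i < n)%N -> x i \notin flag x i.

(** V_n has as many elements as V. *)
Lemma flag_full v : v \in flag x n.
Proof.
have q1 := card_finNzRing_gt1 F.
pose s := [seq rVof vb v | v <- flag x n].
have us : uniq s.
  rewrite map_inj_uniq; first exact: flag_uniq (leqnn _).
  exact: can_inj (rVofK vbP).
have ss : size s = #|{: 'rV[F]_n}| by rewrite size_map size_flag card_mx mul1n.
have : rVof vb v \in s.
  have sE : {subset s <= enum {: 'rV[F]_n}} by move=> ? _; rewrite mem_enum.
  have [|_ ->] := uniq_min_size us sE; last by rewrite mem_enum.
  by rewrite ss cardE.
by case/mapP => w hw /(can_inj (rVofK vbP)) ->.
Qed.

Lemma flag_eq (g h : 'End(V)) : (forall i, (i < n)%N -> g (x i) = h (x i)) -> g = h.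
Proof.
move=> e; apply/lfunP => v; have := flag_full v.
suff H m : (m <= n)%N -> forall w, w \in flag x m -> g w = h w by exact: H.
elim: m => [|m IH] mn w; first by rewrite inE => /eqP ->; rewrite !linear0.
move=> /flagS[a [u [hu ->]]]; rewrite !linearP /= e //.
by rewrite IH // ltnW.
Qed.

(** Stabilizing the flag and acting trivially on its graded pieces. *)
Definition flag_pred (g : 'End(V)) : Prop :=
  forall i, (i < n)%N -> g (x i) - x i \in flag x i.

Lemma flag_pred_sub g i v : flag_pred g -> (i < n)%N -> v \in flag x i.+1 ->
  g v - v \in flag x i.
Proof.
move=> hg; elim: i v => [|i IH] v im /flagS[a [u [hu ->]]].
  move: hu; rewrite inE => /eqP ->; rewrite addr0 linearZ -scalerBr.
  by apply: flagZ; exact: hg.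
have -> : g (a *: x i.+1 + u) - (a *: x i.+1 + u) = a *: (g (x i.+1) - x i.+1) + (g u - u).
  by rewrite linearP opprD addrACA scalerBr.
apply: flag_lin; first exact: hg.
by apply: (flag_sub (i := i)) => //; apply: IH => //; exact: ltnW.
Qed.

Lemma flag_pred_stable g i v : flag_pred g -> (i <= n)%N -> v \in flag x i ->
  g v \in flag x i.
Proof.
case: i => [|i] hg im hv; first by move: hv; rewrite !inE => /eqP ->; rewrite linear0.
rewrite -[g v](subrK v) -[_ - v]scale1r; apply: flag_lin => //.
by apply: (flag_sub (leqnSn i)); exact: flag_pred_sub.
Qed.

Lemma flag_pred_ker g : flag_pred g -> lker g == 0%VS.
Proof.
move=> hg; apply/eqP/eqP; rewrite -subv0; apply/subvP => v; rewrite memv_ker memv0 => /eqP gv.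
have := flag_full v.
suff H m : (m <= n)%N -> v \in flag x m -> v == 0 by exact: H.
elim: m => [|m IH] mn; first by rewrite inE.
move=> /(flag_pred_sub hg mn); rewrite gv sub0r => hv; apply: IH; first exact: ltnW.
by rewrite -[v]opprK -scaleN1r; exact: flagZ.
Qed.

Lemma flag_pred_unipotent g : flag_pred g -> unipotent g.
Proof.
move=> hg; exists n; apply/lfunP => v; rewrite lfunE /=.
suff H k : (k <= n)%N -> iter k (fun h => (g - \1) \o h)%VF \1%VF v \in flag x (n - k).
  by have := H n (leqnn n); rewrite subnn inE => /eqP.
elim: k => [|k IH] kn; first by rewrite subn0 flag_full.
rewrite iterS comp_lfunE add_lfunE opp_lfunE id_lfunE.
have e : (n - k = (n - k.+1).+1)%N by lia.
by apply: flag_pred_sub => //; [lia|rewrite -e; apply/IH/ltnW].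
Qed.

Lemma flag_pred1 : flag_pred \1%VF.
Proof. by move=> i _; rewrite id_lfunE subrr flag0. Qed.

Lemma flag_pred_mul g h : flag_pred g -> flag_pred h -> flag_pred (g \o h)%VF.
Proof.
move=> hg hh i im; rewrite comp_lfunE.
have -> : g (h (x i)) - x i = 1 *: g (h (x i) - x i) + (g (x i) - x i).
  by rewrite scale1r linearB addrA subrK.
apply: flag_lin; last exact: hg.
by apply: flag_pred_stable => //; [exact: ltnW|exact: hh].
Qed.

Lemma flag_pred_inv g : flag_pred g -> flag_pred g^-1%VF.
Proof.
move=> hg; have kg := flag_pred_ker hg.
have st i : (i <= n)%N -> forall v, v \in flag x i -> g^-1%VF v \in flag x i.
  elim: i => [|i IH] im v; first by rewrite !inE => /eqP ->; rewrite linear0.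
  move=> hv; have h : v - g^-1%VF v \in flag x i.
    have := IH (ltnW im) _ (flag_pred_sub hg im (v := v) hv).
    by rewrite linearB /= lker0_lfunK.
  have -> : g^-1%VF v = (-1) *: (v - g^-1%VF v) + v.
    by rewrite scaleN1r opprB subrK.
  by apply: flag_lin => //; exact: flag_sub (leqnSn i) h.
move=> i im; have := st i (ltnW im) _ (hg i im).
rewrite linearB /= lker0_lfunK // => h.
by rewrite -opprB -scaleN1r; exact: flagZ.
Qed.

Definition flag_group : autSubgroup V :=
  @AutSubgroup _ _ flag_pred flag_pred_ker flag_pred1 flag_pred_mul flag_pred_inv.

(** The x_i form a basis, so an element of the group is a choice of w_i in V_i
    for every i. *)
Lemma flag_pred_enum : exists gs : 'I_(\prod_(i < n) q ^ i) -> 'End(V),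
  [/\ injective gs, forall j, flag_pred (gs j) &
      forall g, flag_pred g -> exists j, gs j = g].
Proof.
pose T := fprod (fun i : 'I_n => 'I_(q ^ i)).
pose X := [tuple x i | i < n].
have Xi (i : 'I_n) : X`_i = x i by rewrite -tnth_nth tnth_mktuple.
have Xb : basis_of {:V} X.
  rewrite basisEdim size_tuple leqnn andbT; apply/subvP => v _; have := flag_full v.
  suff H m : (m <= n)%N -> forall w, w \in flag x m -> w \in <<X>>%VS by exact: H.
  elim: m => [|m IH] mn w; first by rewrite inE => /eqP ->; exact: mem0v.
  move=> /flagS[a [u [hu ->]]]; apply: memvD; last by apply: IH => //; exact: ltnW.
  apply/memvZ/memv_span; rewrite -(Xi (Ordinal mn)); apply: mem_nth.
  by rewrite size_tuple.
pose G (c : T) : 'End(V) := hommx X X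
  (\matrix_(i < n) rVof X (x i + (flag x i)`_(c i))).
have GE c (i : 'I_n) : G c (x i) = x i + (flag x i)`_(c i).
  rewrite /G hommxE // -{1}Xi rVofE // -rowE rowK.
  exact: rVofK.
have GP c : flag_pred (G c).
  move=> i im; rewrite (GE c (Ordinal im)) addrC addKr; apply: mem_nth.
  by rewrite size_flag /=; exact: ltn_ord.
have GI : injective G.
  move=> c c' e; apply/fprodP => i; apply: val_inj => /=.
  have := congr1 (fun g : 'End(V) => g (x i)) e; rewrite /= !GE => /addrI /eqP.
  rewrite nth_uniq ?size_flag ?ltn_ord // => [/eqP //|].
  exact: (flag_uniq x_free (ltnW (ltn_ord i))).
clearbody G.
have GS g : flag_pred g -> exists c, G c = g.
  move=> hg; have lt (i : 'I_n) : (index (g (x i) - x i)%R (flag x i) < q ^ i)%N.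
    by rewrite -(size_flag x) index_mem; exact: hg.
  pose c : T := [fprod i : 'I_n => Ordinal (lt i)].
  exists c; apply: flag_eq => i im; rewrite (GE c (Ordinal im)).
  have -> : c (Ordinal im) = index (g (x i) - x i)%R (flag x i) :> nat.
    by rewrite fprodE.
  have hi := hg i im.
  rewrite (nth_index _ hi).
  by rewrite addrC subrK.
have cT : #|T| = (\prod_(i < n) q ^ i)%N.
  by rewrite card_fprod; apply: eq_bigr => i _; rewrite card_ord.
rewrite -cT; exists (G \o enum_val); split.
- by move=> i j /= /GI /enum_val_inj.
- by move=> j; exact: GP.
- by move=> g /GS[c <-]; exists (enum_rank c); rewrite /= enum_rankK.
Qed.

End FlagGroup.

(** The flag is built from below: x_m is chosen outside of V_m such that its class
    modulo V_m is fixed by U.  Subspaces become row spaces of matrices, so that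
    the fixed vector comes from a representation. *)
Lemma unipotent_flag (U : autSubgroup V) :
  (forall g, aut_set U g -> unipotent g) ->
  exists x : nat -> V, (forall i, (i < n)%N -> x i \notin flag x i) /\
    forall g, aut_set U g -> flag_pred x g.
Proof.
move=> uniU; suff H m : (m <= n)%N -> exists x : nat -> V,
    (forall i, (i < m)%N -> x i \notin flag x i) /\
    forall g, aut_set U g -> forall i, (i < m)%N -> g (x i) - x i \in flag x i.
  by have [x [h1 h2]] := H n (leqnn n); exists x.
elim: m => [|m IH] mn; first by exists (fun _ => 0).
have [x [xf xU]] := IH (ltnW mn).
pose P : set 'M[F]_n := [set M | exists2 g, aut_set U g & M = mxof vb vb g].
pose W : 'M[F]_n := \matrix_(i < n) rVof vb (if (i < m)%N then x i else 0).
have in_W v : (rVof vb v <= W)%MS <-> v \in flag x m.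
  split=> [/submxP[D eD]|].
    rewrite -(rVofK vbP v) eD mulmx_sum_row linear_sum.
    apply: (big_ind (fun w => w \in flag x m)); first exact: flag0.
      by move=> u w hu hw; rewrite -[u]scale1r; exact: flag_lin.
    move=> i _; rewrite linearZ /= rowK rVofK //; apply: flagZ.
    by case: ifP => im; [exact: flag_x|exact: flag0].
  suff H k : (k <= m)%N -> forall w, w \in flag x k -> (rVof vb w <= W)%MS.
    exact: H.
  elim: k => [|k IHk] km w; first by rewrite inE => /eqP ->; rewrite linear0 sub0mx.
  move=> /flagS[a [u [hu ->]]]; rewrite linearP /= addmx_sub //; last by apply: IHk => //; exact: ltnW.
  apply: scalemx_sub; have kn : (k < n)%N := leq_trans km (ltnW mn).
  have -> : rVof vb (x k) = row (Ordinal kn) W by rewrite rowK /= km.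
  exact: row_sub.
have mxE' g v : rVof vb v *m mxof vb vb g = rVof vb (g v).
  by rewrite (rVof_app _ vbP).
have P1 : P 1%:M.
  by exists \1%VF; [exact: aut_one|rewrite mxof1 // (basis_free vbP)].
have PM M N : P M -> P N -> P (M *m N).
  move=> [g Ug ->] [h Uh ->]; exists (h \o g)%VF; first exact: aut_mul.
  by rewrite (mxof_comp _ _ vbP).
have Pu M : P M -> M \in unitmx.
  move=> [g Ug ->]; have kg := aut_ker Ug.
  suff e : mxof vb vb g *m mxof vb vb g^-1%VF = 1%:M by case/mulmx1_unit: e.
  rewrite -(mxof_comp _ _ vbP) // lker0_compVf //.
  by rewrite mxof1 // (basis_free vbP).
have Puni M : P M -> exists k, iter k (fun h => h *m (M - 1%:M)) 1%:M = 0.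
  move=> [g Ug ->]; have [k hk] := uniU g Ug; exists k.
  have one : mxof vb vb \1%VF = 1%:M by rewrite mxof1 // (basis_free vbP).
  rewrite -(linear0 (mxof vb vb)) -hk.
  elim: (k) => [|k' IHk] /=; first by rewrite one.
  rewrite IHk (mxof_comp _ _ vbP) //; congr (_ *m _).
  by rewrite linearB /= one.
have PW M : P M -> (W *m M <= W)%MS.
  move=> [g Ug ->]; apply/row_subP => i; rewrite row_mul rowK mxE'; apply/in_W.
  case: ifP => im; last by rewrite linear0 flag0.
  rewrite -[g _](subrK (x i)) -[_ - _]scale1r; apply: flag_lin; last exact: flag_x.
  by apply: (flag_sub (ltnW im)); exact: xU.
have nfW : ~~ row_full W.
  apply/negP => /row_fullP[B BW]; have q1 := card_finNzRing_gt1 F.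
  have all_in v : v \in flag x m.
    by apply/in_W; rewrite -[rVof vb v]mulmx1 -BW mulmxA submxMl.
  have : (size (enum {: 'rV[F]_n}) <= size [seq rVof vb v | v <- flag x m])%N.
    apply: uniq_leq_size (enum_uniq _) _ => u _.
    by rewrite -(vecofK vbP u); apply: map_f.
  by rewrite size_map size_flag -cardE card_mx mul1n leq_exp2l // leqNgt mn.
have [v [nv hv]] := kolchin_step P1 PM Pu Puni PW nfW.
pose w := vecof vb v.
have rw : rVof vb w = v by exact: vecofK.
pose x' i := if (i < m)%N then x i else w.
have fe i : (i <= m)%N -> flag x' i = flag x i.
  by move=> im; apply: flag_ext => j ji; rewrite /x' (leq_trans ji im).
exists x'; split=> [i|g Ug i]; rewrite ltnS => im; rewrite fe // /x'.
  move: im; rewrite leq_eqVlt => /orP[/eqP ->|im]; last by rewrite im; exact: xf.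
  by rewrite ltnn; apply/negP => /in_W; rewrite rw (negPf nv).
move: im; rewrite leq_eqVlt => /orP[/eqP ->|im]; last by rewrite im; exact: xU.
rewrite ltnn; apply/in_W; rewrite linearB /= -mxE' rw.
by apply: hv; exists g.
Qed.

(** The whole group attached to the flag is unipotent, so U cannot be smaller. *)
Lemma maximal_unipotent_flag (U : autSubgroup V) : maximal_unipotent U ->
  exists x : nat -> V, (forall i, (i < n)%N -> x i \notin flag x i) /\
    forall g, aut_set U g <-> flag_pred x g.
Proof.
move=> [uniU maxU]; have [x [xf xU]] := unipotent_flag uniU.
exists x; split=> // g; rewrite -(maxU (flag_group xf)) //.
by move=> h; exact: flag_pred_unipotent.
Qed.

(** The number of automorphisms listed matches the rank in spans_sym_GL and
    spans_recip_GL. *)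
Lemma GL_enum : (0 < n)%N -> exists gs : 'I_(q ^ 'C(n, 2) *
    \prod_(1 <= i < n.+1) (q ^ i - 1)) -> 'End(V),
  injective gs /\ forall j, lker (gs j) == 0%VS.
Proof.
move=> n0; have [f [f_inj fu]] : exists f : 'I_(q ^ 'C(n, 2) *
    \prod_(1 <= i < n.+1) (q ^ i - 1)) -> 'M[F]_n,
    injective f /\ forall j, f j \in unitmx.
  move: (n) n0 => [//|k] k0; rewrite -(card_GL F k0) cardsT.
  exists (fun j => val (enum_val j : {'GL_k.+1[F]})); split.
    by move=> i j /val_inj /enum_val_inj.
  by move=> j; exact: (valP (enum_val j : {'GL_k.+1[F]})).
exists (hommx vb vb \o f); split.
  by move=> i j /= /(can_inj (hommxK vbP vbP)) /f_inj.
move=> j /=; apply/lker0P => u v; rewrite !hommxE //.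
by move=> /(can_inj (vecofK vbP)) /(can_inj (mulmxK (fu j))) /(can_inj (rVofK vbP)).
Qed.

End Flags.

(** * Invariants of finite linear groups *)

Section ActedAlgebra.
Context {F : finFieldType} {V : vectType F}.
Local Notation n := (\dim {:V}).
Local Notation K := (polyFrac F n).
Local Notation kc := (polyConst F n).
Local Notation ev := (peval (inj := kc)).

(** What the symmetric algebra and the algebra of reciprocals have in common:
    both are stable under linear automorphisms, which are determined by their
    action, and both contain n algebraically independent elements of degree 1,
    which bounds their growth from below. *)
Record acted (A : gradedAlgebra kc) (X : set K) : Prop := Acted {
  acted_stable : forall (g : 'End(V)) m x, lker g == 0%VS -> A m x -> A m (act g x);
  acted_dist : forall g h : 'End(V), lker g == 0%VS -> lker h == 0%VS -> g != h ->
    exists2 x, (\bigcup_m A m) x & act g x != act h x;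
  acted_growth : exists2 y : 'I_n -> K, forall i, A 1%N (y i) &
    injective (ev y);
  acted_gen : forall m x, A m x -> X x }.

Lemma sym_acted : acted (symAlg V) (gen kc (range linform)).
Proof.
split; [exact: sym_act|exact: sym_dist| |exact: sym_gen].
exists (fun i : 'I_n => linform (vbasis {:V})`_i); last exact: sym_growth.
by move=> i; exact: sym_linform.
Qed.

Lemma rec_acted :
  acted (recAlg V) (gen kc [set (linform v)^-1 | v in [set v : V | v != 0]]).
Proof.
split; [exact: rec_act|exact: rec_dist| |exact: rec_gen].
exists (fun i : 'I_n => (linform (vbasis {:V})`_i)^-1); last exact: rec_growth.
move=> i; apply: rec_linform; have vi : (vbasis {:V})`_i \in (vbasis {:V} : seq V).
  by rewrite mem_nth ?size_tuple.
exact: free_not0 (basis_free (vbasisP {:V})) vi.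
Qed.

Section Invariants.
Variables (A : gradedAlgebra kc) (X : set K) (hA : acted A X).
Variables (b : 'I_n -> K) (d : 'I_n -> nat).
Hypotheses (Ab : forall i, A (d i) (b i)) (d_gt0 : forall i, (0 < d i)%N).
(** N automorphisms fixing the b_i match the N elements that span A over the
    polynomials in the b_i. *)
Variables (N : nat) (gs : 'I_N -> 'End(V)).
Hypotheses (gs_inj : injective gs) (gs_ker : forall j, lker (gs j) == 0%VS).
Hypothesis gs_b : forall j i, act (gs j) (b i) = b i.
Hypothesis spanX : spans A (range (ev b)) N X.

Let gs_dist i j : i != j ->
  exists2 x, (\bigcup_m A m) x & act (gs i) x != act (gs j) x.
Proof. by move=> nij; apply: (acted_dist hA) => //; rewrite (inj_eq gs_inj). Qed.

Let spanA : exists (e : 'I_N -> K) (eps : 'I_N -> nat) (i0 : 'I_N),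
  [/\ e i0 = 1 /\ eps i0 = 0%N, forall i, A (eps i) (e i) &
      forall m x, A m x -> exists2 c : 'I_N -> K,
        forall i, range (ev b) (c i) & x = \sum_i c i * e i].
Proof.
have [e [eps [i0 [h1 h2 h3]]]] := spans_ord spanX.
by exists e, eps, i0; split=> // m x /(acted_gen hA)/h3.
Qed.

Lemma acted_poly_free : injective (ev b).
Proof.
have [e [eps [i0 [[_ h0] h2 h3]]]] := spanA; have [y Ay y_inj] := acted_growth hA.
exact: (peval_inj Ab d_gt0 h0 h2 h3 Ay y_inj).
Qed.

Lemma acted_invariant_poly m x : A m x -> (forall j, act (gs j) x = x) ->
  exists2 p, p \is ishomog1 m (wdeg d) & x = ev b p.
Proof.
have [e [eps [i0 [[h1 h0] h2 h3]]]] := spanA.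
apply: (invariant_poly Ab h1 h0 h2 h3 (sigma := fun j => act (gs j))) => //.
- by move=> j; exact: act1.
- by move=> j; exact: act_zmod.
- by move=> j; exact: act_mul.
- by move=> j; exact: act_kc.
Qed.

Section Quotient.
Variable H : autSubgroup V.
Hypotheses (gs_H : forall j, aut_set H (gs j))
  (H_b : forall g, aut_set H g -> forall i, act g (b i) = b i).

Lemma acted_quotient : isomorphic (Proj (invariants A H)) (weighted_proj_space F d).
Proof.
apply: (poly_proj_isomorphic (b := b)); first exact: acted_poly_free.
- by move=> i; split=> // g Hg; exact: H_b.
- by move=> m x [Ax hx]; apply: acted_invariant_poly => // j; exact: hx.
Qed.

Hypotheses (d1 : forall i, d i = 1%N) (gs_onto : forall g, aut_set H g -> exists j, gs j = g).

(** When the polynomial generators have degree 1, one of them is nonzero at any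
    given point of the quotient, where it gives an affine neighbourhood. *)
Lemma invariants_degree1 (y : projPoint (invariants A H)) :
  exists2 g, invariants A H 1%N g & ~ pt_set y g.
Proof.
apply: contrapT => hy; have [m [a [m0 Ba na]]] := pt_relevant y; apply: na.
have Bb i : invariants A H 1%N (b i) by split=> [|g Hg]; [rewrite -(d1 i)|exact: H_b].
have yb i : pt_set y (b i).
  by apply: contrapT => nb; apply: hy; exists (b i).
have [Aa fa] := Ba.
have [|p /dhomogP hp ->] := acted_invariant_poly Aa; first by move=> j; exact: fa.
rewrite [p]mpolyE rmorph_sum big_seq_cond.
apply: (big_ind (pt_set y)) => [|u v yu yv|l /andP[lp _]].
- exact: pt_zero.
- by rewrite -[v]opprK -[- v]sub0r; apply: pt_sub => //; apply: pt_sub => //; exact: pt_zero.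
have [i li] : exists i, (0 < l i)%N.
  apply: contrapT => h; have := hp _ lp; rewrite /= /wdeg big1 => [|i _].
    by move=> m1; rewrite -m1 in m0.
  by case: (posnP (l i)) => [->//|li]; case: h; exists i.
rewrite /= pevalZ peval_mon (bigD1 i) //= -(prednK li) exprSr.
set w := \prod_(j < n | _) _.
have [t Bw] : exists t, invariants A H t w.
  exists (\sum_(j < n | j != i) l j)%N.
  apply: (big_rec2 (fun t u => invariants A H t u)); first exact: comp_one.
  by move=> j t u _ Bu; apply: comp_mul => //; exact: comp_exp1.
have Bt := comp_mul (comp_scal (invariants A H) p@_l)
  (comp_mul (comp_exp1 (Bb i) (l i).-1) Bw).
by rewrite mulrAC mulrA; apply: pt_mul => //; exact: comp_total Bt.
Qed.

Lemma acted_quotient_map : exists pi : morphism (Proj A) (Proj (invariants A H)),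
  [/\ induced_by_inclusion pi, finite_morphism pi, flat pi & has_degree pi N].
Proof.
have [e [eps [i0 [[e0 eps0] Ae sA]]]] := spanA.
have [c1 gs1] := gs_onto (@aut_one _ _ H).
pose sigma (j : 'I_N) := act (gs j).
have sB j : zmod_morphism (sigma j) by exact: act_zmod.
have sM j x y : sigma j (x * y) = sigma j x * sigma j y by exact: act_mul.
have sA' j m x : A m x -> A m (sigma j x) by exact: (acted_stable hA).
have s1 x : sigma c1 x = x by rewrite /sigma gs1 act_id.
have sP j0 : exists2 t : 'I_N -> 'I_N,
    injective t & forall j x, sigma j0 (sigma j x) = sigma (t j) x.
  have /choice [t ht] : forall j, exists i, gs i = (gs j0 \o gs j)%VF.
    by move=> j; apply: gs_onto; apply: aut_mul.
  exists t => [i j tij|j x]; last by rewrite /sigma ht; apply: act_comp.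
  apply: gs_inj; have := ht i; rewrite tij ht => /(congr1 (comp_lfun (gs j0)^-1)).
  by rewrite !comp_lfunA lker0_compVf // !comp_lfun1l.
have BE m x : invariants A H m x <-> A m x /\ forall j, sigma j x = x.
  split=> [[Ax hx]|[Ax hx]]; split=> //.
    by move=> j; exact: hx.
  move=> g Hg; have [j <-] := gs_onto Hg; exact: hx.
have Bb i : invariants A H (d i) (b i) by split=> // g Hg; exact: H_b.
have sAg m x : A m x -> exists2 c : 'I_N -> K,
    (forall j, if (eps j <= m)%N then invariants A H (m - eps j)%N (c j) else c j = 0) &
    x = \sum_(j < N) c j * e j.
  move=> /(graded_span Ab Ae sA) [p hp ->].
  exists (fun j => ev b (p j)) => // j; have := hp j.
  by case: ifP => _; [exact: peval_homog|move=> ->; rewrite rmorph0].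
have fr c : (forall j i, sigma i (c j) = c j) -> \sum_(j < N) c j * e j = 0 ->
    forall j, c j = 0.
  apply: (span_coef_free sA (sigma := sigma)) => // j; [exact: act1|exact: act_kc].
exists (quot_map BE Ae sAg); split.
- exact: quot_map_induced.
- exact: (quot_finite sB sM sA' s1 sP BE Ae sAg fr invariants_degree1).
- exact: (quot_flat sM fr invariants_degree1).
- exact: (quot_degree sB sM sA' s1 sP BE Ae sAg fr invariants_degree1).
Qed.

End Quotient.
End Invariants.
End ActedAlgebra.

(** * The special linear group *)

Section SpecialLinear.
Context {F : finFieldType} {V : vectType F}.
Local Notation n := (\dim {:V}).
Local Notation K := (polyFrac F n).
Local Notation kc := (polyConst F n).
Local Notation ev := (peval (inj := kc)).
Local Notation q := #|F|.
Local Notation vb := (vbasis {:V}).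
Let vbP : basis_of {:V} vb := vbasisP {:V}.

Lemma lker_hommx (M : 'M[F]_n) : M \in unitmx -> lker (hommx vb vb M) == 0%VS.
Proof.
move=> uM; apply/lker0P => u v; rewrite !hommxE //.
move=> /(can_inj (vecofK vbP)) /(can_inj (mulmxK uM)).
exact: (can_inj (rVofK vbP)).
Qed.

Lemma det_surj (a : F) : (0 < n)%N -> a != 0 ->
  exists2 g : 'End(V), lker g == 0%VS & det g = a.
Proof.
move=> n0 a0; pose i0 : 'I_n := Ordinal n0.
pose M : 'M[F]_n := diag_mx (\row_i (if i == i0 then a else 1)).
have dM : \det M = a.
  rewrite det_diag (bigD1 i0) //= mxE eqxx big1 ?mulr1 // => i ni.
  by rewrite mxE (negPf ni).
exists (hommx vb vb M); first by rewrite lker_hommx // unitmxE dM unitfE.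
by rewrite /det hommxK.
Qed.

Lemma det_neq0 (g : 'End(V)) : lker g == 0%VS -> det g != 0.
Proof.
move=> kg; apply/eqP => g0; have := det_comp (g^-1)%VF g.
rewrite lker0_compVf // det_one g0 mulr0 => /eqP.
by rewrite oner_eq0.
Qed.

(** The Moore matrix of a family of vectors is the matrix of its coordinates
    times the Moore matrix of the basis, as scalars are fixed by Frobenius. *)
Lemma moore_matrix_coord (u : 'I_n -> V) :
  \matrix_(i < n, j < n) linform (u i) ^+ (q ^ j) =
  map_mx kc (\matrix_i rVof vb (u i)) *m \matrix_(i < n, j < n) linform vb`_i ^+ (q ^ j).
Proof.
apply/matrixP => i j; rewrite !mxE.
have -> : linform (u i) = \sum_k kc (coord vb k (u i)) * linform vb`_k.
  rewrite {1}(coord_basis vbP (memvf (u i))).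
  have l0 : linform (0 : V) = 0 by rewrite /linform linear0 rmorph0.
  rewrite (big_morph _ (@linformD F V) l0).
  by apply: eq_bigr => k _; rewrite linformZ.
have f0 : (0 : K) ^+ (q ^ j) = 0.
  by rewrite expr0n expn_eq0 eqn0Ngt (ltnW (card_finNzRing_gt1 F)).
rewrite (big_morph (fun z => z ^+ (q ^ j)) (fun x y => frobeniusD kc x y j) f0).
by apply: eq_bigr => k _; rewrite exprMn frobenius_inj !mxE.
Qed.

(** An automorphism multiplies the matrix of coordinates by its own matrix. *)
Lemma act_moore_det (g : 'End(V)) (u : 'I_n -> V) : lker g == 0%VS ->
  act g (\det (\matrix_(i < n, j < n) linform (u i) ^+ (q ^ j))) =
  kc (det g) * \det (\matrix_(i < n, j < n) linform (u i) ^+ (q ^ j)).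
Proof.
move=> kg; have [s hs] := act_rmorphism kg.
have e : act g (\det (\matrix_(i < n, j < n) linform (u i) ^+ (q ^ j))) =
    \det (\matrix_(i < n, j < n) linform (g (u i)) ^+ (q ^ j)).
  rewrite -hs -det_map_mx; congr (\det _); apply/matrixP => i j.
  by rewrite !mxE rmorphXn /= hs act_linform.
rewrite e (moore_matrix_coord u) (moore_matrix_coord (g \o u)) !det_mulmx !det_map_mx mulrA -rmorphM.
congr (kc _ * _).
have -> : \matrix_i rVof vb (g (u i)) = (\matrix_i rVof vb (u i)) *m mxof vb vb g.
  by apply/row_matrixP => i; rewrite row_mul !rowK (rVof_app _ vbP).
by rewrite det_mulmx mulrC.
Qed.

Section Quotient.
Variables (A : gradedAlgebra kc) (X : set K) (hA : acted A X).
Variables (b : 'I_n -> K) (d : 'I_n -> nat).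
Hypotheses (Ab : forall i, A (d i) (b i)) (d_gt0 : forall i, (0 < d i)%N).
Hypothesis GL_b : forall g : 'End(V), lker g == 0%VS -> forall i, act g (b i) = b i.
Variables (N : nat) (gs : 'I_N -> 'End(V)).
Hypotheses (gs_inj : injective gs) (gs_ker : forall j, lker (gs j) == 0%VS).
Hypothesis spanX : spans A (range (ev b)) N X.
Variables (psi : F -> F) (i1 : 'I_n) (l : K) (dl : nat) (c : F).
Hypotheses (psiM : forall x y, psi (x * y) = psi x * psi y) (psiK : involutive psi)
  (psi0 : psi 0 = 0).
Hypotheses (l_neq0 : l != 0) (c_neq0 : c != 0) (Al : A dl l) (dl_gt0 : (0 < dl)%N)
  (act_l : forall g : 'End(V), lker g == 0%VS -> act g l = kc (psi (det g)) * l)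
  (lX : l ^+ (q - 1) = kc c * b i1).

Let b' i := if i == i1 then l else b i.
Let d' i := if i == i1 then dl else d i.

(** For psi the identity or the inverse, l is a semi-invariant of the general
    linear group of weight det or its inverse: with b i1 replaced by l, the
    polynomial generators for the general linear group become generators for
    the special linear group. *)
Lemma acted_SL_quotient :
  isomorphic (Proj (invariants A (SL_V V))) (weighted_proj_space F d').
Proof.
have b_inj := acted_poly_free hA Ab d_gt0 spanX.
have n0 : (0 < n)%N by case: (n) (i1) => [[]|].
have psi_neq0 x : x != 0 -> psi x != 0.
  by apply: contra => /eqP e; rewrite -(psiK x) e psi0.
pose T := {g : 'End(V) | lker g == 0%VS}.
pose mulT (g h : T) : T := exist _ (sval g \o sval h)%VF (lker_comp (svalP g) (svalP h)).
have gs_b j i : act (gs j) (b i) = b i by exact: GL_b.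
pose sigma (g : T) := act (sval g); pose chi (g : T) := psi (det (sval g)).
have sB g : zmod_morphism (sigma g) by exact: act_zmod (svalP g).
have sM g x y : sigma g (x * y) = sigma g x * sigma g y by exact: act_mul (svalP g) x y.
have sI g e : sigma g (kc e) = kc e by exact: act_kc (svalP g) e.
have sC g h x : sigma g (sigma h x) = sigma (mulT g h) x.
  exact: act_comp x (svalP h) (svalP g).
have sA g m x : A m x -> A m (sigma g x) by exact: (acted_stable hA) (svalP g).
have chi0 g : chi g != 0 by exact: psi_neq0 (det_neq0 (svalP g)).
have chiM g h : chi (mulT g h) = chi g * chi h by rewrite /chi /= det_comp psiM.
have chiS a : a != 0 -> exists g, chi g = a.
  move=> a0; have [g kg dg] := det_surj n0 (psi_neq0 _ a0).
  by exists (exist _ g kg); rewrite /chi /= dg psiK.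
have sl g : sigma g l = kc (chi g) * l by exact: act_l (svalP g).
have fix_poly m x : A m x -> (forall g, sigma g x = x) ->
    exists p, x = ev b p.
  move=> Ax fx; have [|p _ ->] := acted_invariant_poly hA Ab gs_inj gs_ker gs_b spanX Ax.
    by move=> j; exact: (fx (exist _ (gs j) (gs_ker j))).
  by exists p.
have semi m s : invariants A (SL_V V) m s -> range (ev b') s.
  move=> [As hs].
  apply: (semi_invariants sB sM sI sC sA chi0 chiM chiS b_inj l_neq0 c_neq0 Al sl lX
    fix_poly As) => -[g kg] [h kh]; rewrite /chi /sigma /= => /(can_inj psiK) dgh.
  (* g and h differ by an element of determinant 1, which fixes s. *)
  pose t := (h^-1 \o g)%VF.
  have kt : lker t == 0%VS by rewrite lker_comp // lker_inv.
  have SLt : aut_set (SL_V V) t.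
    split=> //; rewrite /t det_comp dgh -det_comp lker0_compVf //; exact: det_one.
  have -> : g = (h \o t)%VF by rewrite /t comp_lfunA lker0_compfV // comp_lfun1l.
  by rewrite -[LHS](act_comp _ kt kh) (hs _ SLt).
have Ab' i : A (d' i) (b' i) by rewrite /d' /b'; case: eqP.
have Bb' i : invariants A (SL_V V) (d' i) (b' i).
  split=> // g [kg dg]; rewrite /b'; case: eqP => _; last exact: GL_b.
  have psi1 : psi 1 = 1 by have := psiM 1 (psi 1); rewrite mul1r psiK mulr1.
  by rewrite act_l // dg psi1 rmorph1 mul1r.
have sub_b p : range (ev b') (ev b p).
  have hB' := range_peval_subring kc b'.
  apply: peval_subring => // i; have [->|ni] := eqVneq i i1.
    have -> : b i1 = kc c^-1 * l ^+ (q - 1) by rewrite lX mulrA -rmorphM mulVf // rmorph1 mul1r.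
    apply: (subringM hB'); first by case: hB'.
    by apply: (subringX hB'); exists 'X_i1 => //; rewrite peval_var /b' eqxx.
  by exists 'X_i => //; rewrite peval_var /b' (negPf ni).
have b'_inj : injective (ev b').
  have [e [eps [i0 [[_ h0] h2 h3]]]] := spans_ord spanX.
  have [y Ay y_inj] := acted_growth hA.
  have d'_gt0 i : (0 < d' i)%N by rewrite /d'; case: eqP.
  apply: (peval_inj Ab' d'_gt0 h0 h2 _ Ay y_inj) => m x /(acted_gen hA)/h3[co hc ->].
  by exists co => // i; have [p _ <-] := hc i.
apply: (poly_proj_isomorphic b'_inj Bb') => m x Bx.
(* The polynomial representing x can be chosen homogeneous: apply the statement
   on components to the invariants, which are spanned by 1. *)
have [||p hp ->] := @graded_span _ _ _ (invariants A (SL_V V)) n b' d' Bb' 1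
    (fun=> 1) (fun=> 0%N) _ _ m x Bx.
- by move=> _; exact: comp_one.
- move=> t z Bz; exists (fun=> z); last by rewrite big_ord1 mulr1.
  by move=> _; exact: semi Bz.
- exists (p ord0); last by rewrite big_ord1 mulr1.
  by have := hp ord0; rewrite /= subn0.
Qed.

End Quotient.
End SpecialLinear.

(** * The quotients *)

Section Counting.
Implicit Types q n : nat.

Lemma prod_expn q n : (\prod_(i < n) q ^ i = q ^ 'C(n, 2))%N.
Proof. by rewrite -expn_sum -bin2_sum big_mkord. Qed.

(** The order in which the g_i are adjoined against that of the order formula
    for the general linear group. *)
Lemma prod_rev q n : (\prod_(k < n) (q ^ (n - k) - 1) = \prod_(1 <= i < n.+1) (q ^ i - 1))%N.
Proof.
rewrite big_add1 big_mkord (reindex_inj rev_ord_inj) /=.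
by apply: eq_bigr => k _; rewrite subKn.
Qed.

Lemma prod_gaussian q n : (0 < q)%N -> (\prod_(i < n) (q ^ n - q ^ i) =
  q ^ 'C(n, 2) * \prod_(1 <= i < n.+1) (q ^ i - 1))%N.
Proof.
move=> q0; rewrite -prod_rev -prod_expn -big_split /=; apply: eq_bigr => i _.
by rewrite mulnBr muln1 -expnD subnKC // ltnW.
Qed.

Lemma sum_expn q n : (1 < q)%N -> (\sum_(i < n) q ^ i = (q ^ n - 1) %/ (q - 1))%N.
Proof.
by move=> q1; rewrite !subn1 predn_exp mulKn // -subn1 subn_gt0.
Qed.

End Counting.

Section FlagQuotients.
Context {F : finFieldType} {V : vectType F}.
Local Notation n := (\dim {:V}).
Local Notation K := (polyFrac F n).
Local Notation kc := (polyConst F n).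
Local Notation q := #|F|.
Variable x : nat -> V.
Hypothesis x_free : forall i, (i < n)%N -> x i \notin flag x i.

Let lD := @linformD F V.
Let lZ := @linformZ F V.
Let l0 := @linform_eq0 F V.
Let full := flag_full x_free.
Let q1 : (1 < q)%N := card_finNzRing_gt1 F.
Let g := gx linform x.
Let f := fx linform x.
Let dc := dcoef linform x n.
Let cc := ccoef linform x n.

Let spanQ := spans_recip_unipotent lD lZ l0
  x_free full (@rec_linform F V).
Let spanP := spans_sym_unipotent lD lZ l0
  x_free full (@sym_linform F V).
Let spanQG := spans_recip_GL lD lZ l0
  x_free full (@rec_linform F V).
Let spanPG := spans_sym_GL lD lZ l0
  x_free full (@sym_linform F V).

Let act_flag (h : 'End(V)) i : flag_pred x h -> (i < n)%N ->
  act h (g i) = g i /\ act h (f i) = f i.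
Proof.
move=> hh im; have kh := flag_pred_ker x_free hh; have [s hs] := act_rmorphism kh.
have si v : s (linform v) = linform (h v) by rewrite hs act_linform.
rewrite -!hs; split.
  exact: (gx_act lD lZ si hh im).
exact: (fx_act lD lZ si hh im).
Qed.

Let act_GL (h : 'End(V)) j : lker h == 0%VS -> act h (dc j) = dc j /\ act h (cc j) = cc j.
Proof.
move=> kh; have [s hs] := act_rmorphism kh.
have si v : s (linform v) = linform (h v) by rewrite hs act_linform.
have sd k : s (dc k) = dc k.
  apply: (dcoef_act lD lZ l0 x_free full si).
  by move=> v; exists (h^-1%VF v); rewrite lker0_lfunVK.
by rewrite -!hs; split; rewrite // /cc /ccoef fmorph_div /= !sd.
Qed.

Section Unipotent.
Variable U : autSubgroup V.
Hypothesis UE : forall h, aut_set U h <-> flag_pred x h.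

Lemma unipotent_quotients :
  (isomorphic (Q_quot U) (proj_space F n) /\
   exists pi : morphism (Q_space V) (Q_quot U),
     [/\ induced_by_inclusion pi, finite_morphism pi, flat pi &
         has_degree pi (q ^ ((n * (n - 1)) %/ 2))%N]) /\
  isomorphic (P_quot U) (weighted_proj_space F (fun i : 'I_n => (q ^ i)%N)).
Proof.
have [gs [gs_inj gsU Ugs]] := flag_pred_enum x_free.
have gs_ker j : lker (gs j) == 0%VS by exact: flag_pred_ker (gsU j).
have gs_U j : aut_set U (gs j) by exact/UE.
have U_gs h : aut_set U h -> exists j, gs j = h by move/UE/Ugs.
have gQ h (i : 'I_n) : flag_pred x h -> act h (g i) = g i.
  by move=> hh; case: (act_flag hh (ltn_ord i)).
have fP h (i : 'I_n) : flag_pred x h -> act h (f i) = f i.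
  by move=> hh; case: (act_flag hh (ltn_ord i)).
have Ag (i : 'I_n) : recAlg V 1%N (g i).
  exact: (gx_deg lD lZ l0 x_free (@rec_linform F V)).
have Af (i : 'I_n) : symAlg V (q ^ i)%N (f i).
  exact: (fx_deg lD lZ l0 x_free (@sym_linform F V)).
split; last first.
  apply: (acted_quotient sym_acted Af _ gs_inj gs_ker _ spanP gs_U) => [i|j i|h /UE hU i].
  - by rewrite expn_gt0 ltnW.
  - exact: fP.
  - exact: fP.
have d0 : forall i : 'I_n, (0 < 1)%N by [].
have gsg j (i : 'I_n) : act (gs j) (g i) = g i by exact: gQ.
have Ug h : aut_set U h -> forall i : 'I_n, act h (g i) = g i by move=> /UE hU i; exact: gQ.
split; first exact: (acted_quotient rec_acted Ag d0 gs_inj gs_ker gsg spanQ gs_U Ug).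
have -> : (q ^ ((n * (n - 1)) %/ 2) = \prod_(i < n) q ^ i)%N.
  by rewrite prod_expn bin2 divn2 subn1.
exact: (acted_quotient_map rec_acted Ag gs_inj gs_ker gsg spanQ gs_U Ug (fun _ => erefl) U_gs).
Qed.

End Unipotent.

Hypothesis n_gt0 : (0 < n)%N.

Lemma linear_quotients :
  isomorphic (Q_quot (GL_V V))
    (weighted_proj_space F (fun i : 'I_n => (q ^ i.+1 - 1)%N)) /\
  isomorphic (P_quot (GL_V V))
    (weighted_proj_space F (fun i : 'I_n => (q ^ n - q ^ i)%N)) /\
  isomorphic (Q_quot (SL_V V))
    (weighted_proj_space F (fun i : 'I_n =>
       if i.+1 == n then ((q ^ n - 1) %/ (q - 1))%N else (q ^ i.+1 - 1)%N)) /\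
  isomorphic (P_quot (SL_V V))
    (weighted_proj_space F (fun i : 'I_n =>
       if i == 0%N :> nat then ((q ^ n - 1) %/ (q - 1))%N
       else (q ^ n - q ^ i)%N)).
Proof.
have [gs [gs_inj gs_ker]] := GL_enum n_gt0.
pose bQ (i : 'I_n) := dc i.+1; pose bP (i : 'I_n) := cc i.
have GQ h : lker h == 0%VS -> forall i, act h (bQ i) = bQ i.
  by move=> kh i; case: (act_GL i.+1 kh).
have GP h : lker h == 0%VS -> forall i, act h (bP i) = bP i.
  by move=> kh i; case: (act_GL i kh).
have AQ (i : 'I_n) : recAlg V (q ^ i.+1 - 1)%N (bQ i).
  exact: (dcoef_deg lD lZ l0 x_free
    (@rec_linform F V) _ (leqnn n)).
have AP (i : 'I_n) : symAlg V (q ^ n - q ^ i)%N (bP i).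
  exact: (ccoef_deg lD lZ l0 x_free
    (@sym_linform F V) (leqnn n) (ltnW (ltn_ord i))).
have dQ (i : 'I_n) : (0 < q ^ i.+1 - 1)%N by rewrite subn_gt0 -[1%N](expn0 q) ltn_exp2l.
have dP (i : 'I_n) : (0 < q ^ n - q ^ i)%N by rewrite subn_gt0 ltn_exp2l.
have sQ := spanQG; rewrite prod_rev prod_expn mulnC in sQ.
have sP := spanPG; rewrite prod_gaussian ?(ltnW q1) // in sP.
have gQ j i : act (gs j) (bQ i) = bQ i by exact: GQ.
have gP j i : act (gs j) (bP i) = bP i by exact: GP.
split; first exact: (acted_quotient rec_acted AQ dQ gs_inj gs_ker gQ sQ (H := GL_V V) gs_ker GQ).
split; first exact: (acted_quotient sym_acted AP dP gs_inj gs_ker gP sP (H := GL_V V) gs_ker GP).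
(* By moore_det an automorphism multiplies this product by its determinant. *)
pose l := \prod_(i < n) f i.
have lam0 : l != 0.
  apply/prodf_neq0 => i _.
  exact: (fx_neq0 lD lZ l0 x_free).
have actl h : lker h == 0%VS -> act h l = kc (det h) * l.
  move=> kh; rewrite /l.
  rewrite -(moore_det lD lZ l0 x_free).
  exact: act_moore_det.
have lX : l ^+ (q - 1) = kc ((-1) ^+ n) * cc 0%N.
  rewrite rmorphXn rmorphN1.
  exact: (prod_fx lD lZ l0 x_free).
have sgn0 : (-1) ^+ n != 0 :> F by rewrite signr_eq0.
have dl0 : (0 < (q ^ n - 1) %/ (q - 1))%N.
  by rewrite -(sum_expn n q1) -(prednK n_gt0) big_ord_recl expn0.
split.
- have AfV (i : 'I_n) : recAlg V (q ^ i)%N (f i)^-1.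
    exact: (fx_recip_deg lD lZ l0 x_free
      (@rec_linform F V)).
  have ilast : (n.-1 < n)%N by rewrite prednK.
  pose i1 : 'I_n := Ordinal ilast.
  have Al : recAlg V ((q ^ n - 1) %/ (q - 1))%N l^-1.
    rewrite -(sum_expn n q1) /l -prodfV.
    apply: (big_rec2 (fun t u => recAlg V t u)) => [|i t u _ Au]; first exact: comp_one.
    exact: comp_mul.
  have actV' h : lker h == 0%VS -> act h l^-1 = kc (det h)^-1 * l^-1.
    by move=> kh; rewrite actV // actl // invfM fmorphV.
  have lVX : l^-1 ^+ (q - 1) = kc ((-1) ^+ n) * bQ i1.
    rewrite exprVn lX invfM -fmorphV invr_sign /bQ /= prednK //; congr (_ * _).
    by rewrite /cc /ccoef dcoef0 div1r invrK.
  have := acted_SL_quotient rec_acted AQ dQ GQ gs_inj gs_ker sQ (psi := GRing.inv) (@invfM F)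
    (@invrK F) (invr0 F) _ sgn0 Al dl0 actV' lVX.
  rewrite invr_eq0 => /(_ lam0).
  suff -> : (fun i : 'I_n => if i == i1 then ((q ^ n - 1) %/ (q - 1))%N else (q ^ i.+1 - 1)%N) =
    (fun i : 'I_n => if i.+1 == n then ((q ^ n - 1) %/ (q - 1))%N else (q ^ i.+1 - 1)%N) by [].
  apply/funext => i; have -> // : (i == i1) = (i.+1 == n).
  by rewrite -(inj_eq val_inj) /= -eqSS prednK.
- pose i1 : 'I_n := Ordinal n_gt0.
  have Af (i : 'I_n) : symAlg V (q ^ i)%N (f i).
    exact: (fx_deg lD lZ l0 x_free
      (@sym_linform F V)).
  have Al : symAlg V ((q ^ n - 1) %/ (q - 1))%N l.
    rewrite -(sum_expn n q1).
    apply: (big_rec2 (fun t u => symAlg V t u)) => [|i t u _ Au]; first exact: comp_one.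
    exact: comp_mul.
  exact: (acted_SL_quotient sym_acted AP dP GP gs_inj gs_ker sP (psi := id) (fun _ _ => erefl)
    (fun _ => erefl) erefl lam0 sgn0 Al dl0 actl (i1 := i1) lX).
Qed.

End FlagQuotients.

Theorem theorem3p2 (F : finFieldType) (V : vectType F) (r : nat)
    (dimV : \dim {:V} = r) (r_gt0 : (0 < r)%N)
    (U : autSubgroup V) (maxU : maximal_unipotent U) :
  let q := #|F| in
  (isomorphic (Q_quot U) (proj_space F r) /\
   exists pi : morphism (Q_space V) (Q_quot U),
     [/\ induced_by_inclusion pi, finite_morphism pi, flat pi &
         has_degree pi (q ^ ((r * (r - 1)) %/ 2))%N]) /\
  isomorphic (P_quot U)
    (weighted_proj_space F (fun i : 'I_r => (q ^ i)%N)) /\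
  isomorphic (Q_quot (GL_V V))
    (weighted_proj_space F (fun i : 'I_r => (q ^ i.+1 - 1)%N)) /\
  isomorphic (P_quot (GL_V V))
    (weighted_proj_space F (fun i : 'I_r => (q ^ r - q ^ i)%N)) /\
  isomorphic (Q_quot (SL_V V))
    (weighted_proj_space F (fun i : 'I_r =>
       if i.+1 == r then ((q ^ r - 1) %/ (q - 1))%N else (q ^ i.+1 - 1)%N)) /\
  isomorphic (P_quot (SL_V V))
    (weighted_proj_space F (fun i : 'I_r =>
       if i == 0%N :> nat then ((q ^ r - 1) %/ (q - 1))%N
       else (q ^ r - q ^ i)%N)).
Proof.
subst r; have [x [x_free UE]] := maximal_unipotent_flag maxU.
have [QU PU] := unipotent_quotients x_free UE.
have [QG [PG [QS PS]]] := linear_quotients x_free r_gt0.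
by split; [exact: QU|split; [exact: PU|do ![split; first by []]]].
Qed.
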